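(* Let $(\varepsilon_k)_{k\ge0}$ be independent and identically distributed random variables with $\mathbb{P}(\varepsilon_k=1)=\mathbb{P}(\varepsilon_k=-1)=\tfrac12$, and let $$F(z)=\sum_{k=0}^\infty\varepsilon_kz^k,\qquad F_n(z)=\sum_{k=0}^n\varepsilon_kz^k .$$ Let $R_n=\{z\in\mathbb{D}: F_n(z)+z^{n+1}f(z)=0\text{ for some }f\in\mathcal{L}_\infty\}$. Then, as $n\to\infty$, $$\Big\{\big(\alpha,T_{n,\alpha}(R_n)\big):\alpha\in\mathcal{Z}(F_n)\Big\}\longrightarrow\Big\{\big(\alpha,\mathcal{D}_\alpha\big):\alpha\in\mathcal{Z}(F)\Big\}$$ in distribution, with respect to the vague topology on (tagged) point processes on $\mathbb{D}\times\mathbf{CL}(\mathbb{C})$, where $\mathcal{D}_\alpha=F'(\alpha)^{-1}D_\alpha$ for $\alpha\in\mathcal{Z}(F)$ (almost surely $F'(\alpha)\neq0$ for all such $\alpha$).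
   Context: $\mathbb{D}=\{z\in\mathbb{C}:|z|<1\}$. $\mathcal{L}_\infty$ is the set of power series $\sum_{k\ge0}a_kz^k$ with all $a_k\in\{-1,+1\}$, viewed as analytic functions on $\mathbb{D}$. For an analytic function $g$ on $\mathbb{D}$, $\mathcal{Z}(g)$ is the multiset of its zeros in $\mathbb{D}$. For $\xi\in\mathbb{D}\setminus\{0\}$, $T_{n,\xi}(z)=(z-\xi)/\xi^{n+1}$, and $T_{n,\xi}(A)$ is the image of $A$. For $\alpha\in\mathbb{D}$, the dragon curve $D_\alpha\subset\mathbb{C}$ is the unique non-empty compact set with $D_\alpha=\phi_+(D_\alpha)\cup\phi_-(D_\alpha)$, where $\phi_\pm(w)=\pm1+\alpha w$; equivalently $D_\alpha=\{f(\alpha):f\in\mathcal{L}_\infty\}$. $\mathbf{CL}(\mathbb{C})$ is the collection of non-empty closed subsets of $\mathbb{C}$, equipped with the Fell topology. Convergence of a sequence $(A_n)$ in this topology is Kuratowski convergence: with $$\mathrm{Li}(A_n)=\{z\in\mathbb{C}:\limsup_{n\to\infty}\mathrm{dist}(z,A_n)=0\},\qquad \mathrm{Ls}(A_n)=\{z\in\mathbb{C}:\liminf_{n\to\infty}\mathrm{dist}(z,A_n)=0\},$$ $A_n\to A$ if and only if $\mathrm{Li}(A_n)=\mathrm{Ls}(A_n)=A$; here $\mathrm{dist}(z,A)=\inf_{a\in A}|z-a|$. The set $T_{n,\alpha}(R_n)$ is regarded as an element of $\mathbf{CL}(\mathbb{C})$ by identifying it with its closure in $\mathbb{C}$. The convergence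 in distribution of point processes in the vague topology means: for every continuous compactly supported function $g:\mathbb{D}\times\mathbf{CL}(\mathbb{C})\to\mathbb{R}$, $$\sum_{\alpha\in\mathcal{Z}(F_n)}g\big(\alpha,T_{n,\alpha}(R_n)\big)\xrightarrow[n\to\infty]{d}\sum_{\alpha\in\mathcal{Z}(F)}g\big(\alpha,\mathcal{D}_\alpha\big)$$ in distribution as real random variables. *)

(* Defs.v *)
From HB Require Import structures.
From mathcomp Require Import all_boot all_order all_algebra.
From mathcomp Require Import all_classical all_reals all_analysis.
From mathcomp Require Export complex.

Set Implicit Arguments.
Unset Strict Implicit.
Unset Printing Implicit Defensive.

Import Order.TTheory GRing.Theory Num.Theory.
Import numFieldNormedType.Exports.

Local Open Scope classical_set_scope.
Local Open Scope ring_scope.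

(* [R[i]] carries its [R]-module structure; packing it as a
   [numClosedFieldType] makes the generic norm, topology and (complex)
   [R[i]]-module structures of numeric fields apply instead. *)
Definition Cx (R : realType) : numClosedFieldType := R[i]%C.
Arguments Cx : simpl never.

Definition embC (R : realType) (x : R) : Cx R := x%:C%C.

Section hyperspace.
Variable T : topologicalType.

Record hyperspace := Hyperspace {
  hyper_set :> set T ;
  hyper_closed : closed hyper_set ;
  hyper_nonempty : hyper_set !=set0 }.

HB.instance Definition _ := gen_eqMixin hyperspace.
HB.instance Definition _ := gen_choiceMixin hyperspace.

(* Subbase of the Fell topology: closed sets hitting an open set, closed sets
   missing a compact set. *)
Definition fell_subbase : set (set hyperspace) :=
  [set H | (exists2 U : set T, open U &
              H = [set A : hyperspace | hyper_set A `&` U !=set0]) \/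
           (exists2 K : set T, compact K &
              H = [set A : hyperspace | hyper_set A `&` K = set0])].

HB.instance Definition _ :=
  isSubBaseTopological.Build hyperspace fell_subbase id.

End hyperspace.

Lemma closure_neq0 (T : topologicalType) (A : set T) :
  A !=set0 -> closure A !=set0.
Proof. by move=> [x Ax]; exists x; exact: subset_closure. Qed.

Lemma setT_pointed_neq0 (T : ptopologicalType) : [set: T] !=set0.
Proof. by exists point. Qed.

(* A set is identified with its closure; the value at [set0], which has no
   counterpart in [hyperspace T], is arbitrary. *)
Definition hyper_of_set (T : ptopologicalType) (A : set T) : hyperspace T :=
  if pselect (A !=set0) is left A0
  then Hyperspace (@closed_closure T A) (closure_neq0 A0)
  else Hyperspace (@closedT T) (setT_pointed_neq0 T).

Section analytic.
Context {R : realType}.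
Local Notation C := (Cx R).

Definition disk : set C := [set z | `|z| < 1].

Definition power_series (a : nat -> C) (z : C) : C :=
  limn [series a k * z ^+ k]_k.

Definition littlewood_series : set (C -> C) :=
  [set f | exists2 a : nat -> C,
     (forall k, a k = 1 \/ a k = - 1) & f = power_series a].

(* Analytic functions on the disk are represented by functions on the whole of
   [C]; only their values on [disk] matter. *)
Definition zeros (f : C -> C) : set C := [set z | disk z /\ f z = 0].

Definition vanishes_to_order (f : C -> C) (z : C) (m : nat) : Prop :=
  (forall j, (j < m)%N -> derive1n j f z = 0) /\ derive1n m f z != 0.

(* [0] when [f] vanishes identically near [z]. *)
Definition multiplicity (f : C -> C) (z : C) : nat :=
  get (vanishes_to_order f z).

(* Sum over the multiset of zeros. It is [0] by convention if infinitely many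
   terms are nonzero, which cannot happen if [f] is analytic and not
   identically zero on the disk and [phi] vanishes off a compact subset of
   it. *)
Definition sum_zeros (f : C -> C) (phi : C -> R) : R :=
  \sum_(z \in zeros f) (phi z *+ multiplicity f z).

Definition rescale (n : nat) (xi z : C) : C := (z - xi) / xi ^+ n.+1.

Definition is_dragon (alpha : C) (D : set C) : Prop :=
  [/\ D !=set0, compact D &
      D = [set 1 + alpha * w | w in D] `|` [set - 1 + alpha * w | w in D]].

(* The unique set [D] with [is_dragon alpha D], for [alpha] in [disk]. *)
Definition dragon (alpha : C) : set C := get (is_dragon alpha).

Definition F_series (e : nat -> R) : C -> C :=
  power_series (fun k => embC (e k)).

Definition F_trunc (e : nat -> R) (n : nat) (z : C) : C :=
  \sum_(k < n.+1) embC (e k) * z ^+ k.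

Definition roots_ext (e : nat -> R) (n : nat) : set C :=
  [set z | disk z /\
     exists2 f, littlewood_series f & F_trunc e n z + z ^+ n.+1 * f z = 0].

(* [F_trunc e n] does not vanish at [0] and [roots_ext e n] is nonempty as soon
   as it has a zero in [disk], for [e] with values in {-1, 1}. *)
Definition tag_trunc (e : nat -> R) (n : nat) (alpha : C) : hyperspace C :=
  hyper_of_set (rescale n alpha @` roots_ext e n).

Definition tag_limit (e : nat -> R) (alpha : C) : hyperspace C :=
  hyper_of_set [set (derive1 (F_series e) alpha)^-1 * w | w in dragon alpha].

Definition test_function (g : C * hyperspace C -> R) : Prop :=
  {within disk `*` [set: hyperspace C], continuous g} /\
  exists K : set (C * hyperspace C),
    [/\ compact K, K `<=` disk `*` [set: hyperspace C] &
        forall p, disk p.1 -> ~ K p -> g p = 0].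

End analytic.

Section probability.
Context {d : measure_display} {Omega : measurableType d} {R : realType}.
Variable P : probability Omega R.

Definition mutually_independent (X : nat -> Omega -> R) : Prop :=
  forall (s : seq nat) (B : nat -> set R), uniq s ->
    (forall k, measurable (B k)) ->
    P (\bigcap_(k in [set` s]) (X k @^-1` B k)) =
    (\prod_(k <- s) P (X k @^-1` B k))%E.

Definition ae_random_variable (X : Omega -> R) : Prop :=
  exists2 Y : Omega -> R, measurable_fun [set: Omega] Y &
    {ae P, forall w, X w = Y w}.

(* Variables that are only defined almost surely are given arbitrary values
   elsewhere, hence measurability is required up to a null set; the
   expectations do not depend on these values. *)
Definition cvg_in_distribution (X : nat -> Omega -> R) (Y : Omega -> R) : Prop :=
  [/\ forall n, ae_random_variable (X n),
      ae_random_variable Y &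
      forall h : R -> R, continuous h -> bounded_fun h ->
        ('E_P[h \o X n] @[n --> \oo] --> 'E_P[h \o Y])%E].

End probability.

(* Main.v *)
Require Import Defs.
From HB Require Import structures.
From mathcomp Require Import all_boot all_order all_algebra.
From mathcomp Require Import all_classical all_reals all_analysis.
From mathcomp Require Import measurable_realfun ring lra.

(* The sums over the zeros of F_n converge almost surely to the sum over the
   zeros of F, hence in distribution by dominated convergence; the former are
   functions of finitely many signs, which gives measurability.

   For a fixed sequence of signs such that all zeros of F are simple, near each
   zero al of F there is exactly one zero z_n of F_n for large n, and it tends
   to al. In the coordinate u with z = z_n + z_n^(n+1) u, the equation
   F_n(z) + z^(n+1) f(z) = 0 divided by z_n^(n+1) becomes F'(al) u + f(al) = 0
   up to an error which is uniform in f and in bounded u, so Newton's iteration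
   transfers solutions both ways and the rescaled sets converge to
   F'(al)^-1 D_al in the Fell topology.

   Double zeros do not occur almost surely. If F(al) = F'(al) = 0 with
   s < |al| < r and r^2 < s, consider the first derivative of the truncation
   F_N which is not small at al (it exists by Jensen's inequality). The
   preceding derivative then has a root be within distance O(N r^N) of al, and
   F(be) = O(N^2 r^(2N)) is smaller than s^N. The root be is determined by the
   first N signs, up to at most N^2 choices. Given these, the following B signs
   put F(be) in such a small disk with probability at most 2^-J by a
   Littlewood-Offord argument, where N and B are multiples of J. Hence the
   event has probability at most O(J^2 2^-J) for every J. *)

Set Implicit Arguments.
Unset Strict Implicit.
Unset Printing Implicit Defensive.

Import Order.TTheory GRing.Theory Num.Theory.
Import numFieldNormedType.Exports.

Local Open Scope classical_set_scope.
Local Open Scope ring_scope.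

(** The estimates are stated for power series with coefficients bounded by 1, with constants that
    depend only on radii. This class contains F, the truncations F_n (completed by zeros) and all
    the F_n + z^(n+1) f, so a single contraction estimate near a simple zero serves all of them, and
    Newton's iteration yields existence, uniqueness and location of their zeros. For double zeros
    the obstacle is that al depends on all the signs, so that no randomness is left once al is
    given. If F vanishes at al to order m, its derivative of order m - 1 has a simple zero there,
    which can be traced to a root of a polynomial in the first N signs; the later signs remain free.
    The value F(be) is quadratic in the distance from be to al because F and F' vanish at al; it has
    to be compared with s^N because the later signs enter F(be) with the factor be^N. *)

(** * The real-valued modulus on the complex numbers and its topology *)

Section modulus.
Context {R : realType}.
Local Notation C := (Cx R).
Implicit Types (z w : C) (x y : R).

(* The norm of [C] takes its values in [C] itself. *)
Definition absC (z : C) : R := complex.Re `|z|.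

Lemma embC_inj : injective (@embC R). Proof. by move=> x y []. Qed.

Lemma embCD x y : embC (x + y) = embC x + embC y.
Proof. exact: (rmorphD (real_complex R)). Qed.

Lemma embCM x y : embC (x * y) = embC x * embC y.
Proof. exact: (rmorphM (real_complex R)). Qed.

Lemma embCN x : embC (- x) = - embC x.
Proof. exact: (rmorphN (real_complex R)). Qed.

Lemma embC0 : embC 0 = 0 :> C. Proof. by []. Qed.
Lemma embC1 : embC 1 = 1 :> C. Proof. by []. Qed.

Lemma ler_embC x y : (embC x <= embC y) = (x <= y).
Proof. exact: lecR. Qed.

Lemma ltr_embC x y : (embC x < embC y) = (x < y).
Proof. exact: ltcR. Qed.

Lemma normE z : `|z| = embC (absC z).
Proof. by rewrite /absC; have -> := normc_def (z : R[i]%C). Qed.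

Lemma gt0_embC (e : C) : 0 < e -> exists2 x : R, 0 < x & e = embC x.
Proof.
by case: e => a b; rewrite ltcE /= => /andP[/eqP-> a0]; exists a.
Qed.

Lemma absC_ge0 z : 0 <= absC z.
Proof. by rewrite -ler_embC -normE embC0 normr_ge0. Qed.

Lemma absC_eq0 z : (absC z == 0) = (z == 0).
Proof. by rewrite -[RHS]normr_eq0 normE -(inj_eq embC_inj). Qed.

Lemma absC_gt0 z : (0 < absC z) = (z != 0).
Proof. by rewrite lt_neqAle absC_ge0 andbT eq_sym absC_eq0. Qed.

Lemma absC0 : absC 0 = 0. Proof. by apply/eqP; rewrite absC_eq0. Qed.

Lemma absCM z w : absC (z * w) = absC z * absC w.
Proof. by apply: embC_inj; rewrite embCM -!normE normrM. Qed.

Lemma absC1 : absC 1 = 1.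
Proof. by apply: embC_inj; rewrite -normE normr1 embC1. Qed.

Lemma absCX z n : absC (z ^+ n) = absC z ^+ n.
Proof. by elim: n => [|n IH]; rewrite ?expr0 ?absC1// !exprS absCM IH. Qed.

Lemma absCV z : absC z^-1 = (absC z)^-1.
Proof.
have [->|z0] := eqVneq z 0; first by rewrite invr0 absC0 invr0.
by apply/(mulfI (x := absC z)); rewrite ?absC_eq0// -absCM !mulfV ?absC1 ?absC_eq0.
Qed.

Lemma absCN z : absC (- z) = absC z.
Proof. by apply: embC_inj; rewrite -!normE normrN. Qed.

Lemma absCB z w : absC (z - w) = absC (w - z).
Proof. by rewrite -absCN opprB. Qed.

Lemma absCD z w : absC (z + w) <= absC z + absC w.
Proof. by rewrite -ler_embC embCD -!normE ler_normD. Qed.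

Lemma absC_triangle z w v : absC (z - w) <= absC (z - v) + absC (v - w).
Proof. by apply: le_trans (absCD _ _); rewrite addrA subrK. Qed.

Lemma absC_lerB z w : absC z - absC w <= absC (z - w).
Proof. by rewrite lerBlDr -{1}(subrK w z) absCD. Qed.

Lemma absC_emb x : absC (embC x) = `|x|.
Proof.
rewrite /absC; have -> := normc_def (embC x : R[i]%C).
by rewrite /= expr0n addr0 sqrtr_sqr.
Qed.

Lemma absC_nat n : absC n%:R = n%:R.
Proof.
rewrite -[RHS]ger0_norm// -absC_emb; congr absC; apply/esym.
exact: (rmorph_nat (real_complex R)).
Qed.

Lemma absC_sum (I : Type) (s : seq I) (Q : pred I) (F : I -> C) :
  absC (\sum_(i <- s | Q i) F i) <= \sum_(i <- s | Q i) absC (F i).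
Proof.
elim/big_ind2 : _ => [|z1 x1 z2 x2 h1 h2|//]; first by rewrite absC0.
by apply: (le_trans (absCD _ _)); exact: lerD.
Qed.

Lemma diskE z : disk z <-> absC z < 1.
Proof. by rewrite /disk /= normE -embC1 ltr_embC. Qed.

Lemma nbhs_absC z (A : set C) :
  nbhs z A <-> exists2 e : R, 0 < e & forall w, absC (z - w) < e -> A w.
Proof.
split.
  case/nbhs_ballP => e /= e0 eA; have [x x0 ex] := gt0_embC e0.
  by exists x => // w zw; apply: eA; rewrite /ball/= normE ex ltr_embC.
case=> e e0 eA; apply/nbhs_ballP; exists (embC e) => /=.
  by rewrite -embC0 ltr_embC.
by move=> w; rewrite /ball/= normE ltr_embC; exact: eA.
Qed.

Lemma cvg_absC {T} {F : set_system T} {FF : Filter F} (u : T -> C) z :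
  (u @ F --> z) <-> (forall e : R, 0 < e -> \forall n \near F, absC (z - u n) < e).
Proof.
split=> [uz e e0|h A].
  by apply: (uz [set w | absC (z - w) < e]); apply/nbhs_absC; exists e.
case/nbhs_absC => e e0 eA; have := h e e0; apply: filterS => n; exact: eA.
Qed.

Lemma absC_continuous : continuous absC.
Proof.
move=> z A /nbhs_ballP[e /= e0 eA]; apply/nbhs_absC; exists e => // w zw.
apply: eA; rewrite /ball/=; apply: le_lt_trans zw; rewrite ler_norml absC_lerB andbT.
by rewrite lerNl opprB absCB absC_lerB.
Qed.

Lemma absC_ge_Re z : `|complex.Re z| <= absC z.
Proof. by rewrite -lecR; exact: (normc_ge_Re z). Qed.

Lemma absC_ge_Im z : `|complex.Im z| <= absC z.
Proof.
have -> : absC z = absC (z * (Complex 0 1 : C)).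
  rewrite absCM (_ : absC (Complex 0 1 : C) = 1) ?mulr1//.
  rewrite /absC; have -> := normc_def (Complex 0 1 : R[i]%C).
  by rewrite /= expr0n add0r expr1n sqrtr1.
by apply: le_trans (absC_ge_Re _); have -> := ReiNIm z; rewrite normrN.
Qed.

Lemma absC_le_ReIm z : absC z <= `|complex.Re z| + `|complex.Im z|.
Proof.
have -> : absC z = absC (embC (complex.Re z) + (Complex 0 1 : C) * embC (complex.Im z)).
  by congr absC; exact: (complexE z).
apply: (le_trans (absCD _ _)); rewrite absCM !absC_emb (_ : absC (Complex 0 1) = 1) ?mul1r//.
rewrite /absC; have -> := normc_def (Complex 0 1 : R[i]%C).
by rewrite /= expr0n add0r expr1n sqrtr1.
Qed.

Lemma ReB z w : complex.Re (z - w) = complex.Re z - complex.Re w.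
Proof. by case: z; case: w. Qed.

Lemma ImB z w : complex.Im (z - w) = complex.Im z - complex.Im w.
Proof. by case: z; case: w. Qed.

Lemma cvg_Complex {T} {F : set_system T} {FF : Filter F} (f g : T -> R) x y :
  f @ F --> x -> g @ F --> y ->
  (fun t => Complex (f t) (g t) : C) @ F --> (Complex x y : C).
Proof.
move=> fx gy; apply/cvg_absC => e e0; have e20 : 0 < e / 2 by rewrite divr_gt0.
near=> t; apply: le_lt_trans (absC_le_ReIm _) _; rewrite ReB ImB /=.
rewrite [ltRHS]splitr; apply: ltrD; near: t.
  by have/cvgrPdist_lt := fx; apply.
by have/cvgrPdist_lt := gy; apply.
Unshelve. all: by end_near. Qed.

Lemma C_cauchy_cvg (u : nat -> C) :
  (forall e : R, 0 < e -> exists N, forall m n, (N <= m)%N -> (N <= n)%N ->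
     absC (u m - u n) < e) ->
  exists l : C, u @ \oo --> l.
Proof.
move=> cu.
have aux (f : C -> R) : (forall z w, `|f z - f w| <= absC (z - w)) ->
    cvgn (fun n => f (u n)).
  move=> fl; apply/cauchy_cvgP/cauchy_exP => e e0; have [N NP] := cu e e0.
  exists (f (u N)); exists N => // n /= Nn; rewrite /ball/=.
  by apply: le_lt_trans (fl _ _) _; exact: NP.
have /cvg_ex[x hx] : cvgn (fun n => complex.Re (u n)).
  by apply: (aux (@complex.Re R)) => z w; rewrite -ReB absC_ge_Re.
have /cvg_ex[y hy] : cvgn (fun n => complex.Im (u n)).
  by apply: (aux (@complex.Im R)) => z w; rewrite -ImB absC_ge_Im.
exists (Complex x y); rewrite (_ : u = (fun n => Complex (complex.Re (u n)) (complex.Im (u n)))).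
  exact: cvg_Complex hx hy.
by apply/funext => n; case: (u n).
Qed.

Lemma absC_lim_le {T} {F : set_system T} {FF : ProperFilter F} (u : T -> C) z B :
  u @ F --> z -> (\forall n \near F, absC (u n) <= B) -> absC z <= B.
Proof.
move=> uz uB; apply/ler_addgt0Pr => e e0.
have /filter_ex[n [h1 h2]] : \forall n \near F, absC (u n) <= B /\ absC (z - u n) < e.
  by near=> n; split; near: n => //; move/cvg_absC : uz; exact.
apply: le_trans (_ : absC (z - u n) + absC (u n) <= _).
  by rewrite -{1}(subrK (u n) z) absCD.
by rewrite addrC lerD// ltW.
Unshelve. all: by end_near. Qed.

Lemma cdisk_compact (r : R) : compact [set z : C | absC z <= r].
Proof.
pose f (p : R * R) : C := Complex p.1 p.2.
have cf : continuous f.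
  move=> p; apply: cvg_Complex; [exact: cvg_fst|exact: cvg_snd].
have cK : compact (`[- r, r] `*` `[- r, r]).
  by apply: compact_setX; exact: segment_compact.
apply: (@subclosed_compact _ _ (f @` (`[- r, r] `*` `[- r, r]))).
- rewrite (_ : [set z | _] = absC @^-1` [set x | x <= r])//.
  by apply: closed_comp => [z _|]; [exact: absC_continuous|exact: closed_le].
- by apply: continuous_compact => //; exact: continuous_subspaceT.
- move=> z /= zr; exists (complex.Re z, complex.Im z); last by case: z {zr}.
  split=> /=; rewrite in_itv/= -ler_norml; apply: le_trans zr.
    exact: absC_ge_Re.
  exact: absC_ge_Im.
Qed.

End modulus.

(** * Uniform estimates for series with bounded coefficients *)

Section bounded_coefficients.
Context {R : realType}.
Local Notation C := (Cx R).
Implicit Types (a b : nat -> C) (z w v : C) (r x rho M : R).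

(** The full series sums to the bound. By Pascal's rule the partial sums satisfy S_(j+1)(n+1) =
    S_j(n+1) + x S_(j+1)(n), and the bound solves this recursion. *)
Lemma sum_bin_le x j n : 0 <= x -> x < 1 ->
  \sum_(k < n) 'C(k + j, j)%:R * x ^+ k <= (1 - x)^-1 ^+ j.+1.
Proof.
move=> x0 x1; have y0 : 0 < 1 - x by rewrite subr_gt0.
have yV : (1 - x) * (1 - x)^-1 = 1 by rewrite mulfV// gt_eqF.
have V0 : 0 <= (1 - x)^-1 by rewrite invr_ge0 ltW.
elim: j n => [|j IHj] n.
  rewrite expr1 -(ler_pM2l y0) yV.
  under eq_bigr do rewrite addn0 bin0 mul1r.
  by rewrite -[1 - x]opprB mulNr -subrX1 opprB gerBl exprn_ge0.
elim: n => [|n IHn]; first by rewrite big_ord0 exprn_ge0.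
have -> : \sum_(k < n.+1) 'C(k + j.+1, j.+1)%:R * x ^+ k =
    \sum_(k < n.+1) 'C(k + j, j)%:R * x ^+ k +
    x * \sum_(k < n) 'C(k + j.+1, j.+1)%:R * x ^+ k.
  under eq_bigr do rewrite addnS binS natrD mulrDl.
  rewrite big_split /= addrC; congr (_ + _).
  rewrite big_ord_recl/= add0n bin_small// mul0r add0r mulr_sumr.
  by apply: eq_bigr => k _; rewrite /bump/= add1n addSn addnS exprS mulrCA.
apply: le_trans (lerD (IHj _) (ler_wpM2l x0 IHn)) _.
rewrite -{1}[_ ^+ j.+1]mul1r -{1}yV -mulrA -exprS -mulrDl subrK mul1r//.
Qed.

Definition psum a n z : C := \sum_(k < n) a k * z ^+ k.

(* [power_series (dcoef j a)] is the [j]-th derivative of [power_series a]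
   divided by [j`!]. *)
Definition dcoef j a k : C := 'C(k + j, j)%:R * a (k + j)%N.

(** Unlike the sequences of signs, this class is stable under completion by zeros, so that estimates
    for series also cover polynomials. *)
Definition bounded_by1 a := forall k, absC (a k) <= 1.

Lemma dcoef0 a : dcoef 0 a = a.
Proof. by apply/funext => k; rewrite /dcoef addn0 bin0 mul1r. Qed.

Lemma psumS a n z : psum a n.+1 z = psum a n z + a n * z ^+ n.
Proof. by rewrite /psum big_ord_recr. Qed.

Lemma psumE a z : [series a k * z ^+ k]_k = psum a ^~ z.
Proof. by apply/funext => n; rewrite /psum /series/= big_mkord. Qed.

(** The binomial factor is paid for by enlarging the radius: ['C(k + j, j) * (r / rho) ^+ k] is one
    term of the sum in [sum_bin_le], hence bounded, and what remains is a geometric tail in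
    [rho]. *)
Lemma psum_dcoef_tail j a r rho z m n : bounded_by1 a -> absC z <= r -> r < rho ->
  rho < 1 -> (m <= n)%N ->
  absC (psum (dcoef j a) n z - psum (dcoef j a) m z) <=
  (1 - r / rho)^-1 ^+ j.+1 * (1 - rho)^-1 * rho ^+ m.
Proof.
move=> a1 zr rrho rho1 /subnKC <-.
have r0 : 0 <= r by apply: le_trans zr; exact: absC_ge0.
have rho0 : 0 < rho by exact: le_lt_trans rrho.
have x0 : 0 <= r / rho by rewrite divr_ge0// ltW.
have x1 : r / rho < 1 by rewrite ltr_pdivrMr// mul1r.
set K := (1 - r / rho)^-1 ^+ j.+1.
have K0 : 0 <= K by rewrite exprn_ge0// invr_ge0 subr_ge0 ltW.
have term k : absC (dcoef j a k * z ^+ k) <= K * rho ^+ k.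
  rewrite !absCM absC_nat absCX.
  have : 'C(k + j, j)%:R * (r / rho) ^+ k <= K.
    apply: le_trans (sum_bin_le j k.+1 x0 x1).
    by rewrite big_ord_recr/= lerDr sumr_ge0// => i _; rewrite mulr_ge0// exprn_ge0.
  rewrite expr_div_n mulrA ler_pdivrMr ?exprn_gt0// => h.
  apply: le_trans h; rewrite ler_pM ?mulr_ge0 ?absC_ge0 ?exprn_ge0 ?absC_ge0//.
    by rewrite ler_piMr.
  by rewrite lerXn2r// nnegrE absC_ge0.
rewrite /psum big_split_ord/= [X in absC X]addrAC subrr add0r.
apply: (le_trans (absC_sum _ _ _)).
apply: (le_trans (ler_sum _ (fun i _ => term _))).
under eq_bigr do rewrite exprD mulrA.
rewrite -mulr_sumr [leRHS]mulrAC; apply: ler_wpM2l; first by rewrite mulr_ge0// exprn_ge0// ltW.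
have := sum_bin_le 0 (n - m) (ltW rho0) rho1; rewrite expr1.
by under eq_bigr do rewrite addn0 bin0 mul1r.
Qed.

Lemma cvg_geo_mul (K x : R) : 0 <= x -> x < 1 -> (fun n => K * x ^+ n) @ \oo --> (0 : R).
Proof.
move=> x0 x1; rewrite -[X in _ --> X](mulr0 K); apply: cvgMr.
by apply: cvg_expr; rewrite ger0_norm.
Qed.

Lemma cvg0_lt (u : nat -> R) (e : R) : u @ \oo --> (0 : R) -> 0 < e -> \forall n \near \oo, u n < e.
Proof.
move=> /cvgrPdist_lt u0 e0; near=> n; apply: le_lt_trans (ler_norm _) _.
by rewrite -normrN -[- _]sub0r; near: n; exact: u0.
Unshelve. all: by end_near. Qed.

Lemma psum_dcoef_cvg j a z : bounded_by1 a -> absC z < 1 ->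
  psum (dcoef j a) ^~ z @ \oo --> power_series (dcoef j a) z.
Proof.
move=> a1 z1; rewrite /power_series psumE.
pose rho := (absC z + 1) / 2.
have zrho : absC z < rho by rewrite /rho; lra.
have rho1 : rho < 1 by rewrite /rho; lra.
have rho0 : 0 <= rho by apply: ltW; apply: le_lt_trans zrho; exact: absC_ge0.
have [l hl] : exists l : C, psum (dcoef j a) ^~ z @ \oo --> l.
  apply: C_cauchy_cvg => e e0.
  have e20 : 0 < e / 2 by rewrite divr_gt0.
  have [N _ NP] := cvg0_lt (cvg_geo_mul ((1 - absC z / rho)^-1 ^+ j.+1 * (1 - rho)^-1) rho0 rho1) e0.
  have wlg m n : (N <= m)%N -> (m <= n)%N ->
     absC (psum (dcoef j a) n z - psum (dcoef j a) m z) < e.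
    move=> Nm mn; apply: le_lt_trans (NP m Nm).
    exact: psum_dcoef_tail.
  exists N => m n Nm Nn; have [mn|/ltnW nm] := leqP m n; last exact: wlg.
  by rewrite absCB; exact: wlg.
by rewrite (cvg_lim _ hl)//; exact: norm_hausdorff.
Qed.

Lemma power_series_dcoef_tail j a r rho z m : bounded_by1 a -> absC z <= r -> r < rho ->
  rho < 1 ->
  absC (power_series (dcoef j a) z - psum (dcoef j a) m z) <=
  (1 - r / rho)^-1 ^+ j.+1 * (1 - rho)^-1 * rho ^+ m.
Proof.
move=> a1 zr rrho rho1.
have z1 : absC z < 1 by apply: le_lt_trans zr (lt_trans rrho rho1).
apply: (@absC_lim_le R _ \oo _ (fun n => psum (dcoef j a) n z - psum (dcoef j a) m z)).
  by apply: cvgB; [exact: psum_dcoef_cvg|exact: cvg_cst].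
by exists m => // n mn; exact: psum_dcoef_tail.
Qed.

Lemma power_series_dcoef_agree j a b r rho z m : bounded_by1 a -> bounded_by1 b ->
  absC z <= r -> r < rho -> rho < 1 -> (forall k, (k < m + j)%N -> a k = b k) ->
  absC (power_series (dcoef j a) z - power_series (dcoef j b) z) <=
  2 * ((1 - r / rho)^-1 ^+ j.+1 * (1 - rho)^-1 * rho ^+ m).
Proof.
move=> a1 b1 zr rrho rho1 ab.
apply: (le_trans (absC_triangle _ _ (psum (dcoef j a) m z))).
rewrite mulr_natl mulr2n lerD//; first exact: power_series_dcoef_tail.
rewrite (_ : psum _ _ _ = psum (dcoef j b) m z); last first.
  by apply: eq_bigr => k _; rewrite /dcoef ab// ltn_add2r.
by rewrite absCB; exact: power_series_dcoef_tail.
Qed.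

Lemma absC_power_series_le a r z : bounded_by1 a -> absC z <= r -> r < 1 ->
  absC (power_series a z) <= (1 - r)^-1.
Proof.
move=> a1 zr r1; have r0 : 0 <= r by apply: le_trans zr; exact: absC_ge0.
have z1 := le_lt_trans zr r1.
apply: (@absC_lim_le R _ \oo _ (psum a ^~ z)).
  by have := @psum_dcoef_cvg 0 _ _ a1 z1; rewrite dcoef0; exact.
near=> n; apply: le_trans (absC_sum _ _ _) _.
have := sum_bin_le 0 n r0 r1; rewrite expr1; apply: le_trans.
apply: ler_sum => i _; rewrite addn0 bin0 absCM absCX.
rewrite ler_pM ?absC_ge0 ?exprn_ge0 ?absC_ge0//.
by rewrite lerXn2r// nnegrE absC_ge0.
Unshelve. all: by end_near. Qed.

Lemma absC_subXX r z w k : absC z <= r -> absC w <= r ->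
  absC (z ^+ k - w ^+ k) <= k%:R * r ^+ k.-1 * absC (z - w).
Proof.
move=> zr wr; have r0 : 0 <= r by apply: le_trans zr; exact: absC_ge0.
rewrite subrXX absCM mulrC ler_wpM2r ?absC_ge0//.
apply: (le_trans (absC_sum _ _ _)).
apply: (@le_trans _ _ (\sum_(i < k) r ^+ k.-1)); last by rewrite sumr_const card_ord mulr_natl.
apply: ler_sum => i _; rewrite absCM !absCX.
rewrite -[X in r ^+ X](@subnK i); last by case: k i => [[]//|k] i; rewrite -ltnS.
by rewrite exprD ler_pM ?exprn_ge0 ?absC_ge0// lerXn2r// nnegrE absC_ge0.
Qed.

Lemma absC_XM_sub r M z w v k l : absC z <= r -> absC w <= r -> absC v <= r ->
  absC (z - v) <= M -> absC (w - v) <= M ->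
  absC (z ^+ k * w ^+ l - v ^+ (k + l)) <= (k + l)%:R * r ^+ (k + l).-1 * M.
Proof.
move=> zr wr vr zv wv; have r0 : 0 <= r by apply: le_trans zr; exact: absC_ge0.
have -> : z ^+ k * w ^+ l - v ^+ (k + l) =
  (z ^+ k - v ^+ k) * w ^+ l + v ^+ k * (w ^+ l - v ^+ l) by rewrite exprD; ring.
apply: (le_trans (absCD _ _)); rewrite natrD !mulrDl lerD//.
  rewrite -mulrDl absCM; case: k => [|k]; first by rewrite !expr0 subrr absC0 !mul0r.
  rewrite addSn/= exprD mulrA mulrAC ler_pM ?absC_ge0//.
    by apply: (le_trans (absC_subXX _ zr vr)); rewrite ler_wpM2l// mulr_ge0// exprn_ge0.
  by rewrite absCX lerXn2r// nnegrE absC_ge0.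
rewrite absCM; case: l => [|l]; first by rewrite !expr0 subrr absC0 mulr0 !mul0r.
rewrite addnS/= exprD mulrCA -mulrA ler_pM ?absC_ge0//.
  by rewrite absCX lerXn2r// nnegrE absC_ge0.
by apply: (le_trans (absC_subXX _ wr vr)); rewrite ler_wpM2l// mulr_ge0// exprn_ge0.
Qed.

(** The slope is taken at a third point [v], so that the same linear part serves all pairs [z], [w]
    in a ball around [v]; this is the form that a contraction estimate needs. Each summand of the
    factorization of z^k - w^k is compared with v^(k-1). *)
Lemma absC_subXX_taylor r M z w v k : absC z <= r -> absC w <= r -> absC v <= r ->
  absC (z - v) <= M -> absC (w - v) <= M ->
  absC (z ^+ k - w ^+ k - k%:R * v ^+ k.-1 * (z - w)) <=
  2 * ('C(k, 2)%:R * r ^+ k.-2) * M * absC (z - w).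
Proof.
move=> zr wr vr zv wv; have r0 : 0 <= r by apply: le_trans zr; exact: absC_ge0.
have -> : z ^+ k - w ^+ k - k%:R * v ^+ k.-1 * (z - w) =
  (\sum_(i < k) (z ^+ (k.-1 - i) * w ^+ i - v ^+ k.-1)) * (z - w).
  rewrite sumrB sumr_const card_ord mulrBl subrXX mulr_natl.
  by rewrite [X in X - _]mulrC.
rewrite absCM ler_wpM2r ?absC_ge0//.
apply: (le_trans (absC_sum _ _ _)).
apply: (@le_trans _ _ (\sum_(i < k) (k.-1%:R * r ^+ k.-2 * M))).
  apply: ler_sum => i _.
  have ik : (k.-1 - i + i = k.-1)%N by rewrite subnK//; case: k i => [[]//|k] i; rewrite -ltnS.
  by have := absC_XM_sub (k.-1 - i) i zr wr vr zv wv; rewrite ik.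
rewrite sumr_const card_ord -[leLHS]mulr_natl !mulrA -!natrM -(mul_bin_diag k 1).
by rewrite bin1.
Qed.

Lemma psum_dcoef1 a n v :
  psum (dcoef 1 a) n v = \sum_(k < n.+1) a k * (k%:R * v ^+ k.-1).
Proof.
rewrite big_ord_recl/= mul0r mulr0 add0r; apply: eq_bigr => k _.
by rewrite /dcoef /bump/= bin1 addn1 add1n mulrA [_ * a _]mulrC.
Qed.

(** The constant is the second derivative of 1 / (1 - r), the extreme case of coefficients all equal
    to 1. *)
Lemma psum_taylor a r M z w v n : bounded_by1 a -> r < 1 ->
  absC z <= r -> absC w <= r -> absC v <= r ->
  absC (z - v) <= M -> absC (w - v) <= M ->
  absC (psum a n.+2 z - psum a n.+2 w - psum (dcoef 1 a) n.+1 v * (z - w)) <=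
  2 * (1 - r)^-1 ^+ 3 * M * absC (z - w).
Proof.
move=> a1 r1 zr wr vr zv wv; have r0 : 0 <= r by apply: le_trans zr; exact: absC_ge0.
have M0 : 0 <= M by apply: le_trans zv; exact: absC_ge0.
rewrite psum_dcoef1 /psum mulr_suml -!sumrB.
apply: (le_trans (absC_sum _ _ _)).
apply: (@le_trans _ _ (\sum_(k < n.+2) (2 * ('C(k, 2)%:R * r ^+ k.-2) * M * absC (z - w)))).
  apply: ler_sum => k _.
  have -> : a k * z ^+ k - a k * w ^+ k - a k * (k%:R * v ^+ k.-1) * (z - w) =
    a k * (z ^+ k - w ^+ k - k%:R * v ^+ k.-1 * (z - w)) by ring.
  rewrite absCM; apply: le_trans (ler_piMl (absC_ge0 _) (a1 _)) _.
  exact: absC_subXX_taylor.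
rewrite -!mulr_suml -mulr_sumr; do 2 (apply: ler_wpM2r; rewrite ?absC_ge0//).
apply: ler_wpM2l => //; rewrite big_ord_recl big_ord_recl/= !bin_small// !mul0r !add0r.
apply: le_trans (sum_bin_le 2 n r0 r1).
by apply: ler_sum => i _; rewrite /bump/= !add1n addn2.
Qed.

Lemma psum_lipschitz a r z w n : bounded_by1 a -> r < 1 ->
  absC z <= r -> absC w <= r ->
  absC (psum a n.+1 z - psum a n.+1 w) <= (1 - r)^-1 ^+ 2 * absC (z - w).
Proof.
move=> a1 r1 zr wr; have r0 : 0 <= r by apply: le_trans zr; exact: absC_ge0.
rewrite /psum -!sumrB.
apply: (le_trans (absC_sum _ _ _)).
apply: (@le_trans _ _ (\sum_(k < n.+1) (k%:R * r ^+ k.-1 * absC (z - w)))).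
  apply: ler_sum => k _; rewrite -mulrBr absCM.
  apply: le_trans (ler_piMl (absC_ge0 _) (a1 _)) _.
  exact: absC_subXX.
rewrite -!mulr_suml; apply: ler_wpM2r; rewrite ?absC_ge0//.
rewrite big_ord_recl/= !mul0r !add0r.
apply: le_trans (sum_bin_le 1 n r0 r1).
by apply: ler_sum => i _; rewrite /bump/= !add1n addn1 bin1.
Qed.

Lemma psum_cvg a z : bounded_by1 a -> absC z < 1 ->
  psum a ^~ z @ \oo --> power_series a z.
Proof. by move=> a1 z1; have := @psum_dcoef_cvg 0 _ _ a1 z1; rewrite dcoef0. Qed.

Lemma power_series_taylor a r M z w v : bounded_by1 a -> r < 1 ->
  absC z <= r -> absC w <= r -> absC v <= r ->
  absC (z - v) <= M -> absC (w - v) <= M ->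
  absC (power_series a z - power_series a w - power_series (dcoef 1 a) v * (z - w)) <=
  2 * (1 - r)^-1 ^+ 3 * M * absC (z - w).
Proof.
move=> a1 r1 zr wr vr zv wv.
apply: (@absC_lim_le R _ \oo _
  (fun n => psum a n.+2 z - psum a n.+2 w - psum (dcoef 1 a) n.+1 v * (z - w))).
  apply: cvgB; last first.
    apply: cvgMl; have := @psum_dcoef_cvg 1 _ _ a1 (le_lt_trans vr r1).
    by rewrite -(cvg_shiftS (psum _ ^~ v)).
  apply: cvgB.
    rewrite (cvg_shiftS (fun n => psum a n.+1 z)) (cvg_shiftS (psum a ^~ z)).
    by apply: psum_cvg => //; exact: le_lt_trans r1.
  rewrite (cvg_shiftS (fun n => psum a n.+1 w)) (cvg_shiftS (psum a ^~ w)).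
  by apply: psum_cvg => //; exact: le_lt_trans r1.
by near=> n; exact: psum_taylor.
Unshelve. all: by end_near. Qed.

Lemma power_series_lipschitz a r z w : bounded_by1 a -> r < 1 ->
  absC z <= r -> absC w <= r ->
  absC (power_series a z - power_series a w) <= (1 - r)^-1 ^+ 2 * absC (z - w).
Proof.
move=> a1 r1 zr wr.
apply: (@absC_lim_le R _ \oo _ (fun n => psum a n.+1 z - psum a n.+1 w)).
  apply: cvgB.
    by rewrite (cvg_shiftS (psum a ^~ z)); apply: psum_cvg => //; exact: le_lt_trans r1.
  by rewrite (cvg_shiftS (psum a ^~ w)); apply: psum_cvg => //; exact: le_lt_trans r1.
by near=> n; exact: psum_lipschitz.
Unshelve. all: by end_near. Qed.

Lemma derive1_quadratic (f : C -> C) z (c : C) (d K : R) : 0 < d ->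
  (forall w, absC (w - z) < d ->
     absC (f w - f z - c * (w - z)) <= K * absC (w - z) ^+ 2) ->
  derive1 f z = c.
Proof.
move=> d0 fz; apply: cvg_lim; first exact: norm_hausdorff.
apply/cvg_absC => e e0.
pose K' := `|K| + 1; have K'0 : 0 < K' by rewrite ltr_wpDl.
have : nbhs (0 : C) [set h | absC h < d /\ K' * absC h < e].
  apply/nbhs_absC; exists (Num.min d (e / K')).
    by rewrite lt_min d0 divr_gt0.
  by move=> w; rewrite sub0r absCN lt_min ltr_pdivlMr// mulrC => /andP[].
apply: filterS => h [hd he] /= h0; rewrite absCB.
have h0' : 0 < absC h by rewrite absC_gt0.
rewrite -(ltr_pM2r h0') -absCM.
have -> : (h^-1 *: (f (h + z) - f z) - c) * h = f (h + z) - f z - c * (h + z - z).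
  by rewrite -[_ *: _]/(_ * _) addrK; field.
have /= := fz (h + z); rewrite addrK => /(_ hd) /le_lt_trans; apply.
rewrite expr2 mulrA ltr_pM2r//; apply: le_lt_trans he.
by rewrite ler_wpM2r ?absC_ge0// (le_trans (ler_norm _))// lerDl.
Qed.

Lemma power_series_derive1 a z : bounded_by1 a -> absC z < 1 ->
  derive1 (power_series a) z = power_series (dcoef 1 a) z.
Proof.
move=> a1 z1; pose r := (absC z + 1) / 2.
have zr : absC z < r by rewrite /r; lra.
have r1 : r < 1 by rewrite /r; lra.
apply: (@derive1_quadratic _ _ _ (r - absC z) (2 * (1 - r)^-1 ^+ 3)).
  by rewrite subr_gt0.
move=> w wz; rewrite expr2 mulrA.
apply: power_series_taylor => //; rewrite ?subrr ?absC0 ?absC_ge0// ltW//.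
by have := absC_lerB w z; lra.
Qed.

End bounded_coefficients.

(** * Newton's iteration with a fixed slope *)

Section newton.
Context {R : realType}.
Local Notation C := (Cx R).
Implicit Types (f : C -> C) (z w c : C) (d : R).

(* [z |-> f z - z * c] is a contraction by a factor [absC c / 2]: iterate
   [z |-> z - f z / c]. *)
Lemma newton_root f z0 c d : c != 0 ->
  (forall z w, absC (z - z0) <= d -> absC (w - z0) <= d ->
     absC (f z - f w - c * (z - w)) <= absC c / 2 * absC (z - w)) ->
  2 * absC (f z0) <= absC c * d ->
  exists2 z, f z = 0 & absC (z - z0) <= 2 * absC (f z0) / absC c.
Proof.
move=> c0 fc fz0; have c0' : 0 < absC c by rewrite absC_gt0.
set q := absC (f z0) / absC c.
have q0 : 0 <= q by rewrite divr_ge0 ?absC_ge0.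
have q2d : 2 * q <= d by rewrite mulrA ler_pdivrMr// mulrC [d * _]mulrC mulrC.
pose g z := z - f z / c.
pose u n := iter n g z0.
pose hn n : R := 2^-1 ^+ n.
have hn0 n : 0 < hn n by rewrite exprn_gt0.
have hnS n : hn n.+1 = hn n / 2 by rewrite /hn exprSr.
have gc z w : absC (z - z0) <= d -> absC (w - z0) <= d ->
    absC (g z - g w) <= absC (z - w) / 2.
  move=> zd wd; rewrite -(ler_pM2l c0') -absCM.
  have -> : c * (g z - g w) = - (f z - f w - c * (z - w)) by rewrite /g; field.
  by rewrite absCN mulrA mulrAC; exact: fc.
(* Successive steps halve, so the distance to the start is a partial geometric sum with limit 2
   q. *)
have uP n : absC (u n - z0) <= 2 * q * (1 - hn n) /\ absC (u n.+1 - u n) <= q * hn n.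
  elim: n => [|n [IH1 IH2]].
    rewrite /u /= subrr absC0 /hn expr0 subrr !mulr0 mulr1; split=> //.
    by rewrite /g addrAC subrr add0r absCN absCM absCV.
  have h1 : absC (u n.+1 - z0) <= 2 * q * (1 - hn n.+1).
    apply: (le_trans (absC_triangle _ _ (u n))); rewrite hnS.
    by have := lerD IH2 IH1; lra.
  have dn k : 2 * q * (1 - hn k) <= d.
    by apply: le_trans q2d; have := mulr_ge0 q0 (ltW (hn0 k)); lra.
  split=> //; rewrite hnS mulrA; apply: (@le_trans _ _ (absC (u n.+1 - u n) / 2)).
    by apply: gc; [exact: le_trans h1 (dn _)|exact: le_trans IH1 (dn _)].
  by rewrite ler_pM2r.
have um n k : absC (u (n + k)%N - u n) <= 2 * q * hn n * (1 - hn k).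
  elim: k => [|k IH]; first by rewrite addn0 subrr absC0 /hn expr0 subrr mulr0.
  apply: (le_trans (absC_triangle _ _ (u (n + k)%N))).
  have [_] := uP (n + k)%N; rewrite addnS.
  by rewrite /hn exprD -!/(hn _) hnS => h; have := lerD h IH; lra.
have um' n k : absC (u (n + k)%N - u n) <= 2 * q * hn n.
  by apply: le_trans (um n k) _; have := mulr_ge0 (mulr_ge0 q0 (ltW (hn0 n))) (ltW (hn0 k)); lra.
have uS n : u n.+1 = g (u n) by [].
clearbody u.
have hcv : (fun n => 2 * q * hn n) @ \oo --> (0 : R) by apply: cvg_geo_mul; lra.
have [l ul] : exists l : C, u @ \oo --> l.
  apply: C_cauchy_cvg => e e0; have [N _ NP] := cvg0_lt hcv e0.
  exists N => m n; wlog mn : m n / (m <= n)%N => [hw Nm Nn|Nm _].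
    by have [/hw|/ltnW /hw] := leqP m n; [exact|rewrite absCB; exact].
  by rewrite absCB -(subnKC mn); apply: le_lt_trans (um' _ _) (NP m Nm).
have u_d n : absC (u n - z0) <= 2 * q.
  by have [h _] := uP n; apply: (le_trans h); have := mulr_ge0 q0 (ltW (hn0 n)); lra.
have l_d : absC (l - z0) <= 2 * q.
  apply: (@absC_lim_le R _ \oo _ (fun n => u n - z0)); first by apply: cvgB; [exact: ul|exact: cvg_cst].
  by near=> n; exact: u_d.
exists l; last by rewrite -mulrA.
apply/eqP; rewrite -absC_eq0; apply/eqP/le_anti; rewrite absC_ge0 andbT.
apply/ler_addgt0Pr => e e0; rewrite add0r.
have e1 : 0 < e / (2 * absC c) by rewrite divr_gt0// mulr_gt0.
have e2 : 0 < e / (8 * absC c) by rewrite divr_gt0// mulr_gt0.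
have /filter_ex[n [h1 h2]] : \forall n \near \oo,
    2 * q * hn n < e / (8 * absC c) /\ absC (l - u n) < e / (8 * absC c).
  near=> n; split; near: n; first exact: cvg0_lt.
  by move/cvg_absC : ul; exact.
(* The last term is f (u n), rewritten as a Newton step; the first is controlled by the
   contraction. *)
have -> : f l = (f l - f (u n) - c * (l - u n)) + c * (l - u n) + c * (u n - u n.+1).
  by rewrite uS /g; field.
apply: (le_trans (absCD _ _)); apply: (le_trans (lerD (absCD _ _) (lexx _))).
rewrite !absCM [absC (u n - _)]absCB.
have h3 := um' n 1%N; rewrite addn1 in h3.
have h4 := fc _ _ (le_trans l_d q2d) (le_trans (u_d n) q2d).
move: h1 h2; rewrite !ltr_pdivlMr ?mulr_gt0// => h1 h2.
by have := ler_wpM2l (ltW c0') h3; lra.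
Unshelve. all: by end_near. Qed.

Lemma newton_root_uniq f z0 c d z w : c != 0 ->
  (forall z w, absC (z - z0) <= d -> absC (w - z0) <= d ->
     absC (f z - f w - c * (z - w)) <= absC c / 2 * absC (z - w)) ->
  absC (z - z0) <= d -> absC (w - z0) <= d -> f z = 0 -> f w = 0 -> z = w.
Proof.
move=> c0 fc zd wd fz fw; have := fc _ _ zd wd.
rewrite fz fw subrr sub0r absCN absCM => h.
have c0' : 0 < absC c by rewrite absC_gt0.
apply/eqP; rewrite -subr_eq0 -absC_eq0; apply/eqP/le_anti; rewrite absC_ge0 andbT.
by rewrite leNgt; apply/negP => x0; have := mulr_gt0 c0' x0; lra.
Qed.

End newton.

(** * Dragon curves as sets of values of power series *)

Section dragon.
Context {R : realType}.
Local Notation C := (Cx R).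
Implicit Types (a b : nat -> C) (z w al : C).

Definition is_signs a := forall k, a k = 1 \/ a k = - 1.

Lemma is_signs_bounded a : is_signs a -> bounded_by1 a.
Proof. by move=> sa k; have [->|->] := sa k; rewrite ?absCN absC1. Qed.

(** Turns F_n + z^(n+1) f, and F_n itself when [b] is 0, into a power series to which the uniform
    estimates apply. *)
Definition cat_coef n a b k : C := if (k < n)%N then a k else b (k - n)%N.

Lemma cat_coef_bounded n a b : bounded_by1 a -> bounded_by1 b ->
  bounded_by1 (cat_coef n a b).
Proof. by move=> a1 b1 k; rewrite /cat_coef; case: ifP. Qed.

Lemma cat_coef_signs n a b : is_signs a -> is_signs b -> is_signs (cat_coef n a b).
Proof. by move=> a1 b1 k; rewrite /cat_coef; case: ifP. Qed.

Lemma psum_cat n m a b z :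
  psum (cat_coef n a b) (n + m) z = psum a n z + z ^+ n * psum b m z.
Proof.
rewrite /psum big_split_ord/= mulr_sumr; congr (_ + _); apply: eq_bigr => k _.
  by rewrite /cat_coef ltn_ord.
by rewrite /cat_coef ltnNge leq_addr/= addKn exprD mulrCA.
Qed.

Lemma power_series_cat n a b z : bounded_by1 a -> bounded_by1 b -> absC z < 1 ->
  power_series (cat_coef n a b) z = psum a n z + z ^+ n * power_series b z.
Proof.
move=> a1 b1 z1.
have h1 := psum_cvg (@cat_coef_bounded n _ _ a1 b1) z1.
have h2 : (fun m => psum (cat_coef n a b) (n + m) z) @ \oo --> psum a n z + z ^+ n * power_series b z.
  under eq_fun do rewrite psum_cat.
  by apply: cvgD; [exact: cvg_cst|apply: cvgMr; exact: psum_cvg].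
have h3 : [sequence psum (cat_coef n a b) (m + n)%N z]_m @ \oo --> power_series (cat_coef n a b) z.
  by move: h1; rewrite -(cvg_shiftn n (fun m => psum (cat_coef n a b) m z)); exact.
have h23 : (fun m => psum (cat_coef n a b) (n + m) z) = [sequence psum (cat_coef n a b) (m + n)%N z]_m.
  by apply/funext => m; rewrite addnC.
rewrite h23 in h2; exact: (cvg_unique (@norm_hausdorff _ C) h3 h2).
Qed.

Definition sgnC (b : bool) : C := if b then 1 else - 1.

Lemma sgnC_signs (s : nat -> bool) : is_signs (sgnC \o s).
Proof. by move=> k; rewrite /sgnC/=; case: (s k); [left|right]. Qed.

Lemma is_signsP a : is_signs a -> exists s : nat -> bool, a = sgnC \o s.
Proof.
move=> sa; exists (fun k => `[< a k = 1 >]); apply/funext => k /=.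
by rewrite /sgnC; case: asboolP => // h; have [] := sa k.
Qed.

Lemma cantor_near_eq (s : cantor_space) n :
  \forall t \near s, forall k, (k < n)%N -> t k = s k.
Proof.
elim: n => [|n IH]; first by near=> t.
have : \forall t \near s, t n = s n.
  have /= := @proj_continuous nat (fun=> bool) n s [set s n].
  by apply; exact: discrete_set1.
move: IH; apply: filterS2 => t h1 h2 k; rewrite ltnS leq_eqVlt => /orP[/eqP->//|]; exact: h1.
Unshelve. all: by end_near. Qed.

Definition dragon_set al : set C := [set power_series a al | a in is_signs].

(** A continuous image of Cantor space: sequences that agree up to rank N have values within a
    geometric tail of each other. *)
Lemma dragon_set_compact al : absC al < 1 -> compact (dragon_set al).
Proof.
move=> al1.
have -> : dragon_set al = (fun s : cantor_space => power_series (sgnC \o s) al) @` [set: cantor_space].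
  apply/seteqP; split=> [_ [a /is_signsP[s ->] <-]|_ [s _ <-]]; first by exists s.
  by exists (sgnC \o s) => //; exact: sgnC_signs.
apply: continuous_compact; last exact: cantor_space_compact.
apply: continuous_subspaceT => s; apply/cvg_absC => e e0.
pose rho := (absC al + 1) / 2.
have zrho : absC al < rho by rewrite /rho; lra.
have rho1 : rho < 1 by rewrite /rho; lra.
have rho0 : 0 <= rho by apply: ltW; apply: le_lt_trans zrho; exact: absC_ge0.
have [N _ /(_ N (leqnn _)) NP] := cvg0_lt (cvg_geo_mul (2 * ((1 - absC al / rho)^-1 ^+ 1 * (1 - rho)^-1)) rho0 rho1) e0.
near=> t; apply: le_lt_trans NP; rewrite -mulrA -[sgnC \o s]dcoef0 -[sgnC \o t]dcoef0.
apply: power_series_dcoef_agree => //; try exact/is_signs_bounded/sgnC_signs.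
rewrite addn0 => k kN /=; congr sgnC; apply/esym; move: k kN; near: t.
exact: cantor_near_eq.
Unshelve. all: by end_near. Qed.

Lemma is_dragon_dragon_set al : absC al < 1 -> is_dragon al (dragon_set al).
Proof.
move=> al1; split.
- by exists (power_series (fun=> 1) al), (fun=> 1) => // k; left.
- exact: dragon_set_compact.
have step (c : C) a : c = 1 \/ c = - 1 -> is_signs a ->
    c + al * power_series a al = power_series (cat_coef 1 (fun=> c) a) al.
  move=> cs sa; have sc : is_signs (fun=> c) by [].
  by rewrite power_series_cat//; [rewrite /psum big_ord1 expr0 mulr1 expr1|exact: is_signs_bounded..].
apply/seteqP; split=> [_ [a sa <-]|_ [|] [_ [a sa <-] <-]].
- have sa' : is_signs (fun k => a k.+1) by move=> k; exact: sa.
  have -> : power_series a al = a 0 + al * power_series (fun k => a k.+1) al.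
    rewrite step//; congr power_series; apply/funext => -[|k]; rewrite /cat_coef//=.
    by rewrite subn1.
  have [->|->] := sa 0%N; [left|right]; exists (power_series (fun k => a k.+1) al) => //;
    by exists (fun k => a k.+1).
- have s1 : (1 : C) = 1 \/ (1 : C) = - 1 by left.
  by rewrite (step 1)//; exists (cat_coef 1 (fun=> 1) a) => //; apply: cat_coef_signs.
- have s1 : (- 1 : C) = 1 \/ (- 1 : C) = - 1 by right.
  by rewrite (step (- 1))//; exists (cat_coef 1 (fun=> - 1) a) => //; apply: cat_coef_signs.
Qed.

Lemma compact_absC_bounded (D : set C) : compact D -> exists M : R, forall z, D z -> absC z <= M.
Proof.
move=> cD; have [->|/set0P D0] := eqVneq D set0; first by exists 0.
have [|c _ cM] := compact_EVT_max D0 cD (f := absC).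
  exact/continuous_subspaceT/absC_continuous.
by exists (absC c) => z Dz; apply: cM; rewrite inE.
Qed.

Lemma is_dragon_uniq al D : absC al < 1 -> is_dragon al D -> D = dragon_set al.
Proof.
move=> al1 [[d0 Dd0] cD DE].
have D1 w : D w -> D (1 + al * w) by move=> Dw; rewrite DE; left; exists w.
have DN1 w : D w -> D (- 1 + al * w) by move=> Dw; rewrite DE; right; exists w.
apply/seteqP; split=> [x Dx|_ [a sa <-]].
  (* Every point of D comes from a sign and a point of D; iterating this choice reads off the
     coefficients of a series with value x. *)
  have /choice[h hP] : forall y, exists p : C * C, D y ->
      [/\ p.1 = 1 \/ p.1 = - 1, D p.2 & y = p.1 + al * p.2].
    move=> y; have [|nDy] := pselect (D y); last by exists (0, 0).
    by rewrite {1}DE => -[] [w Dw <-]; [exists (1, w)|exists (- 1, w)] => _; split=> //; [left|right].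
  pose y n := iter n (fun w => (h w).2) x.
  have Dy n : D (y n) by elim: n => // n IH; have [] := hP _ IH.
  pose a n := (h (y n)).1.
  have sa : is_signs a by move=> n; have [] := hP _ (Dy n).
  have xE n : x = psum a n al + al ^+ n * y n.
    elim: n => [|n IH]; first by rewrite /psum big_ord0 expr0 mul1r add0r.
    have [_ _ yE] := hP _ (Dy n); rewrite {1}IH {1}yE psumS -/(a n) -[(h (y n)).2]/(y n.+1).
    by rewrite exprS; ring.
  have [M MP] := compact_absC_bounded cD.
  exists a => //; apply: (cvg_unique (@norm_hausdorff _ C) (psum_cvg (is_signs_bounded sa) al1)).
  apply/cvg_absC => e e0.
  have M0 : 0 <= M by apply: le_trans (MP _ Dx); exact: absC_ge0.
  have [N _ NP] := cvg0_lt (cvg_geo_mul M (absC_ge0 al) al1) e0.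
  exists N => // n /= Nn; apply: le_lt_trans (NP n Nn).
  rewrite {1}(xE n) addrAC subrr add0r absCM absCX mulrC.
  by rewrite ler_wpM2r ?exprn_ge0 ?absC_ge0// MP.
(* Conversely, the first n maps applied to a fixed d0 stay in D and tend to the value of the series;
   D is closed. *)
have aD n b : is_signs b -> D (psum b n al + al ^+ n * d0).
  elim: n b => [|n IH] b sb; first by rewrite /psum big_ord0 expr0 mul1r add0r.
  have -> : psum b n.+1 al + al ^+ n.+1 * d0 =
     b 0%N + al * (psum (fun k => b k.+1) n al + al ^+ n * d0).
    rewrite /psum big_ord_recl/= mulrDr mulr_sumr expr0 mulr1 exprS mulrA addrA.
    congr (_ + _ + _); apply: eq_bigr => k _; rewrite /bump/= add1n exprS; ring.
  have sb' : is_signs (fun k => b k.+1) by move=> k; exact: sb.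
  by have [->|->] := sb 0%N; [apply: D1|apply: DN1]; exact: IH.
have Dcl : closed D by apply: compact_closed => //; exact: norm_hausdorff.
apply: (@closed_cvg _ _ \oo _ (fun n => psum a n al + al ^+ n * d0) D Dcl).
  by near=> n; exact: aD.
rewrite -[X in _ --> X]addr0; apply: cvgD; first exact: psum_cvg (is_signs_bounded sa) al1.
apply/cvg_absC => e e0; have [N _ NP] := cvg0_lt (cvg_geo_mul (absC d0) (absC_ge0 al) al1) e0.
by exists N => // n /= Nn; rewrite sub0r absCN absCM absCX mulrC; exact: NP.
Unshelve. all: by end_near. Qed.

Lemma dragonE al : absC al < 1 -> dragon al = dragon_set al.
Proof.
move=> al1; apply: get_unique; first exact: is_dragon_dragon_set.
by move=> D; exact: is_dragon_uniq.
Qed.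

End dragon.

(** * Convergence in the Fell topology *)

Lemma cvg_fell (T : topologicalType) (F : set_system (hyperspace T)) (A : hyperspace T) :
  Filter F ->
  (forall U : set T, open U -> A `&` U !=set0 ->
     F [set B : hyperspace T | hyper_set B `&` U !=set0]) ->
  (forall K : set T, compact K -> A `&` K = set0 ->
     F [set B : hyperspace T | hyper_set B `&` K = set0]) ->
  F --> A.
Proof.
move=> FF hit miss X; rewrite nbhsE => -[V [[DV sDV <-] [C DC CA]] VX].
apply: filterS VX _; apply: (@filterS _ _ _ C) => [B CB|]; first by exists C.
have [D sD CE] := sDV _ DC; rewrite -CE; apply: filter_bigI => E DE.
have EA : E A by move: CA; rewrite -CE; exact.
have := sD _ DE; rewrite inE => -[[U oU EE]|[K cK EE]]; rewrite EE in EA *.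
  exact: hit.
exact: miss.
Qed.

Section fell_convergence.
Context {R : realType}.
Local Notation C := (Cx R).

Lemma hyper_of_setE (A : set C) : A !=set0 -> hyper_set (hyper_of_set A) = closure A.
Proof. by rewrite /hyper_of_set; case: pselect. Qed.

Lemma compact_separated (A K : set C) : compact A -> compact K -> A `&` K = set0 ->
  exists2 e : R, 0 < e & forall x y, A x -> K y -> e <= absC (x - y).
Proof.
move=> cA cK AK0.
have [AK|/set0P AK] := eqVneq (A `*` K) set0.
  exists 1 => // x y Ax Ky; have : (A `*` K) (x, y) by [].
  by rewrite AK.
have [|[x y] /[!inE] [[/= Ax Ky] xym]] := compact_EVT_min AK (compact_setX cA cK) (f := fun p => absC (p.1 - p.2)).
  apply: continuous_subspaceT => p; apply: continuous_cvg; first exact: absC_continuous.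
  by apply: cvgB; [exact: cvg_fst|exact: cvg_snd].
exists (absC (x - y)).
  rewrite absC_gt0 subr_eq0; apply/eqP => xy; have : (A `&` K) x by split=> //; rewrite xy.
  by rewrite AK0.
by move=> x' y' Ax' Ky'; apply: (xym (x', y')); rewrite inE.
Qed.

(** The sets [An] may spread over larger and larger regions, as the rescaled sets do. Closeness to
    [A] is therefore asked only in bounded regions, which is all that a compact set can test. *)
Lemma cvg_hyper_of_set (An : nat -> set C) (A : set C) : compact A -> A !=set0 ->
  (forall x e, A x -> 0 < e -> \forall n \near \oo, exists2 y, An n y & absC (x - y) < e) ->
  (forall M e, 0 < e -> \forall n \near \oo, forall y, An n y -> absC y <= M ->
     exists2 x, A x & absC (x - y) < e) ->
  (fun n => hyper_of_set (An n)) @ \oo --> hyper_of_set A.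
Proof.
move=> cA A0 hit miss.
have clA : closure A = A.
  by rewrite -(closure_id A).1//; exact: (compact_closed (@norm_hausdorff _ C) cA).
(* On the empty set [hyper_of_set] takes its default value, which is not the closure. *)
have An0 : \forall n \near \oo, An n !=set0.
  have [x Ax] := A0; have := hit x 1 Ax ltr01.
  by apply: filterS => n [y Any _]; exists y.
apply: cvg_fell; rewrite hyper_of_setE// clA.
- move=> U oU [x [Ax Ux]].
  have /nbhs_absC[e e0 eU] : nbhs x U by move: oU; rewrite openE; exact.
  have h := hit x e Ax e0.
  suff : \forall n \near \oo, closure (An n) `&` U !=set0.
    by apply: filterS2 An0 => n An0n; rewrite /= hyper_of_setE.
  near=> n.
  have [y Any xy] : exists2 y, An n y & absC (x - y) < e by near: n.
  by exists y; split; [exact: subset_closure|exact: eU].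
- move=> K cK AK0.
  have [e e0 eP] := compact_separated cA cK AK0.
  have [M MP] := compact_absC_bounded cK.
  have e20 : 0 < e / 2 by rewrite divr_gt0.
  (* A point of K in the closure is only approached by points of [An], hence the margin 1 in the
     bound. *)
  have h := miss (M + 1) (e / 2) e20.
  suff : \forall n \near \oo, closure (An n) `&` K = set0.
    by apply: filterS2 An0 => n An0n; rewrite /= hyper_of_setE.
  near=> n.
  have hn : forall y, An n y -> absC y <= M + 1 -> exists2 x, A x & absC (x - y) < e / 2 by near: n.
  apply/seteqP; split=> // k [clk Kk].
  have : nbhs k [set y | absC (k - y) < Num.min 1 (e / 2)].
    by apply/nbhs_absC; exists (Num.min 1 (e / 2)) => //; rewrite lt_min ltr01.
  move=> /clk[y [Any]] /=; rewrite lt_min => /andP[y1 y2].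
  have yM : absC y <= M + 1.
    by have := absC_lerB y k; rewrite absCB; have := MP _ Kk; lra.
  have [x Ax xy] := hn _ Any yM.
  have := eP _ _ Ax Kk; have := absC_triangle x k y; rewrite [absC (y - k)]absCB; lra.
Unshelve. all: by end_near. Qed.

End fell_convergence.

(** * Persistence of simple zeros under truncation *)

Section persistence.
Context {R : realType}.
Local Notation C := (Cx R).
Implicit Types (a b : nat -> C) (z w v al : C).

Lemma psum_power_series n a z : absC z < 1 -> bounded_by1 a ->
  power_series (cat_coef n a (fun=> 0)) z = psum a n z.
Proof.
move=> z1 a1; rewrite power_series_cat//; last by move=> k; rewrite absC0.
rewrite (_ : power_series (fun=> 0) z = 0) ?mulr0 ?addr0//.
rewrite /power_series psumE (_ : psum _ ^~ z = (fun=> 0)); last first.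
  by apply/funext => k; rewrite /psum big1// => i _; rewrite mul0r.
exact: (cvg_lim (@norm_hausdorff _ C) (cvg_cst _)).
Qed.

(** The first summand comes from Taylor's formula for one series, the second from exchanging its
    derivative for that of another series with the same initial coefficients. *)
Definition agree_taylor_const (r rho : R) : R :=
  2 * (1 - r)^-1 ^+ 3 + 2 * ((1 - r / rho)^-1 ^+ 2 * (1 - rho)^-1).

(* [b] has the same first [n.+1] coefficients as [a], but the linear part is
   that of [a]. *)
Lemma agree_taylor a b r rho M z w v n : bounded_by1 a -> bounded_by1 b ->
  r < rho -> rho < 1 -> (forall k, (k < n.+1)%N -> a k = b k) ->
  absC z <= r -> absC w <= r -> absC v <= r ->
  absC (z - v) <= M -> absC (w - v) <= M ->
  absC (power_series b z - power_series b w - power_series (dcoef 1 a) v * (z - w)) <=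
  agree_taylor_const r rho * (M + rho ^+ n) * absC (z - w).
Proof.
move=> a1 b1 rrho rho1 ab zr wr vr zv wv.
have r1 := lt_trans rrho rho1.
have r0 : 0 <= r by apply: le_trans zr; exact: absC_ge0.
have M0 : 0 <= M by apply: le_trans zv; exact: absC_ge0.
have h1 := power_series_taylor b1 r1 zr wr vr zv wv.
have h2 : absC (power_series (dcoef 1 a) v - power_series (dcoef 1 b) v) <=
    2 * ((1 - r / rho)^-1 ^+ 2 * (1 - rho)^-1 * rho ^+ n).
  by apply: power_series_dcoef_agree => // k; rewrite addn1; exact: ab.
have split_linear (x y p q s : C) : x - y - p * s = (x - y - q * s) - (p - q) * s by ring.
rewrite (split_linear _ _ _ (power_series (dcoef 1 b) v)).
apply: (le_trans (absCD _ _)); rewrite absCN absCM.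
have xp : 0 <= absC (z - w) by exact: absC_ge0.
have {}h2 := ler_wpM2r xp h2.
have rho0 : 0 < rho by exact: le_lt_trans rrho.
set A := 2 * (1 - r)^-1 ^+ 3 in h1 *.
set B := (1 - r / rho)^-1 ^+ 2 / (1 - rho) in h2 *.
have A0 : 0 <= A by rewrite mulr_ge0// exprn_ge0// invr_ge0 subr_ge0 ltW.
have B0 : 0 <= B.
  apply: mulr_ge0; last by rewrite invr_ge0 subr_ge0 ltW.
  by rewrite exprn_ge0// invr_ge0 subr_ge0 ltW// ltr_pdivrMr// mul1r.
have p0 : 0 <= rho ^+ n by rewrite exprn_ge0// ltW.
rewrite /agree_taylor_const -/A -/B.
apply: le_trans (lerD h1 h2) _; rewrite -mulrDl ler_wpM2r//.
have := mulr_ge0 A0 p0; have := mulr_ge0 B0 M0; lra.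
Qed.

Lemma agree_taylor_const_ge0 r rho : 0 <= r -> r < rho -> rho < 1 -> 0 <= agree_taylor_const r rho.
Proof.
move=> r0 rrho rho1; have rho0 : 0 < rho by exact: le_lt_trans rrho.
apply: addr_ge0; apply: mulr_ge0 => //.
  by rewrite exprn_ge0// invr_ge0 subr_ge0 ltW// (lt_trans rrho).
apply: mulr_ge0; last by rewrite invr_ge0 subr_ge0 ltW.
by rewrite exprn_ge0// invr_ge0 subr_ge0 ltW// ltr_pdivrMr// mul1r.
Qed.

(** The hypothesis of [newton_root] with slope F'(al), simultaneously for all series that share
    sufficiently many initial coefficients with [a]: F itself, its late truncations, and all the F_n
    + z^(n+1) f. *)
Definition contracts a al (d : R) (n0 : nat) := forall n b, (n0 <= n)%N -> bounded_by1 b ->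
  (forall k, (k < n.+1)%N -> a k = b k) ->
  forall z w, absC (z - al) <= d -> absC (w - al) <= d ->
  absC (power_series b z - power_series b w - power_series (dcoef 1 a) al * (z - w)) <=
  absC (power_series (dcoef 1 a) al) / 2 * absC (z - w).

Lemma simple_zero_contracts a al : bounded_by1 a -> absC al < 1 ->
  power_series (dcoef 1 a) al != 0 ->
  exists d n0, [/\ 0 < d, absC al + d < 1 & contracts a al d n0].
Proof.
move=> a1 al1; set c := power_series _ al => c0.
have c0' : 0 < absC c by rewrite absC_gt0.
have al0 := absC_ge0 al.
pose r := (absC al + 1) / 2; pose rho := (r + 1) / 2.
have alr : absC al < r by rewrite /r; lra.
have rrho : r < rho by rewrite /rho /r; lra.
have rho1 : rho < 1 by rewrite /rho /r; lra.
have rho0 : 0 <= rho by rewrite /rho /r; lra.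
set K := agree_taylor_const r rho.
have K0 : 0 <= K by apply: agree_taylor_const_ge0 => //; rewrite /r; lra.
have K10 : 0 < K + 1 by lra.
(* The error factor is K (d + rho^n) <= 2 K e <= absC c / 2. The divisor is K + 1 since K is only
   known to be nonnegative. *)
pose e := absC c / 4 / (K + 1).
have e0 : 0 < e by rewrite !divr_gt0.
have [n0 _ n0P] := cvg0_lt (cvg_geo_mul 1 rho0 rho1) e0.
pose d := Num.min e ((r - absC al) / 2).
have d0 : 0 < d by rewrite lt_min e0 divr_gt0// subr_gt0.
have dr : d <= (r - absC al) / 2 by rewrite ge_min lexx orbT.
have de : d <= e by rewrite ge_min lexx.
exists d, n0; split => //; first by move: dr alr rrho rho1; lra.
move=> n b n0n b1 ab z w zd wd.
have zr : absC z <= r by have := absC_lerB z al; move: zd dr; lra.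
have wr : absC w <= r by have := absC_lerB w al; move: wd dr; lra.
have h := agree_taylor a1 b1 rrho rho1 ab zr wr (ltW alr) zd wd.
apply: le_trans h _; rewrite ler_wpM2r ?absC_ge0// -/K.
have hn : rho ^+ n < e by have := n0P n n0n; rewrite /= mul1r.
apply: (@le_trans _ _ (K * (2 * e))); first by rewrite ler_wpM2l//; lra.
have eK : e * (K + 1) = absC c / 4 by rewrite /e divfK// gt_eqF.
have := mulr_ge0 K0 (ltW e0); lra.
Qed.

Lemma power_series_psum_tail a r rho z m : bounded_by1 a -> absC z <= r -> r < rho -> rho < 1 ->
  absC (power_series a z - psum a m z) <= (1 - r / rho)^-1 * (1 - rho)^-1 * rho ^+ m.
Proof.
move=> a1 zr rrho rho1; have := @power_series_dcoef_tail _ 0 _ _ _ _ m a1 zr rrho rho1.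
by rewrite dcoef0 expr1.
Qed.

Lemma absC_psum_zero_cvg a al : bounded_by1 a -> absC al < 1 -> power_series a al = 0 ->
  (fun n => absC (psum a n.+1 al)) @ \oo --> (0 : R).
Proof.
move=> a1 al1 F0; apply/cvgrPdist_lt => e e0.
have := psum_cvg a1 al1; rewrite F0 -(cvg_shiftS (psum a ^~ al)) => /cvg_absC /(_ e e0).
by apply: filterS => n; rewrite !sub0r absCN normrN ger0_norm// absC_ge0.
Qed.

(** Newton's iteration for F_n is started at [al] itself, where F_n(al) tends to F(al) = 0. *)
Lemma simple_zero_persists a al d n0 : bounded_by1 a -> absC al < 1 ->
  power_series a al = 0 -> power_series (dcoef 1 a) al != 0 ->
  0 < d -> absC al + d < 1 -> contracts a al d n0 ->
  exists2 zt : nat -> C, zt @ \oo --> al &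
    \forall n \near \oo, [/\ absC (zt n - al) <= d, psum a n.+1 (zt n) = 0 &
      forall z, absC (z - al) <= d -> psum a n.+1 z = 0 -> z = zt n].
Proof.
move=> a1 al1 F0; set c := power_series _ al => c0 d0 ald ctr.
have c0' : 0 < absC c by rewrite absC_gt0.
have small e : 0 < e -> \forall n \near \oo, 2 * absC (psum a n.+1 al) < absC c * e.
  move=> e0; have e0' : 0 < absC c * e / 2 by rewrite !mulr_gt0.
  have := cvg0_lt (absC_psum_zero_cvg a1 al1 F0) e0'.
  by apply: filterS => n; lra.
have ball1 z : absC (z - al) <= d -> absC z < 1 by have := absC_lerB z al; lra.
have cn n : (n0 <= n)%N -> forall z w, absC (z - al) <= d -> absC (w - al) <= d ->
    absC (psum a n.+1 z - psum a n.+1 w - c * (z - w)) <= absC c / 2 * absC (z - w).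
  move=> n0n z w zd wd; rewrite -!psum_power_series//; try exact: ball1.
  apply: (ctr n) => //; first by apply: cat_coef_bounded => // k; rewrite absC0.
  by move=> k kn; rewrite /cat_coef kn.
have /choice[zt ztP] : forall n, exists z, (n0 <= n)%N -> 2 * absC (psum a n.+1 al) < absC c * d ->
    psum a n.+1 z = 0 /\ absC (z - al) <= 2 * absC (psum a n.+1 al) / absC c.
  move=> n; have [n0n|] := leqP n0 n; last by exists 0.
  have [h|h] := ltP (2 * absC (psum a n.+1 al)) (absC c * d); last by exists 0.
  by have [z z1 z2] := newton_root c0 (cn n n0n) (ltW h); exists z.
exists zt.
  apply/cvg_absC => e e0; near=> n.
  have [||_ h] := ztP n; [by near: n; exists n0|by near: n; exact: small|].
  rewrite absCB; apply: le_lt_trans h _; rewrite ltr_pdivrMr// [e * _]mulrC.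
  by near: n; exact: small.
near=> n.
have n0n : (n0 <= n)%N by near: n; exists n0.
have hd : 2 * absC (psum a n.+1 al) < absC c * d by near: n; exact: small.
have [h1 h2] := ztP n n0n hd.
have ztd : absC (zt n - al) <= d.
  by apply: le_trans h2 _; rewrite ler_pdivrMr// [d * _]mulrC ltW.
split=> // z zd z0.
exact: (newton_root_uniq c0 (cn n n0n)).
Unshelve. all: by end_near. Qed.

End persistence.

(** * Limits of the rescaled sets *)

Section tags.
Context {R : realType}.
Local Notation C := (Cx R).
Implicit Types (a b : nat -> C) (z w u al : C).

Lemma expr1D_sub1_le (x : R) m : 0 <= x -> m%:R * x <= 2^-1 -> (1 + x) ^+ m <= 1 + 2 * (m%:R * x).
Proof.
move=> x0; elim: m => [|m IH] mx; first by rewrite expr0 mul0r mulr0 addr0.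
have mx0 : 0 <= m%:R * x by rewrite mulr_ge0.
rewrite -natr1 mulrDl mul1r in mx *.
have /IH {}IH : m%:R * x <= 2^-1 by lra.
rewrite exprSr; apply: le_trans (ler_wpM2r _ IH) _; first by lra.
have : m%:R * x * x <= 2^-1 * x by rewrite ler_wpM2r//; lra.
by lra.
Qed.

(** Controls the ratio of z^(n+1) to [zt n ^+ n.+1], which is (1 + [zt n ^+ n * u])^(n+1): it tends
    to 1 because (n+1) r^n tends to 0. *)
Lemma absC_expr1D_sub1 z m : m%:R * absC z <= 2^-1 ->
  absC ((1 + z) ^+ m - 1) <= 2 * (m%:R * absC z).
Proof.
move=> mz; suff : absC ((1 + z) ^+ m - 1) <= (1 + absC z) ^+ m - 1.
  by have := expr1D_sub1_le (absC_ge0 z) mz; lra.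
elim: m {mz} => [|m IH]; first by rewrite !expr0 !subrr absC0.
have -> : (1 + z) ^+ m.+1 - 1 = (1 + z) * ((1 + z) ^+ m - 1) + z by rewrite exprS; ring.
apply: (le_trans (absCD _ _)); rewrite absCM.
have h : absC (1 + z) <= 1 + absC z by rewrite -{1}absC1; exact: absCD.
have := ler_pM (absC_ge0 _) (absC_ge0 _) h IH.
by rewrite exprS; lra.
Qed.

Lemma cvg_n_geo (x : R) : 0 <= x -> x < 1 -> (fun n => n.+1%:R * x ^+ n) @ \oo --> (0 : R).
Proof.
move=> x0 x1; pose r := (x + 1) / 2.
have xr : x < r by rewrite /r; lra.
have r1 : r < 1 by rewrite /r; lra.
have r0 : 0 < r by rewrite /r; lra.
have q1 : x / r < 1 by rewrite ltr_pdivrMr// mul1r.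
have q0 : 0 <= x / r by rewrite divr_ge0// ltW.
have h := @cvg_geo_mul _ ((1 - x / r)^-1 ^+ 2) r (ltW r0) r1.
apply/cvgrPdist_lt => e e0; have := cvg0_lt h e0; apply: filterS => n hn.
rewrite sub0r normrN ger0_norm ?mulr_ge0 ?exprn_ge0//; apply: le_lt_trans hn.
have := sum_bin_le 1 n.+1 q0 q1; rewrite big_ord_recr/= addn1 bin1 => h1.
have : n.+1%:R * (x / r) ^+ n <= (1 - x / r)^-1 ^+ 2.
  by apply: le_trans h1; rewrite lerDr sumr_ge0// => i _; rewrite mulr_ge0 ?exprn_ge0.
by rewrite expr_div_n mulrA ler_pdivrMr// exprn_gt0.
Qed.

(* In the coordinate [u], with [z = zt n + zt n ^+ n.+1 * u], the equation
   [F_n z + z ^+ n.+1 * f z = 0] becomes [F' al * u + f al = 0] in the limit. *)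
Lemma rescaled_equation a al (zt : nat -> C) (M e : R) : bounded_by1 a -> absC al < 1 ->
  zt @ \oo --> al -> (\forall n \near \oo, psum a n.+1 (zt n) = 0) -> 0 < e ->
  \forall n \near \oo, forall b u z, bounded_by1 b -> absC u <= M ->
    z = zt n + zt n ^+ n.+1 * u ->
    [/\ absC z < 1, absC (z - al) < e &
      absC (psum a n.+1 z + z ^+ n.+1 * power_series b z -
            zt n ^+ n.+1 * (power_series (dcoef 1 a) al * u + power_series b al)) <=
      e * absC (zt n) ^+ n.+1].
Proof.
move=> a1 al1 ztal Hzt0 e0; set c := power_series _ al.
have al0 := absC_ge0 al.
pose M1 : R := `|M| + 1.
have M10 : 0 < M1 by rewrite /M1 ltr_wpDl.
have MM1 : M <= M1 by rewrite /M1 (le_trans (ler_norm _))// lerDl.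
pose r := (absC al + 1) / 2; pose rho := (r + 1) / 2.
have alr : absC al < r by rewrite /r; lra.
have rrho : r < rho by rewrite /rho /r; lra.
have rho1 : rho < 1 by rewrite /rho /r; lra.
have r0 : 0 <= r by rewrite /r; lra.
have r1 : r < 1 by rewrite /r; lra.
have rho0 : 0 <= rho by rewrite /rho /r; lra.
set K := agree_taylor_const r rho.
have K0 : 0 <= K by apply: agree_taylor_const_ge0.
pose L := (1 - r)^-1; have L0 : 0 < L by rewrite invr_gt0 subr_gt0.
(* [t] will bound [absC (zt n - al)], [rho ^+ n] and n+1 times the relative displacement of z. The
   total error is at most (3 K M1 + 2 L + 2 L^2) t relative to |zt n|^(n+1), which dictates the last
   entry. *)
pose t := Num.min (Num.min ((r - absC al) / 2) (e / 2))
  (Num.min 4^-1 (e / (2 * K * M1 + 2 * L + 2 * L ^+ 2 + 1) / 2)).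
have D0 : 0 < 2 * K * M1 + 2 * L + 2 * L ^+ 2 + 1.
  by rewrite ltr_wpDl// !addr_ge0// ?mulr_ge0 ?exprn_ge0// ltW.
have t0 : 0 < t.
  by rewrite !lt_min; apply/andP; split; apply/andP; split; rewrite ?invr_gt0 ?divr_gt0 ?subr_gt0.
have [t1 t2 t3 t4] : [/\ t <= (r - absC al) / 2, t <= e / 2, t <= 4^-1 &
    t * (2 * K * M1 + 2 * L + 2 * L ^+ 2 + 1) <= e / 2].
  have : t <= t by [].
  by rewrite {2}/t !le_min => /andP[/andP[-> ->] /andP[-> ]]; rewrite mulrAC ler_pdivlMr.
have H1 : \forall n \near \oo, absC (al - zt n) < t by move/cvg_absC : ztal; exact.
have H2 : \forall n \near \oo, M1 * (n.+1%:R * r ^+ n) < t.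
  have := cvg0_lt (cvg_n_geo r0 r1) (divr_gt0 t0 M10).
  by apply: filterS => n; rewrite ltr_pdivlMr// mulrC.
have H3 : \forall n \near \oo, rho ^+ n < t.
  have := cvg0_lt (cvg_geo_mul 1 rho0 rho1) t0.
  by apply: filterS => n; rewrite mul1r.
near=> n; move=> b u z b1 uM zE.
have h1 : absC (zt n - al) < t by rewrite absCB; near: n.
have h2 : M1 * (n.+1%:R * r ^+ n) < t by near: n.
have h3 : rho ^+ n < t by near: n.
have zt0 : psum a n.+1 (zt n) = 0 by near: n.
have uM1 : absC u <= M1 by exact: le_trans MM1.
have ztr : absC (zt n) <= r by have := absC_lerB (zt n) al; move: t1; lra.
have rn0 : 0 <= r ^+ n by rewrite exprn_ge0.
have ztn : absC (zt n) ^+ n <= r ^+ n by rewrite lerXn2r// nnegrE absC_ge0.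
have x1 : absC (zt n ^+ n * u) <= M1 * r ^+ n.
  by rewrite absCM absCX mulrC ler_pM ?absC_ge0 ?exprn_ge0 ?absC_ge0.
have x2 : n.+1%:R * absC (zt n ^+ n * u) < t.
  apply: le_lt_trans h2; rewrite mulrCA ler_wpM2l//.
have x3 : absC (zt n ^+ n * u) < t.
  by apply: le_lt_trans x2; rewrite ler_peMl ?absC_ge0// ler1n.
have zzt : z - zt n = zt n ^+ n.+1 * u by rewrite zE addrC addKr.
have zzt' : absC (z - zt n) < t.
  rewrite zzt exprS -mulrA absCM; apply: le_lt_trans x3.
  by rewrite ler_piMl ?absC_ge0// (le_trans ztr)// ltW.
have zal : absC (z - al) < 2 * t.
  by apply: le_lt_trans (absC_triangle _ _ (zt n)) _; lra.
have zr : absC z <= r by have := absC_lerB z al; move: t1; lra.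
have z1 : absC z < 1 by exact: le_lt_trans r1.
split; [by []|by move: t2; lra|].
have ztn1 : absC (zt n ^+ n.+1) = absC (zt n) ^+ n.+1 by rewrite absCX.
set T := absC (zt n) ^+ n.+1 in ztn1 *.
have T0 : 0 <= T by rewrite -ztn1 absC_ge0.
have b'1 : bounded_by1 (cat_coef n.+1 a (fun=> 0)).
  by apply: cat_coef_bounded => // k; rewrite absC0.
(* F_n vanishes at [zt n], and the distance from z to [zt n] already carries the factor T, so the
   Taylor error carries it too. *)
have e1 : absC (psum a n.+1 z - c * (zt n ^+ n.+1 * u)) <= K * (2 * t + t) * M1 * T.
  have := @agree_taylor _ a (cat_coef n.+1 a (fun=> 0)) r rho (2 * t) z (zt n) al n a1 b'1 rrho rho1.
  rewrite !psum_power_series//; last exact: le_lt_trans r1.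
  rewrite zt0 subr0 zzt => h.
  apply: le_trans (h _ zr ztr (ltW alr) (ltW zal) _) _.
  - by move=> k kn; rewrite /cat_coef kn.
  - by move: h1 t0; lra.
  rewrite -/K absCM ztn1 [T * _]mulrC mulrA ler_wpM2r//.
  by rewrite ler_pM ?absC_ge0// ?mulr_ge0// ?addr_ge0// ?exprn_ge0// ?mulr_ge0 ?ler_wpM2l ?lerD// ltW.
have e2 : absC (power_series b z - power_series b al) <= L ^+ 2 * (2 * t).
  apply: le_trans (power_series_lipschitz b1 r1 zr (ltW alr)) _.
  by rewrite ler_wpM2l ?exprn_ge0 ?ltW.
have e3 : absC (z ^+ n.+1 - zt n ^+ n.+1) <= 2 * t * T.
  have -> : z = zt n * (1 + zt n ^+ n * u) by rewrite zE mulrDr mulr1 mulrA exprS.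
  rewrite exprMn -{2}[zt n ^+ n.+1]mulr1 -mulrBr absCM ztn1 mulrC ler_wpM2r//.
  apply: le_trans (absC_expr1D_sub1 _) _; last by rewrite ler_wpM2l// ltW.
  by move: t3 x2; lra.
have bL := absC_power_series_le b1 zr r1.
have split_error (p zn f zt' l g : C) :
  p + zn * f - zt' * (l + g) = (p - zt' * l) + ((zn - zt') * f + zt' * (f - g)) by ring.
rewrite split_error mulrCA.
apply: (le_trans (absCD _ _)); apply: le_trans (lerD e1 (absCD _ _)) _.
rewrite !absCM ztn1.
have e3' := ler_pM (absC_ge0 _) (absC_ge0 _) e3 bL.
have e2' := ler_wpM2l T0 e2.
apply: le_trans (lerD (lexx _) (lerD e3' e2')) _; rewrite -/L.
have -> : K * (2 * t + t) * M1 * T + (2 * t * T * L + T * (L ^+ 2 * (2 * t))) =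
  (3 * (t * K * M1) + 2 * (t * L) + 2 * (t * L ^+ 2)) * T by ring.
rewrite ler_wpM2r//.
have := mulr_ge0 (mulr_ge0 (ltW t0) K0) (ltW M10).
have := mulr_ge0 (ltW t0) (ltW L0); have := mulr_ge0 (ltW t0) (exprn_ge0 2 (ltW L0)).
by move: t4; lra.
Unshelve. all: by end_near. Qed.

Lemma power_seriesN a z : bounded_by1 a -> absC z < 1 ->
  power_series (fun k => - a k) z = - power_series a z.
Proof.
move=> a1 z1; have na1 : bounded_by1 (fun k => - a k) by move=> k; rewrite absCN.
have h1 := psum_cvg na1 z1.
have E : psum (fun k => - a k) ^~ z = (fun n => - psum a n z).
  by apply/funext => n; rewrite /psum -sumrN; apply: eq_bigr => k _; rewrite mulNr.
rewrite E in h1; apply: (cvg_unique (@norm_hausdorff _ C) h1).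
by apply: cvgN; exact: psum_cvg.
Qed.

Lemma tag_cvg a al (zt : nat -> C) : is_signs a -> absC al < 1 ->
  power_series (dcoef 1 a) al != 0 -> zt @ \oo --> al ->
  (\forall n \near \oo, psum a n.+1 (zt n) = 0) ->
  (fun n => hyper_of_set (rescale n (zt n) @` [set z | disk z /\
     exists2 f, littlewood_series f & psum a n.+1 z + z ^+ n.+1 * f z = 0])) @ \oo -->
  hyper_of_set [set (power_series (dcoef 1 a) al)^-1 * w | w in dragon al].
Proof.
move=> sa al1; set c := power_series _ al => c0 ztal Hzt0.
have a1 := is_signs_bounded sa.
have [d [n0 [d0 ald]]] := simple_zero_contracts a1 al1 c0.
have resc M e := @rescaled_equation a al zt M e a1 al1 ztal Hzt0.
rewrite /contracts -/c in resc *; clearbody c => ctr.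
have c0' : 0 < absC c by rewrite absC_gt0.
(* F_n(0) is a sign, so the zeros of F_n differ from 0 and the rescaling is nondegenerate. *)
have zt_neq0 : \forall n \near \oo, 0 < absC (zt n).
  apply: filterS Hzt0 => n; rewrite absC_gt0; apply: contra_eq_neq => ->.
  rewrite /psum big_ord_recl/= expr0 mulr1 big1 ?addr0.
    by have [->|->] := sa 0%N; rewrite ?oppr_eq0 oner_eq0.
  by move=> i _; rewrite /bump/= add1n expr0n/= mulr0.
rewrite dragonE//; apply: cvg_hyper_of_set.
- apply: continuous_compact; last exact: dragon_set_compact.
  by apply: continuous_subspaceT; exact: mulrl_continuous.
- by exists (c^-1 * power_series (fun=> 1) al), (power_series (fun=> 1) al) => //; exists (fun=> 1) => // k; left.
(* With the opposite continuation -b the limit equation holds exactly at u, so z0 is an approximate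
   solution. Newton's iteration from z0 finds a true one, at a distance small compared with |zt
   n|^(n+1). *)
- move=> x e [_ [b sb <-] <-] e0.
  pose b' k := - b k; have sb' : is_signs b'.
    by move=> k; rewrite /b'; have [->|->] := sb k; [right|left; rewrite opprK].
  have b'1 := is_signs_bounded sb'.
  set u := c^-1 * _; have cu : c * u = power_series b al by rewrite /u mulVKf.
  clearbody u.
  (* In turn: z0 is within d / 2 of al; the starting condition of [newton_root] holds on the ball of
     radius d / 2; the rescaled correction 2 t / absC c is smaller than e. *)
  pose t := Num.min (d / 2) (Num.min (absC c * (d / 2) / 4) (absC c * e / 4)).
  have t0 : 0 < t by rewrite !lt_min !divr_gt0 ?mulr_gt0 ?divr_gt0.
  have [t1 t2 t3] : [/\ t <= d / 2, t <= absC c * (d / 2) / 4 & t <= absC c * e / 4].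
    by have : t <= t by []; rewrite {2}/t !le_min => /and3P[].
  clearbody t.
  have H := resc (absC u) _ t0.
  have ztn1 : \forall n \near \oo, absC (zt n) < 1.
    have al10 : 0 < 1 - absC al by rewrite subr_gt0.
    move/cvg_absC : ztal => /(_ _ al10); apply: filterS => n.
    by have := absC_lerB (zt n) al; rewrite [absC (al - _)]absCB; lra.
  have n0n : \forall n \near \oo, (n0 <= n)%N by exists n0.
  move: H; apply: filterS3 (filterI zt_neq0 ztn1) n0n => n [zt0 zt1] n0n /(_ b').
  have [z0 z0E] : exists z0, z0 = zt n + zt n ^+ n.+1 * u by eexists.
  move=> /(_ u z0 b'1 (lexx _) z0E) [z01 z0al].
  have -> : power_series b' al = - power_series b al.
    exact: power_seriesN (is_signs_bounded sb) al1.
  rewrite cu subrr mulr0 subr0 => Hz0.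
  have ztn0 : 0 < absC (zt n) ^+ n.+1 by rewrite exprn_gt0.
  have ztnle : absC (zt n) ^+ n.+1 <= 1 by rewrite exprn_ile1// ltW.
  have [H HE] : exists H, H = power_series (cat_coef n.+1 a b') by eexists.
  have Hz0' : absC (H z0) <= t * absC (zt n) ^+ n.+1 by rewrite HE power_series_cat.
  have Hz0t : absC (H z0) <= t by apply: le_trans Hz0' _; rewrite ler_piMr// ltW.
  have near_al z : absC (z - z0) <= d / 2 -> absC (z - al) <= d.
    by have := absC_triangle z al z0; move: t1 z0al; clear; lra.
  have [z||z Hz zz0] := @newton_root _ H z0 c (d / 2) c0.
  - move=> w zd wd; rewrite HE; apply: (ctr n _ n0n _ _ z w (near_al _ zd) (near_al _ wd)).
      by apply: cat_coef_bounded => //; exact: is_signs_bounded.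
    by move=> k kn; rewrite /cat_coef kn.
  - by move: t0 t2 Hz0t; move: (absC (H z0)) (absC c) => ? ?; clear; lra.
  have zz0' : absC (z - z0) <= 2 * t * absC (zt n) ^+ n.+1 / absC c.
    by apply: le_trans zz0 _; rewrite ler_pM2r ?invr_gt0// -mulrA ler_pM2l.
  have zd : absC (z - al) <= d.
    apply: near_al; apply: le_trans zz0 _; rewrite ler_pdivrMr//.
    by move: t0 t2 Hz0t; move: (absC (H z0)) (absC c) => ? ?; clear; lra.
  have z1 : absC z < 1 by have := absC_lerB z al; move: zd ald; clear; lra.
  exists (rescale n (zt n) z).
    exists z => //; split; first exact/diskE.
    exists (power_series b'); first by exists b'.
    by have := power_series_cat n.+1 a1 b'1 z1; rewrite -HE Hz => <-.
  have -> : u - rescale n (zt n) z = (z0 - z) / zt n ^+ n.+1.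
    rewrite /rescale z0E; field.
    by rewrite -absC_eq0 absCX gt_eqF.
  rewrite absCM absCV absCX ltr_pdivrMr// absCB.
  apply: le_lt_trans zz0' _; rewrite ltr_pdivrMr// [ltRHS]mulrAC ltr_pM2r//.
  by move: t3 (mulr_gt0 c0' e0); move: (absC c) => ?; clear; lra.
(* Conversely, dividing an exact equation by c zt^(n+1) puts the rescaled coordinate within e / 2 of
   -f(al) / c. This is a point of the limit set because signs can be negated. *)
- move=> M e e0.
  have t0 : 0 < absC c * e / 2 by rewrite divr_gt0 ?mulr_gt0.
  have H := resc M _ t0.
  move: H; apply: filterS2 zt_neq0 => n zt0 Hn _ [z [_ [_ [b sb ->] Fz]] <-] yM.
  have ztn0 : 0 < absC (zt n) ^+ n.+1 by rewrite exprn_gt0.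
  have zE : z = zt n + zt n ^+ n.+1 * rescale n (zt n) z.
    by rewrite /rescale; field; rewrite -absC_eq0 absCX gt_eqF.
  have [_ _] := Hn b _ z (is_signs_bounded sb) yM zE.
  rewrite Fz sub0r absCN absCM absCX mulrC ler_pM2r// => h.
  exists (c^-1 * - power_series b al).
    exists (- power_series b al) => //; exists (fun k => - b k).
      by move=> k; have [->|->] := sb k; [right|left; rewrite opprK].
    by rewrite power_seriesN//; exact: is_signs_bounded.
  rewrite -(ltr_pM2l c0') -absCM mulrBr mulVKf// -opprD absCN addrC.
  by apply: le_lt_trans h _; move: t0; move: (absC c) => ?; clear; lra.
Qed.

End tags.

(** * Zeros of F and F_n in a closed disk *)

Section zeros_sum.
Context {R : realType}.
Local Notation C := (Cx R).
Implicit Types (a b : nat -> C) (z w u al : C).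

Lemma near_all_seq (T : eqType) (I : Type) (F : set_system I) {FF : Filter F}
    (s : seq T) (Q : T -> I -> Prop) :
  (forall x, x \in s -> \forall n \near F, Q x n) ->
  \forall n \near F, forall x, x \in s -> Q x n.
Proof.
elim: s => [_|x s IH h]; first by near=> n.
have h1 : \forall n \near F, Q x n by apply: h; rewrite mem_head.
have h2 : \forall n \near F, forall y, y \in s -> Q y n.
  by apply: IH => y ys; apply: h; rewrite inE ys orbT.
apply: filterS2 h1 h2 => n n1 n2 y; rewrite inE => /orP[/eqP->//|]; exact: n2.
Unshelve. all: by end_near. Qed.

Lemma sum_zerosE (f : C -> C) (phi : C -> R) (s : seq C) : uniq s ->
  (forall z, z \in s -> zeros f z /\ multiplicity f z = 1%N) ->
  (forall z, zeros f z -> z \notin s -> phi z = 0) ->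
  sum_zeros f phi = \sum_(z <- s) phi z.
Proof.
move=> us sf phi0; rewrite /sum_zeros -(@fsbig_widen _ _ _ _ [set` s]).
- rewrite -fsbig_seq//; rewrite big_seq [RHS]big_seq; apply: eq_bigr => z zs.
  by have [_ ->] := sf z zs; rewrite mulr1n.
- by move=> z /= zs; have [] := sf z zs.
- by move=> z [/= zf /negP zs]; rewrite /= phi0// mul0rn.
Qed.

Lemma multiplicity1 (f : C -> C) z : f z = 0 -> derive1 f z != 0 -> multiplicity f z = 1%N.
Proof.
move=> fz f'z; apply: get_unique => [|[|[|m]] []//].
- by split=> // -[].
- by rewrite /derive1n/= fz eqxx.
- by move=> h _; case/eqP: f'z; exact: (h 1%N isT).
Qed.

(** The contraction estimate fixes the slope only up to half of its size, but it forces |f w - f z|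
    >= |c| |w - z| / 2, which contradicts the quadratic bound if the derivative at z vanishes. *)
Lemma contraction_derive_neq0 (f : C -> C) z (c c1 : C) (d K : R) : 0 < d -> c != 0 ->
  (forall w, absC (w - z) < d -> absC (f w - f z - c1 * (w - z)) <= K * absC (w - z) ^+ 2) ->
  (forall w, absC (w - z) < d -> absC (f w - f z - c * (w - z)) <= absC c / 2 * absC (w - z)) ->
  c1 != 0.
Proof.
move=> d0 c0 h1 h2; apply/eqP => c10.
have c0' : 0 < absC c by rewrite absC_gt0.
pose K' : R := `|K| + 1; have K'0 : 0 < K' by rewrite /K' ltr_wpDl.
(* At distance t the quadratic bound is at most |c| t / 4, half of what the contraction forces. *)
pose t : R := Num.min (d / 2) (absC c / (4 * K')).
have t0 : 0 < t by rewrite lt_min !divr_gt0 ?mulr_gt0.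
have td : t < d.
  by apply: (@le_lt_trans _ _ (d / 2)); [rewrite ge_min lexx|move: d0; clear; lra].
have tK : t * K' <= absC c / 4.
  have : t <= absC c / (4 * K') by rewrite ge_min lexx orbT.
  by rewrite invfM mulrA ler_pdivlMr.
have wz : absC (z + embC t - z) = t by rewrite addrAC subrr add0r absC_emb ger0_norm// ltW.
have := h1 (z + embC t); have := h2 (z + embC t); rewrite wz => /(_ td) h3 /(_ td).
rewrite c10 mul0r subr0 => h4.
set F := f _ - f z in h3 h4.
have h5 : absC c * t <= absC (F - c * (z + embC t - z)) + absC F.
  rewrite -{1}wz -absCM -lerBlDr [leRHS]absCB; exact: absC_lerB.
have h6 : K * t ^+ 2 <= absC c / 4 * t.
  rewrite expr2 mulrA ler_pM2r//; apply: le_trans tK; rewrite mulrC ler_pM2l//.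
  by rewrite /K' (le_trans (ler_norm _))// lerDl.
move: h3 h4 h5 h6 (mulr_gt0 c0' t0); move: (absC _) (absC F) => ? ?; clear; lra.
Qed.

Lemma psum_quadratic a n z : bounded_by1 a -> absC z < 1 -> exists d K c1,
  [/\ 0 < d, derive1 (psum a n) z = c1 & forall w, absC (w - z) < d ->
    absC (psum a n w - psum a n z - c1 * (w - z)) <= K * absC (w - z) ^+ 2].
Proof.
move=> a1 z1; pose r := (absC z + 1) / 2.
have zr : absC z < r by rewrite /r; lra.
have r1 : r < 1 by rewrite /r; lra.
pose b := cat_coef n a (fun=> 0).
have b1 : bounded_by1 b by apply: cat_coef_bounded => // k; rewrite absC0.
have H w : absC (w - z) < r - absC z -> absC (psum a n w - psum a n z - power_series (dcoef 1 b) z * (w - z)) <=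
    2 * (1 - r)^-1 ^+ 3 * absC (w - z) ^+ 2.
  move=> wz; have wr : absC w <= r by have := absC_lerB w z; lra.
  rewrite -!psum_power_series//; last exact: le_lt_trans r1.
  rewrite expr2 mulrA; apply: power_series_taylor => //; rewrite ?subrr ?absC0 ?absC_ge0// ltW//.
have d0 : 0 < r - absC z by rewrite subr_gt0.
exists (r - absC z), (2 * (1 - r)^-1 ^+ 3), (power_series (dcoef 1 b) z); split=> //.
exact: (derive1_quadratic d0 H).
Qed.

Lemma nonzero_persists a z : bounded_by1 a -> absC z < 1 -> power_series a z != 0 ->
  exists d n0, 0 < d /\ forall w, absC (w - z) < d -> absC w < 1 ->
    power_series a w != 0 /\ forall n, (n0 <= n)%N -> psum a n.+1 w != 0.
Proof.
move=> a1 z1 Fz0.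
have e0 : 0 < absC (power_series a z) by rewrite absC_gt0.
pose r := (absC z + 1) / 2; pose rho := (r + 1) / 2.
have zr : absC z < r by rewrite /r; lra.
have rrho : r < rho by rewrite /rho /r; lra.
have rho1 : rho < 1 by rewrite /rho /r; lra.
have r1 : r < 1 by rewrite /r; lra.
have r0 : 0 <= r by rewrite /r; have := absC_ge0 z; lra.
have rho0 : 0 <= rho by rewrite /rho; lra.
move: e0; set E := absC _ => e0.
pose L := (1 - r)^-1 ^+ 2; have L0 : 0 < L by rewrite exprn_gt0// invr_gt0 subr_gt0.
have e40 : 0 < E / 4 by rewrite divr_gt0.
have [N _ NP] := cvg0_lt (cvg_geo_mul ((1 - r / rho)^-1 * (1 - rho)^-1) rho0 rho1) e40.
pose d := Num.min (r - absC z) (E / (4 * L)).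
exists d, N; split; first by rewrite lt_min subr_gt0 zr divr_gt0// mulr_gt0.
move=> w; rewrite /d lt_min => /andP[wz1 wz2] w1.
have wr : absC w <= r by have := absC_lerB w z; move: wz1; clear; lra.
have h1 : absC (power_series a w - power_series a z) <= E / 4.
  apply: le_trans (power_series_lipschitz a1 r1 wr (ltW zr)) _.
  by move: wz2; rewrite -/L invfM mulrA ltr_pdivlMr// mulrC => /ltW.
have h2 : E <= absC (power_series a w) + E / 4.
  by rewrite -lerBlDl; apply: le_trans (absC_lerB _ _) _; rewrite absCB.
split=> [|n Nn].
  by rewrite -absC_gt0; move: h2 e0; move: (absC _) => ?; clear; lra.
have h3 := power_series_psum_tail n.+1 a1 wr rrho rho1.
have h4 := NP n.+1 (leqW Nn).
have h5 := absC_lerB (power_series a w) (psum a n.+1 w).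
rewrite -absC_gt0; move: h2 e0 h5 (le_lt_trans h3 h4).
by move: (absC _) (absC _) (absC _) => ? ? ?; clear; lra.
Qed.

(** A quantitative form of Hurwitz's theorem, by compactness. Every point of the closed disk has a
    ball which is either a contraction ball around a zero of F, or free of zeros of F and of all
    late F_n. The list [s] keeps the centres of the first kind in a finite subcover. *)
Lemma finite_zeros a (r : R) : bounded_by1 a -> r < 1 ->
  (forall al, absC al < 1 -> power_series a al = 0 -> power_series (dcoef 1 a) al != 0) ->
  exists (s : seq C) (d : C -> R) (n0 : C -> nat), [/\ uniq s,
    forall al, al \in s -> [/\ absC al < 1, power_series a al = 0, 0 < d al,
      absC al + d al < 1 & contracts a al (d al) (n0 al)],
    forall z, absC z <= r -> power_series a z = 0 -> z \in s &
    exists N, forall n z, (N <= n)%N -> absC z <= r -> psum a n.+1 z = 0 ->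
      exists2 al, al \in s & absC (z - al) <= d al].
Proof.
move=> a1 r1 simple.
have /choice[dn dnP] : forall z, exists p : R * nat, absC z < 1 -> 0 < p.1 /\
    (power_series a z = 0 -> absC z + p.1 < 1 /\ contracts a z p.1 p.2) /\
    (power_series a z <> 0 -> forall w, absC (w - z) < p.1 -> absC w < 1 ->
      power_series a w != 0 /\ forall n, (p.2 <= n)%N -> psum a n.+1 w != 0).
  move=> z; have [z1|] := ltP (absC z) 1; last by exists (1, 0%N).
  have [Fz|Fz] := pselect (power_series a z = 0).
    have [d [n0 [d0 zd ctr]]] := simple_zero_contracts a1 z1 (simple _ z1 Fz).
    exists (d, n0) => _; split; first exact: d0.
    by split=> [_|h]; [split|case: (h Fz)].
  have [d [n0 [d0 h]]] := nonzero_persists a1 z1 (introN eqP Fz).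
  exists (d, n0) => _; split; first exact: d0.
  by split=> [h0|_]; [case: (Fz h0)|exact: h].
pose U z := [set w : C | absC (w - z) < (dn z).1].
have Uo z : open (U z).
  rewrite openE => w Uw; apply/nbhs_absC; exists ((dn z).1 - absC (w - z)).
    by rewrite subr_gt0.
  move=> w' ww'; rewrite /U/=; apply: le_lt_trans (absC_triangle _ _ w) _.
  by rewrite absCB -ltrBrDr.
have := @cdisk_compact R r; rewrite compact_cover => /(_ C [set z | absC z <= r] U).
case.
- by move=> z _; exact: Uo.
- move=> z /= zr; exists z => //; rewrite /U/= subrr absC0.
  by have [] := dnP z (le_lt_trans zr r1).
move=> D' sD' cov.
pose s := [seq z <- finmap.enum_fset D' | power_series a z == 0].
have sP al : al \in s -> absC al <= r /\ power_series a al = 0.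
  rewrite mem_filter => /andP[/eqP Fal /sD']; rewrite inE => alr; by split.
exists s, (fun z => (dn z).1), (fun z => (dn z).2); split.
- by rewrite filter_uniq// finmap.fset_uniq.
- move=> al /sP[alr Fal]; have al1 := le_lt_trans alr r1.
  by have [d0 [/(_ Fal) [h1 h2] _]] := dnP al al1.
- move=> z zr Fz; have [w /= wD Uw] := cov z zr.
  have /sD' := wD; rewrite inE/= => wr; have w1 := le_lt_trans wr r1.
  have z1 := le_lt_trans zr r1.
  have [d0 [h1 h2]] := dnP w w1.
  have [Fw|Fw] := pselect (power_series a w = 0); last first.
    by have [/eqP h _] := h2 Fw z Uw z1; case: (h Fz).
  have [_ ctr] := h1 Fw.
  (* A contraction ball contains no zero of F besides its centre. *)
  suff -> : z = w by rewrite mem_filter wD andbT; apply/eqP.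
  apply: (@newton_root_uniq _ (power_series a) w (power_series (dcoef 1 a) w) (dn w).1) => //.
  - exact: simple.
  - by move=> z' w' zd wd; exact: (ctr (dn w).2).
  - exact: ltW.
  - by rewrite subrr absC0 ltW.
(* From this rank on, no ball of the second kind contains a zero of F_n. *)
- exists (\max_(z <- finmap.enum_fset D') (dn z).2) => n z Nn zr Fnz.
  have [w /= wD Uw] := cov z zr.
  have /sD' := wD; rewrite inE/= => wr; have w1 := le_lt_trans wr r1.
  have z1 := le_lt_trans zr r1.
  have [d0 [h1 h2]] := dnP w w1.
  have [Fw|Fw] := pselect (power_series a w = 0); last first.
    have [_ h] := h2 Fw z Uw z1; have /eqP h' : psum a n.+1 z != 0.
      by apply: h; apply: leq_trans Nn; rewrite (big_rem w)//= leq_maxl.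
    by case: (h' Fnz).
  exists w; last exact: ltW.
  by rewrite mem_filter wD andbT; apply/eqP.
Qed.

End zeros_sum.

(** * The limit for a fixed sequence of signs *)

Section deterministic_limit.
Context {R : realType}.
Local Notation C := (Cx R).
Implicit Types (e : nat -> R) (z w al : C).

Lemma signs_embC e : (forall k, e k = 1 \/ e k = - 1) -> is_signs (fun k => embC (e k)).
Proof. by move=> he k; have [->|->] := he k; [left|right; rewrite embCN]. Qed.

Lemma test_function_support (g : C * hyperspace C -> R) : test_function g ->
  exists2 r : R, r < 1 & forall al H, absC al < 1 -> r < absC al -> g (al, H) = 0.
Proof.
move=> [_ [K [cK Kd gK]]].
have [K0|/set0P K0] := eqVneq K set0.
  exists 0 => // al H al1 _; apply: gK; first exact/diskE.
  by rewrite K0.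
have [|p /[!inE] Kp pM] := compact_EVT_max K0 cK (f := fun p => absC p.1).
  apply: continuous_subspaceT => p; apply: continuous_cvg; last exact: cvg_fst.
  exact: absC_continuous.
have [/diskE p1 _] := Kd _ Kp.
exists (absC p.1) => // al H al1 pal; apply: gK; first exact/diskE.
move=> Kal; have := pM (al, H); rewrite inE => /(_ Kal) /=.
by rewrite leNgt pal.
Qed.

(** Since [g] is continuous relative to the disk, the points [zt n] have to be shown to lie in the
    disk eventually. *)
Lemma test_function_cvg (g : C * hyperspace C -> R) (zt : nat -> C) al
    (Hn : nat -> hyperspace C) H : test_function g -> absC al < 1 ->
  zt @ \oo --> al -> Hn @ \oo --> H ->
  (fun n => g (zt n, Hn n)) @ \oo --> g (al, H).
Proof.
move=> [gc _] al1 ztal HnH.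
move/subspace_continuousP : gc => /(_ (al, H)) gc.
have {}gc : g @ within (disk `*` [set: hyperspace C]) (nbhs (al, H)) --> g (al, H).
  by apply: gc; split => //=; exact/diskE.
apply: cvg_trans gc.
have h : (fun n => (zt n, Hn n)) @ \oo --> within (disk `*` [set: hyperspace C]) (nbhs (al, H)).
  move=> A /= wA.
  have h1 : (fun n => (zt n, Hn n)) @ \oo --> (al, H).
    move=> B [[X Y] [/= Xal YH] XYB].
    have k1 : \forall n \near \oo, X (zt n) := ztal _ Xal.
    have k2 : \forall n \near \oo, Y (Hn n) := HnH _ YH.
    by apply: filterS2 k1 k2 => n Xn Yn; exact: XYB.
  have h2 : \forall n \near \oo, absC (zt n) < 1.
    have al10 : 0 < 1 - absC al by rewrite subr_gt0.
    move/cvg_absC : ztal => /(_ _ al10); apply: filterS => n.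
    by have := absC_lerB (zt n) al; rewrite [absC (al - _)]absCB; lra.
  have := h1 _ wA; apply: filterS2 h2 => n n1 /=; apply.
  by split=> //=; exact/diskE.
by move=> A gA; exact: (h (g @^-1` A) gA).
Qed.

Lemma cvg_sum_seq (T : eqType) (s : seq T) (f : T -> nat -> R) (l : T -> R) :
  (forall x, x \in s -> f x @ \oo --> l x) ->
  (fun n => \sum_(x <- s) f x n) @ \oo --> \sum_(x <- s) l x.
Proof.
elim: s => [_|x s IH h].
  by under eq_fun do rewrite big_nil; rewrite big_nil; exact: cvg_cst.
under eq_fun do rewrite big_cons; rewrite big_cons; apply: cvgD.
  by apply: h; rewrite mem_head.
by apply: IH => y ys; apply: h; rewrite inE ys orbT.
Qed.

Lemma F_truncE e n : F_trunc e n = psum (fun k => embC (e k)) n.+1.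
Proof. by []. Qed.

(** The strict bound on the distance to [al] leaves a ball around [z] inside the contraction ball,
    and there [contraction_derive_neq0] applies. *)
Lemma persisting_zero_simple (a : nat -> C) al d n0 z n : bounded_by1 a ->
  power_series (dcoef 1 a) al != 0 -> contracts a al d n0 -> absC al + d < 1 ->
  (n0 <= n)%N -> absC (z - al) < d -> psum a n.+1 z = 0 ->
  multiplicity (psum a n.+1) z = 1%N.
Proof.
move=> a1 c0 ctr ald n0n zd Fz.
have z1 : absC z < 1 by have := absC_lerB z al; lra.
apply: multiplicity1 => //.
have [d' [K [c1 [d'0 -> Q]]]] := psum_quadratic n.+1 a1 z1.
apply: (@contraction_derive_neq0 _ (psum a n.+1) z (power_series (dcoef 1 a) al) c1
  (Num.min d' (d - absC (z - al))) K) => //.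
- by rewrite lt_min d'0 subr_gt0.
- by move=> w; rewrite lt_min => /andP[wd' _]; exact: Q.
move=> w; rewrite lt_min => /andP[_ wd].
have wal : absC (w - al) <= d by have := absC_triangle w al z; lra.
have w1 : absC w < 1 by have := absC_lerB w al; lra.
rewrite -!psum_power_series//; apply: (ctr n) => //.
- by apply: cat_coef_bounded => // k; rewrite absC0.
- by move=> k kn; rewrite /cat_coef kn.
- exact: ltW.
Qed.

Lemma sum_zeros_cvg e (g : C * hyperspace C -> R) :
  (forall k, e k = 1 \/ e k = - 1) ->
  (forall al, zeros (F_series e) al -> derive1 (F_series e) al != 0) ->
  test_function g ->
  (fun n => sum_zeros (F_trunc e n) (fun al => g (al, tag_trunc e n al))) @ \oo -->
  sum_zeros (F_series e) (fun al => g (al, tag_limit e al)).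
Proof.
move=> he simple gt.
pose a k := embC (e k); have sa : is_signs a by exact: signs_embC.
have a1 := is_signs_bounded sa.
have [r r1 gr] := test_function_support gt.
have simple' al : absC al < 1 -> power_series a al = 0 -> power_series (dcoef 1 a) al != 0.
  move=> al1 Fal; rewrite -power_series_derive1//.
  by apply: simple; split => //; exact/diskE.
have [s [d [n0 [us sP scov [N NP]]]]] := finite_zeros a1 r1 simple'.
have /choice[zt ztP] : forall al, exists zt : nat -> C, al \in s -> zt @ \oo --> al /\
    \forall n \near \oo, [/\ absC (zt n - al) <= d al, psum a n.+1 (zt n) = 0 &
      forall z, absC (z - al) <= d al -> psum a n.+1 z = 0 -> z = zt n].
  move=> al; have [als|] := boolP (al \in s); last by exists (fun=> 0).
  have [al1 Fal d0 ald ctr] := sP al als.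
  have [zt h1 h2] := simple_zero_persists a1 al1 Fal (simple' _ al1 Fal) d0 ald ctr.
  by exists zt.
have -> : sum_zeros (F_series e) (fun al => g (al, tag_limit e al)) =
    \sum_(al <- s) g (al, tag_limit e al).
  apply: sum_zerosE => //.
    move=> al als; have [al1 Fal _ _ _] := sP al als.
    have zal : zeros (F_series e) al by split=> //; exact/diskE.
    by split=> //; apply: multiplicity1 => //; exact: simple.
  move=> z [/diskE z1 Fz] zs; apply: gr => //.
  by rewrite ltNge; apply: contra zs => zr; exact: scov.
(* For large n the zeros of F_n that matter are the points [zt al n]: they are simple, distinct for
   distinct [al], and at any other zero [g] vanishes. *)
have H : \forall n \near \oo, sum_zeros (F_trunc e n) (fun al => g (al, tag_trunc e n al)) =
    \sum_(al <- s) g (zt al n, tag_trunc e n (zt al n)).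
  have h1 : \forall n \near \oo, forall al, al \in s ->
      [/\ absC (zt al n - al) <= d al, psum a n.+1 (zt al n) = 0 &
      forall z, absC (z - al) <= d al -> psum a n.+1 z = 0 -> z = zt al n].
    by apply: near_all_seq => al als; have [] := ztP al als.
  have h2 : \forall n \near \oo, forall al, al \in s -> absC (zt al n - al) < d al.
    apply: near_all_seq => al als; have [al1 Fal d0 ald ctr] := sP al als.
    have [/cvg_absC /(_ _ d0) h _] := ztP al als.
    by apply: filterS h => n; rewrite absCB.
  have h3 : \forall n \near \oo, forall al, al \in s -> (n0 al <= n)%N.
    by apply: near_all_seq => al als; exists (n0 al).
  have h4 : \forall n \near \oo, forall al, al \in s -> forall be, be \in s ->
      al != be -> zt al n != zt be n.
    apply: near_all_seq => al als; apply: near_all_seq => be bes.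
    have [->|albe] := eqVneq al be; first by near=> n.
    have e0 : 0 < absC (al - be) / 2 by rewrite divr_gt0// absC_gt0 subr_eq0.
    have [/cvg_absC /(_ _ e0) k1 _] := ztP al als.
    have [/cvg_absC /(_ _ e0) k2 _] := ztP be bes.
    apply: filterS2 k1 k2 => n k1 k2 _; apply/eqP => zz.
    rewrite zz in k1; have := absC_triangle al be (zt be n).
    by rewrite [absC (zt be n - be)]absCB; lra.
  have h5 : \forall n \near \oo, (N <= n)%N by exists N.
  apply: filterS3 h1 (filterI h2 h3) (filterI h4 h5) => n {}h1 [{}h2 {}h3] [{}h4 {}h5].
  rewrite -(big_map (zt ^~ n) predT (fun z => g (z, tag_trunc e n z))).
  apply: sum_zerosE.
  - rewrite map_inj_in_uniq// => al be als bes ab; apply/eqP/negP => /negP albe.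
    by have := h4 al als be bes albe; rewrite ab eqxx.
  - move=> _ /mapP[al als ->]; have [al1 Fal d0 ald ctr] := sP al als.
    have [k1 k2 k3] := h1 al als.
    have z1 : absC (zt al n) < 1 by have := absC_lerB (zt al n) al; lra.
    split; first by split=> //; exact/diskE.
    rewrite F_truncE; apply: (persisting_zero_simple a1 (simple' _ al1 Fal) ctr ald) => //.
      exact: h3.
    exact: h2.
  - move=> z [/diskE z1 Fz] zs; apply: gr => //.
    rewrite ltNge; apply: contra zs => zr; have [al als zal] := NP n z h5 zr Fz.
    have [_ _ k3] := h1 al als; rewrite (k3 z zal Fz).
    by apply/mapP; exists al.
have {}H : (fun n => \sum_(al <- s) g (zt al n, tag_trunc e n (zt al n))) @ \oo -->
    \sum_(al <- s) g (al, tag_limit e al) ->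
  (fun n => sum_zeros (F_trunc e n) (fun al => g (al, tag_trunc e n al))) @ \oo -->
    \sum_(al <- s) g (al, tag_limit e al).
  by apply: cvg_trans; apply: near_eq_cvg; apply: filterS H => n ->.
apply: H; apply: cvg_sum_seq => al als; have [al1 Fal d0 ald ctr] := sP al als.
have [ztal zt0] := ztP al als.
apply: test_function_cvg => //.
have -> : tag_limit e al =
    hyper_of_set [set (power_series (dcoef 1 a) al)^-1 * w | w in dragon al].
  by rewrite /tag_limit power_series_derive1.
apply: (tag_cvg sa al1 (simple' _ al1 Fal) ztal).
by apply: filterS zt0 => n [].
Unshelve. all: by end_near. Qed.

End deterministic_limit.

(** * Jensen's inequality and orders of zeros *)

Section jensen.
Context {R : realType}.
Local Notation C := (Cx R).
Implicit Types (p q : {poly C}) (al x y : C) (rho : R).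

Lemma absC_sqr x : embC (absC x ^+ 2) = x * x^*.
Proof. by rewrite expr2 embCM -normE -expr2 normCK. Qed.

Lemma embC_conj (t : R) : (embC t)^* = embC t.
Proof.
apply/CrealP; rewrite realE -embC0 !ler_embC; exact: le_total.
Qed.

Lemma absC_blaschke rho al x y :
  absC (embC rho * x - al * y) ^+ 2 - absC (embC rho * y - al^* * x) ^+ 2 =
  (rho ^+ 2 - absC al ^+ 2) * (absC x ^+ 2 - absC y ^+ 2).
Proof.
apply: embC_inj; rewrite embCM !(embCD, embCN) !absC_sqr [embC (rho ^+ 2)]embCM.
rewrite !rmorphB !rmorphM/= !embC_conj conjCK; ring.
Qed.

(** By Parseval's identity, the mean of |p|^2 over the circle |z| = rho. *)
Definition wnorm rho p : R := \sum_(i < size p) (rho ^+ i * absC p`_i) ^+ 2.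

Lemma wnorm_wide rho p n : (size p <= n)%N ->
  wnorm rho p = \sum_(i < n) (rho ^+ i * absC p`_i) ^+ 2.
Proof.
move=> /subnKC <-; rewrite big_split_ord/= [X in _ + X]big1 ?addr0// => i _.
by rewrite nth_default ?leq_addr// absC0 mulr0 expr0n.
Qed.

(** On the circle |z| = rho the two linear factors have the same modulus. Algebraically, the
    coefficientwise differences are given by [absC_blaschke] and telescope. *)
Lemma wnorm_blaschke rho al q : 0 < rho ->
  wnorm rho (('X - al%:P) * q) = wnorm rho (((embC rho)%:P - (al^* / embC rho) *: 'X) * q).
Proof.
move=> rho0; set n := (size q).+2.
have rhoN0 : embC rho != 0 :> C by rewrite -embC0 (inj_eq embC_inj) gt_eqF.
have s1 : (size (('X - al%:P) * q)%R <= n)%N.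
  by apply: leq_trans (size_polyMleq _ _) _; rewrite size_XsubC/= /n.
have s2 : (size (((embC rho)%:P - (al^* / embC rho) *: 'X) * q)%R <= n)%N.
  apply: leq_trans (size_polyMleq _ _) _.
  have : (size ((embC rho)%:P - (al^* / embC rho) *: 'X : {poly C})%R <= 2)%N.
    apply: leq_trans (size_polyD _ _) _; rewrite geq_max size_polyN.
    rewrite (leq_trans (size_polyC_leq1 _))//=.
    by rewrite (leq_trans (size_scale_leq _ _))// size_polyX.
  move=> h; apply: (@leq_trans (2 + size q).-1); first by rewrite -!subn1 leq_sub2r// leq_add2r.
  by rewrite add2n /= /n leqnSn.
rewrite (wnorm_wide rho s1) (wnorm_wide rho s2); apply/eqP; rewrite -subr_eq0 -sumrB; apply/eqP.
(* The weighted coefficients of q shifted by one place; both ends of the telescoping sum, Q 0 and Q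
   n, vanish. *)
pose Q i : C := if i is j.+1 then embC (rho ^+ j) * q`_j else 0.
have step i : (rho ^+ i * absC (('X - al%:P) * q)`_i) ^+ 2 -
   (rho ^+ i * absC (((embC rho)%:P - (al^* / embC rho) *: 'X) * q)`_i) ^+ 2 =
   (rho ^+ 2 - absC al ^+ 2) * (absC (Q i) ^+ 2 - absC (Q i.+1) ^+ 2).
  rewrite -absC_blaschke.
  have e1 : rho ^+ i * absC (('X - al%:P) * q)`_i = absC (embC rho * Q i - al * Q i.+1).
    rewrite -[rho ^+ i]ger0_norm ?exprn_ge0 ?ltW// -absC_emb -absCM; congr absC.
    rewrite mulrBl coefB coefXM coefCM mulrBr /Q; case: i => [|i]/=; first by rewrite !mulr0 mulrCA.
    by rewrite exprS embCM mulrA mulrCA.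
  have e2 : rho ^+ i * absC (((embC rho)%:P - (al^* / embC rho) *: 'X) * q)`_i =
      absC (embC rho * Q i.+1 - al^* * Q i).
    rewrite -[rho ^+ i]ger0_norm ?exprn_ge0 ?ltW// -absC_emb -absCM; congr absC.
    rewrite mulrBl coefB coefCM -scalerAl coefZ coefXM mulrBr /Q; case: i {e1} => [|i]/=.
      by rewrite !mulr0 mulrCA.
    rewrite exprS embCM; field.
    exact: rhoN0.
  by rewrite e1 e2.
under eq_bigr do rewrite step.
rewrite -mulr_sumr.
have tel m : \sum_(i < m) (absC (Q i) ^+ 2 - absC (Q i.+1) ^+ 2) = absC (Q 0%N) ^+ 2 - absC (Q m) ^+ 2.
  elim: m => [|m IH]; first by rewrite big_ord0 subrr.
  by rewrite big_ord_recr/= IH addrA subrK.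
by rewrite tel /Q /n nth_default// mulr0 absC0 subrr mulr0.
Qed.

(** Jensen's inequality in quadratic mean: exchanging each factor X - al for its reflection, whose
    constant term is rho, preserves [wnorm], and [wnorm] dominates the squared constant
    coefficient. *)
Lemma wnorm_root_power rho al k q : 0 < rho ->
  (rho ^+ k * absC q`_0) ^+ 2 <= wnorm rho (('X - al%:P) ^+ k * q).
Proof.
move=> rho0; elim: k q => [|k IH] q.
  rewrite expr0 mul1r mul1r (@wnorm_wide _ _ (size q).+1)// big_ord_recl/= expr0 mul1r.
  by rewrite lerDl sumr_ge0// => i _; rewrite sqr_ge0.
rewrite [('X - _) ^+ _]exprS -mulrA wnorm_blaschke// mulrCA.
apply: le_trans (IH _); rewrite mulrBl coefB coefCM -scalerAl coefZ coefXM/= mulr0 subr0.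
by rewrite absCM absC_emb gtr0_norm// [rho ^+ k.+1]exprSr -mulrA.
Qed.

Lemma taylor_factor (p : {poly C}) al k : exists q,
  p - \sum_(j < k) (p^`N(j)).[al] *: ('X - al%:P) ^+ j = ('X - al%:P) ^+ k * q.
Proof.
(* Taylor's formula is applied over the ring {poly C}, to p with constant coefficients, at the point
   al + (X - al) = X. *)
have := @nderiv_taylor_wide {poly C} (k + size p) (map_poly polyC p) al%:P ('X - al%:P).
rewrite size_map_polyC => /(_ (mulrC _ _) (leq_addl _ _)).
rewrite addrC subrK -[_.['X]]/(p \Po 'X) comp_polyXr => {1}->.
exists (\sum_(i < size p) (p^`N(k + i)).[al] *: ('X - al%:P) ^+ i).
have E i : (map_poly polyC p)^`N(i).[al%:P] * ('X - al%:P) ^+ i = (p^`N(i)).[al] *: ('X - al%:P) ^+ i.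
  by rewrite nderivn_map horner_map mul_polyC.
under eq_bigr do rewrite E.
rewrite big_split_ord/= addrAC subrr add0r mulr_sumr; apply: eq_bigr => i _.
by rewrite exprD -scalerAr.
Qed.

Lemma nderivn_poly_horner (a : nat -> C) N j z :
  ((\poly_(i < N) a i)^`N(j)).[z] = psum (dcoef j a) (N - j) z.
Proof.
rewrite (@horner_coef_wide _ (N - j)); last first.
  by apply: leq_trans (size_poly _ _) _; rewrite leq_sub2r// size_poly.
apply: eq_bigr => i _; rewrite coef_nderivn coef_poly -ltn_subRL ltn_ord.
by rewrite /dcoef mulr_natl addnC.
Qed.

Lemma nderivn_poly_cvg (a : nat -> C) j z : bounded_by1 a -> absC z < 1 ->
  (fun N => ((\poly_(i < N) a i)^`N(j)).[z]) @ \oo --> power_series (dcoef j a) z.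
Proof.
move=> a1 z1; under eq_fun do rewrite nderivn_poly_horner.
move=> A zA; have [M _ MP] := @psum_dcoef_cvg _ j _ _ a1 z1 A zA; exists (M + j)%N => // n /= Mjn.
apply: MP => /=; rewrite -(leq_add2r j) subnK//.
by apply: leq_trans Mjn; exact: leq_addl.
Qed.

(* A power series with coefficients of modulus 1 has no zero of infinite
   order: by Jensen's inequality applied to the partial sums (corrected by
   their Taylor polynomials at [al], which tend to 0), the constant coefficient
   would be at most [(absC al / rho) ^+ k] times a constant, for all [k]. *)
Lemma finite_order_zero (a : nat -> C) al : bounded_by1 a -> absC (a 0%N) = 1 -> absC al < 1 ->
  exists j, power_series (dcoef j a) al <> 0.
Proof.
move=> a1 a01 al1; apply: contrapT => /forallNP inf.
have {}inf j : power_series (dcoef j a) al = 0 by apply: contrapT; exact: inf.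
have al0 := absC_ge0 al.
pose rho : R := (absC al + 1) / 2.
have alrho : absC al < rho by rewrite /rho; lra.
have rho1 : rho < 1 by rewrite /rho; lra.
have rho0 : 0 < rho by rewrite /rho; lra.
pose t := absC al / rho.
have t0 : 0 <= t by rewrite divr_ge0// ltW.
have t1 : t < 1 by rewrite ltr_pdivrMr// mul1r.
pose S := (1 - rho ^+ 2)^-1.
have rho21 : rho ^+ 2 < 1 by rewrite expr_lt1// ltW.
have S0 : 0 < S by rewrite invr_gt0 subr_gt0.
have t21 : t ^+ 2 < 1 by rewrite expr_lt1.
have V40 : 0 < 4^-1 :> R by rewrite invr_gt0.
(* 9 / 4 and 1 / 4 are the squares of 3 / 2 and 1 / 2: removing a Taylor polynomial with
   coefficients at most 1 / 2 leaves coefficients at most 3 / 2, and a constant coefficient at least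
   1 / 2. *)
have [k _ /(_ k (leqnn k)) /= kP] := cvg0_lt (cvg_geo_mul (9 / 4 * S) (exprn_ge0 2 t0) t21) V40.
pose p N := \poly_(i < N) a i.
pose B j : R := \sum_(i < size (('X - al%:P) ^+ j)) absC (('X - al%:P) ^+ j)`_i.
have BP j i : absC (('X - al%:P) ^+ j)`_i <= B j.
  have [h|h] := ltnP i (size (('X - al%:P) ^+ j)).
    by rewrite /B (bigD1 (Ordinal h))//= lerDl sumr_ge0// => *; exact: absC_ge0.
  by rewrite nth_default// absC0 sumr_ge0// => *; exact: absC_ge0.
have ecvg : (fun N => \sum_(j < k) absC ((p N)^`N(j)).[al] * B j) @ \oo --> (0 : R).
  rewrite [X in _ --> X](_ : 0 = \sum_(j < k) (0 * B j)); last first.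
    by rewrite big1// => *; rewrite mul0r.
  apply: cvg_sum_seq => j _; apply: cvgMl.
  rewrite -absC0 -(inf j); apply: continuous_cvg; first exact: absC_continuous.
  exact: nderivn_poly_cvg.
have V20 : 0 < 2^-1 :> R by rewrite invr_gt0.
have [N [N0 eN]] : exists N, (0 < N)%N /\ \sum_(j < k) absC ((p N)^`N(j)).[al] * B j < 2^-1.
  have [N _ NP] := cvg0_lt ecvg V20.
  by exists N.+1; split => //; apply: NP; rewrite /= leqnSn.
pose T := \sum_(j < k) ((p N)^`N(j)).[al] *: ('X - al%:P) ^+ j.
have Ti i : absC T`_i <= 2^-1.
  apply: le_trans (ltW eN); rewrite /T coef_sum; apply: le_trans (absC_sum _ _ _) _.
  by apply: ler_sum => j _; rewrite coefZ absCM ler_wpM2l ?absC_ge0.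
have [q qE] := taylor_factor (p N) al k; rewrite -/T in qE.
have pi i : absC (p N - T)`_i <= 3 / 2.
  rewrite coefB; apply: le_trans (absCD _ _) _; rewrite absCN.
  have : absC (p N)`_i <= 1 by rewrite coef_poly; case: ifP => _; rewrite ?absC0.
  by have := Ti i; lra.
have p0 : 2^-1 <= absC (p N - T)`_0.
  rewrite coefB; have := absC_lerB (p N)`_0 T`_0; rewrite {1}coef_poly N0 a01.
  by have := Ti 0%N; lra.
have wS : wnorm rho (p N - T) <= 9 / 4 * S.
  apply: (@le_trans _ _ (\sum_(i < size (p N - T)) 9 / 4 * (rho ^+ 2) ^+ i)).
    apply: ler_sum => i _; rewrite exprMn [leLHS]mulrC -exprM mulnC exprM.
    rewrite ler_wpM2r//; first by rewrite exprn_ge0// exprn_ge0// ltW.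
    by apply: (@le_trans _ _ ((3 / 2) ^+ 2)); [rewrite lerXn2r// nnegrE ?absC_ge0//; lra|lra].
  rewrite -mulr_sumr ler_wpM2l//.
  have := sum_bin_le 0 (size (p N - T)) (exprn_ge0 2 (ltW rho0)) rho21; rewrite expr1.
  by under eq_bigr do rewrite addn0 bin0 mul1r.
have q0 := wnorm_root_power al k q rho0; rewrite -qE in q0.
have q0E : absC (p N - T)`_0 = t ^+ k * (rho ^+ k * absC q`_0).
  rewrite qE coef0M -horner_coef0 horner_exp hornerXsubC sub0r absCM absCX absCN.
  by rewrite mulrA /t -exprMn divfK// gt_eqF.
have : (2^-1) ^+ 2 <= (absC (p N - T)`_0) ^+ 2 by rewrite lerXn2r// nnegrE ?absC_ge0.
rewrite q0E exprMn => h1.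
have : (t ^+ k) ^+ 2 * (rho ^+ k * absC q`_0) ^+ 2 <= (t ^+ k) ^+ 2 * (9 / 4 * S).
  by rewrite ler_wpM2l ?exprn_ge0//; exact: le_trans wS.
rewrite -[in leRHS]exprM mulnC exprM [leRHS]mulrC => h2.
have := le_lt_trans (le_trans h1 h2) kP; lra.
Qed.

End jensen.

(** * Approximation of a double zero by a root of a polynomial *)

Section double_zeros.
Context {R : realType}.
Local Notation C := (Cx R).
Implicit Types (p q : {poly C}) (al be : C) (s : seq C).

(** The bound on the logarithmic derivative in multiplied-out form, so that [al] may itself be a
    root, in which case [d] is 0. *)
Lemma deriv_prod_XsubC_le s al (d : R) : 0 <= d ->
  (forall z, z \in s -> d <= absC (al - z)) ->
  absC ((\prod_(z <- s) ('X - z%:P))^`()).[al] * d <=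
  (size s)%:R * absC (\prod_(z <- s) ('X - z%:P)).[al].
Proof.
move=> d0; elim: s => [_|z s IH sd].
  by rewrite big_nil -polyC1 derivC horner0 absC0 !mul0r.
have /IH {}IH : forall w, w \in s -> d <= absC (al - w).
  by move=> w ws; apply: sd; rewrite inE ws orbT.
have dz : d <= absC (al - z) by apply: sd; rewrite mem_head.
rewrite big_cons derivM derivXsubC mul1r hornerD !hornerM hornerXsubC.
set q := \prod_(_ <- _) _ in IH *.
apply: le_trans (ler_wpM2r d0 (absCD _ _)) _; rewrite !absCM mulrDl.
have -> : (size (z :: s))%:R * (absC (al - z) * absC q.[al]) =
  absC q.[al] * absC (al - z) + absC (al - z) * ((size s)%:R * absC q.[al]).
  by rewrite /= -natr1; ring.
by apply: lerD; [rewrite ler_wpM2l ?absC_ge0|rewrite -mulrA ler_wpM2l ?absC_ge0].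
Qed.

Lemma seq_argmin (T : eqType) (s : seq T) (f : T -> R) : s != [::] ->
  exists2 x, x \in s & forall y, y \in s -> f x <= f y.
Proof.
elim: s => // x [_ _|x' s IH _].
  by exists x; rewrite ?mem_head// => y; rewrite inE => /eqP->.
have [//|m ms mP] := IH.
have [xm|mx] := leP (f x) (f m).
  exists x; rewrite ?mem_head// => y; rewrite inE => /orP[/eqP->//|/mP]; exact: le_trans.
exists m; first by rewrite inE ms orbT.
by move=> y; rewrite inE => /orP[/eqP->|/mP//]; exact: ltW.
Qed.

(* The logarithmic derivative at [al] is the sum of the [(al - z)^-1] over the
   roots [z], so the root closest to [al] satisfies the bound. *)
Lemma near_root p al : (p^`()).[al] != 0 ->
  exists2 be, root p be & absC (be - al) * absC (p^`()).[al] <= (size p)%:R * absC p.[al].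
Proof.
move=> p'0; have [s pE] := closed_field_poly_normal p.
have p0 : p != 0 by apply: contra_neq p'0 => ->; rewrite deriv0 horner0.
have lp0 : lead_coef p != 0 by rewrite lead_coef_eq0.
have s0 : s != [::].
  apply: contra_neq p'0 => s0; rewrite pE s0 big_nil derivZ derivC scaler0 horner0 //.
have [be bes beP] := seq_argmin (fun z => absC (al - z)) s0.
exists be; first by rewrite pE rootZ// root_prod_XsubC.
have sp : (size s)%:R <= (size p)%:R :> R.
  have sp : size p = (size s).+1.
    by rewrite {1}pE size_scale// (size_prod_XsubC s id).
  by rewrite ler_nat sp.
have := deriv_prod_XsubC_le (absC_ge0 (al - be)) beP.
set q := \prod_(_ <- _) _ in pE * => h.
have -> : absC (p^`()).[al] = absC (lead_coef p) * absC (q^`()).[al].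
  by rewrite {1}pE derivZ hornerZ absCM.
have -> : absC p.[al] = absC (lead_coef p) * absC q.[al] by rewrite {1}pE hornerZ absCM.
rewrite absCB mulrCA [leRHS]mulrCA ler_wpM2l ?absC_ge0// mulrC; apply: le_trans h _.
by rewrite ler_wpM2r ?absC_ge0.
Qed.

Lemma deriv_nderivn p j : (p^`N(j))^`() = p^`N(j.+1) *+ j.+1.
Proof.
apply/polyP => i; rewrite coef_deriv !coef_nderivn coefMn coef_nderivn.
rewrite -!mulrnA addnS addSn; congr (_ *+ _).
by rewrite [RHS]mulnC mul_bin_left -addnS addKn mulnC.
Qed.

Lemma psum_poly_nderivn_tail (a : nat -> C) j r al : bounded_by1 a -> absC al < r -> r < 1 ->
  power_series (dcoef j a) al = 0 ->
  exists K : R, 0 <= K /\ forall N, (j <= N)%N ->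
    absC ((\poly_(i < N) a i)^`N(j)).[al] <= K * r ^+ N.
Proof.
move=> a1 alr r1 F0; have al0 := absC_ge0 al.
have r0 : 0 < r by exact: le_lt_trans alr.
pose K := (1 - absC al / r)^-1 ^+ j.+1 * (1 - r)^-1.
have K0 : 0 <= K.
  rewrite mulr_ge0 ?exprn_ge0// invr_ge0 subr_ge0 ltW//.
  by rewrite ltr_pdivrMr// mul1r.
exists (K / r ^+ j); split; first by rewrite divr_ge0// exprn_ge0// ltW.
move=> N jN; rewrite nderivn_poly_horner.
have := @power_series_dcoef_tail _ j _ _ _ al (N - j) a1 (lexx _) alr r1.
rewrite F0 sub0r absCN -/K => h; apply: le_trans h _.
rewrite -[in leRHS](subnK jN) exprD mulrACA [_ / _ * _]mulrAC -!mulrA.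
by rewrite mulVf ?mulr1// expf_eq0 gt_eqF// andbF.
Qed.

Lemma double_zero_approx (a : nat -> C) al (s r th : R) : is_signs a ->
  s < absC al -> absC al < r -> r < 1 -> r ^+ 2 < th -> th < 1 ->
  power_series a al = 0 -> power_series (dcoef 1 a) al = 0 ->
  \forall N \near \oo, exists j be, [/\ (j < N)%N,
    ((\poly_(i < N) a i)^`N(j) != 0) && root ((\poly_(i < N) a i)^`N(j)) be,
    s <= absC be, absC be <= r & absC (power_series a be) <= th ^+ N].
Proof.
move=> sa sal alr r1 rth th1 F0 F10; have a1 := is_signs_bounded sa.
have al0 := absC_ge0 al; have r0 : 0 < r by exact: le_lt_trans alr.
have al1 : absC al < 1 by exact: lt_trans r1.
have fin : exists j, `[< power_series (dcoef j a) al <> 0 >].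
  have a01 : absC (a 0%N) = 1 by have [->|->] := sa 0%N; rewrite ?absCN absC1.
  by have [j jP] := finite_order_zero a1 a01 al1; exists j; exact/asboolP.
(* m is the order of vanishing of F at al; the derivative of order m - 1 has a simple zero there. *)
case: (ex_minnP fin) => m /asboolP mP mmin {fin}.
have m_gt1 : (1 < m)%N.
  rewrite ltnNge; apply/negP; case: m mP {mmin} => [|[|//]] mP _; apply: mP => //.
  by rewrite dcoef0.
have Fj : power_series (dcoef m.-1 a) al = 0.
  apply: contrapT => /asboolP/mmin; case: m m_gt1 {mP mmin} => // m _.
  by rewrite ltnn.
set c := power_series (dcoef m a) al in mP *.
have c0 : 0 < absC c by rewrite absC_gt0; apply/eqP.
have [K [K0 KP]] := psum_poly_nderivn_tail a1 alr r1 Fj.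
have hcvg := @nderivn_poly_cvg _ a m al a1 al1; rewrite -/c in hcvg.
clearbody c.
have hc : \forall N \near \oo, absC c / 2 <= absC ((\poly_(i < N) a i)^`N(m)).[al].
  have c20 : 0 < absC c / 2 by rewrite divr_gt0.
  move/cvg_absC : hcvg => /(_ _ c20); apply: filterS => N.
  have := absC_lerB c ((\poly_(i < N) a i)^`N(m)).[al].
  move: (absC c) (absC (c - _)) (absC _.[al]) => ? ? ?; clear; lra.
have thgt0 : 0 < th by apply: le_lt_trans rth; exact: exprn_ge0 (ltW r0).
pose A : R := 2 * K / absC c.
have A0 : 0 <= A by rewrite divr_ge0 ?absC_ge0// mulr_ge0.
pose D : R := 2 * (1 - r)^-1 ^+ 3.
have D0 : 0 <= D by rewrite mulr_ge0// exprn_ge0// invr_ge0 subr_ge0 ltW.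
(* Since (N r^N)^2 = (N y^N)^2 th^N and y < 1, the gap between r^2 and th absorbs the factor N^2. *)
pose y := r / Num.sqrt th.
have sth0 : 0 < Num.sqrt th by rewrite sqrtr_gt0.
have y0 : 0 <= y by rewrite divr_ge0// ltW.
have y1 : y < 1.
  rewrite ltr_pdivrMr// mul1r -(ltr_pXn2r (n := 2))// ?nnegrE ?ltW//.
  by rewrite sqr_sqrtr// ltW.
have NxN (x e : R) : 0 <= x -> x < 1 -> 0 < e -> \forall N \near \oo, N%:R * x ^+ N < e.
  move=> x0 x1 e0; have := cvg0_lt (cvg_n_geo x0 x1) e0.
  apply: filterS => N; apply: le_lt_trans.
  by rewrite ler_wpM2r ?exprn_ge0// ler_nat.
(* [e1] keeps [be] in the annulus between s and r, and [e2] absorbs the constant D A^2. *)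
pose e1 : R := Num.min (absC al - s) (r - absC al) / (A + 1).
have e10 : 0 < e1 by rewrite divr_gt0 ?lt_min ?subr_gt0 ?sal ?alr// ltr_wpDl.
pose e2 : R := Num.min 1 (1 / (D * A ^+ 2 + 1)).
have DA0 : 0 <= D * A ^+ 2 by rewrite mulr_ge0// exprn_ge0.
have e20 : 0 < e2 by rewrite lt_min ltr01 divr_gt0// ltr_wpDl.
have h1 := NxN r e1 (ltW r0) r1 e10; have h2 := NxN y e2 y0 y1 e20.
have hm : \forall N \near \oo, (m <= N)%N by exists m.
apply: filterS3 hc (filterI h1 h2) hm => N {}hc [{}h1 {}h2] mN.
set p := (\poly_(i < N) a i)^`N(m.-1).
have m0 : (0 < m)%N by exact: ltnW.
have p'E : (p^`()).[al] = m%:R * ((\poly_(i < N) a i)^`N(m)).[al].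
  by rewrite /p deriv_nderivn prednK// hornerMn mulr_natl.
have p'c : absC c / 2 <= absC (p^`()).[al].
  rewrite p'E absCM absC_nat; apply: le_trans hc _.
  by rewrite ler_peMl ?absC_ge0// ler1n.
have p'0 : (p^`()).[al] != 0.
  by rewrite -absC_gt0; apply: lt_le_trans p'c; rewrite divr_gt0.
have [be rbe bal] := near_root p'0.
have pN0 : p != 0 by apply: contra_neq p'0 => ->; rewrite deriv0 horner0.
have sp : (size p)%:R <= N%:R :> R.
  rewrite ler_nat /p; apply: leq_trans (size_poly _ _) _.
  by apply: leq_trans (leq_subr _ _) (size_poly _ _).
have pal : absC p.[al] <= K * r ^+ N.
  by apply: KP; apply: leq_trans mN; exact: leq_pred.
have rN0 : 0 <= r ^+ N by rewrite exprn_ge0// ltW.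
have balA : absC (be - al) <= A * (N%:R * r ^+ N).
  have h3 : absC (be - al) * (absC c / 2) <= N%:R * (K * r ^+ N).
    apply: le_trans (ler_wpM2l (absC_ge0 _) p'c) _; apply: le_trans bal _.
    by rewrite ler_pM ?absC_ge0.
  have -> : A * (N%:R * r ^+ N) = N%:R * (K * r ^+ N) / (absC c / 2).
    by rewrite /A; field; rewrite gt_eqF.
  by rewrite ler_pdivlMr// divr_gt0.
have bale : absC (be - al) < Num.min (absC al - s) (r - absC al).
  apply: le_lt_trans balA _; have A10 : 0 < A + 1 by rewrite ltr_wpDl.
  apply: (@le_lt_trans _ _ ((A + 1) * (N%:R * r ^+ N))).
    by rewrite ler_wpM2r ?mulr_ge0// lerDl.
  by rewrite mulrC -ltr_pdivlMr.
move: bale; rewrite lt_min => /andP[b1 b2].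
have sbe : s <= absC be.
  have := absC_lerB al be; rewrite absCB; move: b1.
  by move: (absC _) (absC al) (absC be) => ? ? ?; clear; lra.
have ber : absC be <= r.
  have := absC_lerB be al; move: b2.
  by move: (absC (_ - _)) (absC al) (absC be) => ? ? ?; clear; lra.
exists m.-1, be; split => //.
- by rewrite prednK.
- by rewrite pN0.
(* F and F' vanish at al, so only the quadratic error of Taylor's formula remains. *)
have := power_series_taylor a1 r1 ber (ltW alr) (ltW alr) (lexx (absC (be - al))).
rewrite subrr absC0 F0 F10 mul0r !subr0 => /(_ (absC_ge0 _)) h; apply: le_trans h _.
rewrite -/D -mulrA -expr2.
apply: (@le_trans _ _ (D * (A * (N%:R * r ^+ N)) ^+ 2)).
  by rewrite ler_wpM2l// lerXn2r// nnegrE ?absC_ge0// mulr_ge0// mulr_ge0.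
have -> : D * (A * (N%:R * r ^+ N)) ^+ 2 = D * A ^+ 2 * (N%:R * y ^+ N) ^+ 2 * th ^+ N.
  have rN : r ^+ N = y ^+ N * Num.sqrt th ^+ N.
    by rewrite /y expr_div_n divfK// expf_neq0// gt_eqF.
  have tN : th ^+ N = (Num.sqrt th ^+ N) ^+ 2.
    by rewrite -exprM mulnC exprM sqr_sqrtr// ltW.
  by rewrite rN tN; ring.
rewrite ler_piMl ?exprn_ge0 ?(ltW thgt0)//.
move: h2; rewrite lt_min => /andP[h2 h3].
have u0 : 0 <= N%:R * y ^+ N by rewrite mulr_ge0// exprn_ge0.
rewrite -[(N%:R * _) ^+ 2]/((N%:R * y ^+ N) * (N%:R * y ^+ N)) mulrA.
apply: (@le_trans _ _ (D * A ^+ 2 * (N%:R * y ^+ N) * 1)).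
  by apply: ler_wpM2l; [exact: mulr_ge0 DA0 u0|exact: ltW].
rewrite mulr1; move: h3; rewrite ltr_pdivlMr ?ltr_wpDl// => h3.
by move: u0 h3; move: (D * A ^+ 2) (N%:R * y ^+ N) => ? ?; clear; lra.
Qed.

End double_zeros.

(** * Littlewood-Offord counting *)

Section littlewood_offord.
Context {R : realType}.
Local Notation C := (Cx R).
Implicit Types (x w be : C).

(** The first nonzero term dominates: relative to its coefficient, of modulus 2, the later terms add
    up to at most 2 (1/3) / (1 - 1/3) = 1. This is the origin of the bound 1 / 3. *)
Lemma separated_sum x (D : nat -> C) J : absC x <= 3^-1 ->
  (forall j, absC (D j) <= 2) -> (forall j, D j = 0 \/ 2 <= absC (D j)) ->
  (exists2 j, (j < J)%N & D j != 0) ->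
  absC x ^+ J <= absC (\sum_(j < J) D j * x ^+ j).
Proof.
move=> x3; elim: J D => [|J IH] D D2 Dor [j jJ Dj0]; first by [].
have x1 : absC x <= 1 by lra.
rewrite big_ord_recl/= expr0 mulr1.
have -> : \sum_(i < J) D (bump 0 i) * x ^+ bump 0 i = x * \sum_(i < J) D i.+1 * x ^+ i.
  by rewrite mulr_sumr; apply: eq_bigr => i _; rewrite /bump/= add1n exprS mulrCA.
have [D00|D02] := Dor 0%N.
  rewrite D00 add0r absCM exprS ler_wpM2l ?absC_ge0//.
  apply: (IH (fun k => D k.+1)) => //.
  by case: j jJ Dj0 => [|j] jJ Dj0; [rewrite D00 eqxx in Dj0|exists j].
have S3 : absC (\sum_(i < J) D i.+1 * x ^+ i) <= 3.
  apply: le_trans (absC_sum _ _ _) _.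
  apply: (@le_trans _ _ (\sum_(i < J) 2 * absC x ^+ i)).
    by apply: ler_sum => i _; rewrite absCM absCX ler_wpM2r// exprn_ge0// absC_ge0.
  have xlt1 : absC x < 1 by lra.
  have := sum_bin_le 0 J (absC_ge0 x) xlt1; rewrite expr1.
  under eq_bigr do rewrite addn0 bin0 mul1r.
  rewrite -mulr_sumr => h.
  have h2 : (1 - absC x)^-1 <= 3 / 2.
    by rewrite -[3 / 2]invrK lef_pV2 ?posrE ?invr_gt0//; lra.
  by lra.
have h1 : absC (x * \sum_(i < J) D i.+1 * x ^+ i) <= 1.
  rewrite absCM; have := ler_pM (absC_ge0 _) (absC_ge0 _) x3 S3.
  by move/le_trans; apply; lra.
apply: (@le_trans _ _ 1); first by rewrite exprn_ile1// absC_ge0.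
set y := x * _ in h1 *.
by have := absC_lerB (D 0%N) (- y); rewrite opprK absCN; lra.
Qed.

Lemma sum_multiples x (D : nat -> C) L J B : (0 < L)%N -> (L * J <= B)%N ->
  (forall i, ~~ ((L %| i) && (i < L * J))%N -> D i = 0) ->
  \sum_(i < B) D i * x ^+ i = \sum_(j < J) D (L * j)%N * (x ^+ L) ^+ j.
Proof.
move=> L0 /subnKC <- D0; rewrite big_split_ord/= [X in _ + X]big1 ?addr0; last first.
  by move=> i _; rewrite D0 ?mul0r// negb_and -leqNgt leq_addr orbT.
have {}D0 i : ~~ (L %| i)%N -> D i = 0 by move=> h; rewrite D0// negb_and h.
elim: J => [|J IH]; first by rewrite muln0 !big_ord0.
rewrite big_ord_recr/= -IH mulnS addnC big_split_ord/=; congr (_ + _).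
case: L L0 D0 {IH} => // L _ D0.
rewrite big_ord_recl/= addn0 exprM big1 ?addr0// => i _.
rewrite /bump/= add1n D0 ?mul0r// dvdn_addr ?dvdn_mulr//.
by apply/negP => /dvdn_leq -/(_ isT); rewrite ltnS leqNgt ltn_ord.
Qed.

Lemma sgnC_diff (b c : bool) : absC (sgnC b - sgnC c : C) <= 2 /\
  (sgnC b - sgnC c = 0 :> C \/ 2 <= absC (sgnC b - sgnC c : C)).
Proof.
have n2 : absC (1 + 1 : C) = 2 by rewrite -[1 + 1]/(2%:R) absC_nat.
have z2 : absC (0 : C) <= 2 by rewrite absC0.
case: b; case: c; rewrite /sgnC ?subrr ?opprK -?opprD ?absCN ?n2.
- by split=> //; left.
- by split=> //; right.
- by split=> //; right.
- by split=> //; left.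
Qed.

Lemma sgnC_inj : injective (@sgnC R).
Proof.
have h : (1 : C) != - 1 by rewrite -addr_eq0 -[1 + 1]/(2%:R) pnatr_eq0.
by move=> [] []//= /eqP; rewrite ?(negbTE h)// eq_sym (negbTE h).
Qed.

(* Flipping the bits at the positions [L * j] moves the sum out of any ball of
   radius [s ^+ (L * J) / 2], so that the [2 ^ J] flips of the patterns
   counted below are all distinct. *)
Lemma littlewood_offord be w (s : R) L J B : (0 < L)%N -> (L * J <= B)%N ->
  0 <= s -> s <= absC be -> absC be ^+ L <= 3^-1 ->
  (#|[pred v : {ffun 'I_B -> bool} |
     (absC (\sum_(i < B) sgnC (v i) * be ^+ i + w) < s ^+ (L * J) / 2)%R]| * 2 ^ J <= 2 ^ B)%N.
Proof.
move=> L0 LJB s0 sbe be3; set S := [pred v | _].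
(* Bit j acts at position L * j, where the sum involves the j-th power of be^L, a base of modulus at
   most 1 / 3. *)
pose ext (y : {ffun 'I_J -> bool}) i :=
  if (L %| i)%N then if insub (i %/ L)%N is Some j then y j else false else false.
pose flip (p : {ffun 'I_B -> bool} * {ffun 'I_J -> bool}) : {ffun 'I_B -> bool} :=
  [ffun i : 'I_B => p.1 i (+) ext p.2 i].
have inj : {in [predX S & predT] &, injective flip}.
  move=> [v y] [v' y']; rewrite !inE/= !andbT => Sv Sv' vv'.
  have vE i : v i (+) ext y i = v' i (+) ext y' i.
    by have /ffunP/(_ i) := vv'; rewrite !ffunE.
  pose vb (u : {ffun 'I_B -> bool}) i := if insub i is Some k then u k else false.
  have vbE u (i : 'I_B) : vb u i = u i by rewrite /vb valK.
  pose D i : C := sgnC (vb v i) - sgnC (vb v' i).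
  have D0 i : ~~ ((L %| i) && (i < L * J))%N -> D i = 0.
    move=> h; rewrite /D; have [iB|iB] := ltnP i B; last first.
      by rewrite /vb insubF ?subrr// ltnNge iB.
    have := vE (Ordinal iB); rewrite -!vbE/=.
    have ext0 z : ext z i = false.
      rewrite /ext; case: ifP => // Li; rewrite insubF// ltn_divLR// mulnC.
      by move: h; rewrite Li/= => /negbTE.
    by rewrite !ext0 !addbF => ->; rewrite subrr.
  (* Otherwise v and v' differ, and only at multiples of L, so by [separated_sum] the two sums are
     at least s^(LJ) apart; but both lie in a ball of radius s^(LJ) / 2. *)
  have v_eq : v = v'.
    apply: contrapT => vneq.
    have [i Di] : exists i : 'I_B, D i != 0.
      apply: contrapT => /forallNP h; apply: vneq; apply/ffunP => i.
      apply: sgnC_inj; apply/eqP; rewrite -subr_eq0 -!vbE; apply/negP => /negP k.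
      exact: (h i).
    have Dsum : absC be ^+ (L * J) <= absC (\sum_(i < B) D i * be ^+ i).
      rewrite (sum_multiples be L0 LJB D0) exprM -absCX.
      apply: (@separated_sum _ (fun j => D (L * j)%N)).
      - by rewrite absCX.
      - by move=> j; have [] := sgnC_diff (vb v (L * j)%N) (vb v' (L * j)%N).
      - by move=> j; have [] := sgnC_diff (vb v (L * j)%N) (vb v' (L * j)%N).
      have : ((L %| i) && (i < L * J))%N.
        by apply: contraNT Di => /D0 ->; rewrite eqxx.
      move=> /andP[/dvdnP[j ij] iLJ]; exists j.
        by rewrite ij mulnC ltn_mul2l L0 in iLJ.
      by rewrite mulnC -ij.
    have sLJ : s ^+ (L * J) <= absC be ^+ (L * J) by rewrite lerXn2r// nnegrE ?absC_ge0.
    move: Sv Sv'.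
    set X := \sum_(i < B) sgnC (v i) * be ^+ i; set X' := \sum_(i < B) sgnC (v' i) * be ^+ i.
    have DX : \sum_(i < B) D i * be ^+ i = (X + w) - (X' + w).
      rewrite opprD addrACA subrr addr0 /X /X' -sumrB; apply: eq_bigr => k _.
      by rewrite /D !vbE mulrBl.
    move: Dsum; rewrite DX => Dsum h1 h2.
    have := absCD (X + w) (- (X' + w)); rewrite absCN.
    move: Dsum sLJ h1 h2; move: (absC (_ - _)) (absC (X + w)) (absC (X' + w)) (absC be ^+ _) (s ^+ _).
    by move=> ? ? ? ? ?; clear; lra.
  rewrite v_eq; congr (_, _); apply/ffunP => j.
  have LjB : (L * j < B)%N by apply: leq_trans LJB; rewrite ltn_mul2l L0/=.
  have := vE (Ordinal LjB); rewrite v_eq => /addbI.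
  by rewrite /ext/= dvdn_mulr// mulKn// valK.
have := max_card [in fintype.image flip [predX S & predT]].
by rewrite (fintype.card_in_image inj) cardX !card_ffun !card_bool !card_ord.
Qed.

Lemma card_has_le (T : finType) (X : eqType) (l : seq X) (Q : X -> pred T) m M :
  (forall y, y \in l -> (#|[pred t | Q y t]| * m <= M)%N) ->
  (#|[pred t | has (Q ^~ t) l]| * m <= size l * M)%N.
Proof.
elim: l => [_|y l IH h]; first by rewrite eq_card0.
have h1 : (#|[pred t | Q y t]| * m <= M)%N by apply: h; rewrite mem_head.
have h2 : (#|[pred t | has (Q ^~ t) l]| * m <= size l * M)%N.
  by apply: IH => z zl; apply: h; rewrite inE zl orbT.
apply: leq_trans (leq_add h1 h2); rewrite -mulnDl leq_mul2r; apply/orP; right.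
rewrite -cardUI; apply: leq_trans (leq_addr _ _).
by apply: subset_leq_card; apply/fintype.subsetP => t; rewrite !inE.
Qed.

Lemma card_pair_le (T1 T2 : finType) (Q : T1 -> pred T2) m M :
  (forall t1, (#|[pred t | Q t1 t]| * m <= M)%N) ->
  (#|[pred p : T1 * T2 | Q p.1 p.2]| * m <= #|T1| * M)%N.
Proof.
move=> h; rewrite -sum1_card.
rewrite (eq_bigl (fun p : T1 * T2 => predT p.1 && Q p.1 p.2)) => [|p]; last by rewrite inE.
rewrite -(pair_big_dep predT Q (fun _ _ => 1%N))/= big_distrl/= -sum_nat_const.
by apply: leq_sum => t1 _; rewrite sum1_card; exact: h.
Qed.

Definition bits n (u : {ffun 'I_n -> bool}) k := if insub k is Some i then u i else false.

Lemma bitsE n (u : {ffun 'I_n -> bool}) (i : 'I_n) : bits u i = u i.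
Proof. by rewrite /bits valK. Qed.

(** Giving no roots to the zero polynomial keeps the length below the size; [near_vanishing]
    correspondingly asks for a nonzero polynomial. *)
Definition polyroots (p : {poly C}) : seq C :=
  if p == 0 then [::] else sval (closed_field_poly_normal p).

Lemma mem_polyroots (p : {poly C}) be : p != 0 -> root p be -> be \in polyroots p.
Proof.
move=> p0; rewrite /polyroots (negbTE p0); case: closed_field_poly_normal => s /= pE.
by rewrite {1}pE rootZ ?lead_coef_eq0// root_prod_XsubC.
Qed.

Lemma size_polyroots (p : {poly C}) N : (size p <= N)%N -> (size (polyroots p) <= N)%N.
Proof.
rewrite /polyroots; have [//|p0] := eqVneq p 0.
case: closed_field_poly_normal => s /= pE; apply: leq_trans; rewrite {1}pE.
by rewrite size_scale ?lead_coef_eq0// (size_prod_XsubC s id).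
Qed.

(* The first [N] signs determine the candidates [be], and the event is that
   the next [B] signs make the power series nearly vanish at one of them. *)
Definition near_vanishing (s r : R) L J N B (b : nat -> bool) : Prop :=
  exists j be, [/\ (j < N)%N,
    ((\poly_(i < N) sgnC (b i) : {poly C})^`N(j) != 0) &&
      root ((\poly_(i < N) sgnC (b i))^`N(j)) be,
    s <= absC be, absC be <= r &
    absC (\sum_(i < B) sgnC (b (N + i)%N) * be ^+ i +
          psum (sgnC \o b) N be / be ^+ N) < s ^+ (L * J) / 2].

Lemma near_vanishing_ext s r L J N B b b' :
  (forall i, (i < N + B)%N -> b i = b' i) ->
  near_vanishing s r L J N B b -> near_vanishing s r L J N B b'.
Proof.
move=> bb [j [be [jN pbe sbe ber h]]].
have pE : \poly_(i < N) sgnC (b i) = \poly_(i < N) sgnC (b' i) :> {poly C}.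
  by apply: eq_poly => i iN; rewrite bb// ltn_addr.
exists j, be; split; rewrite -?pE//.
have <- : \sum_(i < B) sgnC (b (N + i)%N) * be ^+ i = \sum_(i < B) sgnC (b' (N + i)%N) * be ^+ i.
  by apply: eq_bigr => i _; rewrite bb// ltn_add2l.
have <- // : psum (sgnC \o b) N be = psum (sgnC \o b') N be.
by apply: eq_bigr => i _; rewrite /= bb// ltn_addr.
Qed.

(** There are N derivatives with at most N roots each. A candidate and the offset in its sum are
    functions of the first N bits, so [littlewood_offord] counts the last B bits with both fixed. *)
Lemma near_vanishing_card (s r : R) L J N B : (0 < L)%N -> (L * J <= B)%N -> 0 <= s ->
  0 <= r -> r ^+ L <= 3^-1 ->
  (#|[pred u : {ffun 'I_(N + B) -> bool} | `[< near_vanishing s r L J N B (bits u) >]]| * 2 ^ J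
    <= N ^ 2 * 2 ^ (N + B))%N.
Proof.
move=> L0 LJB s0 r0 r3.
pose P (u1 : {ffun 'I_N -> bool}) j : {poly C} := (\poly_(i < N) sgnC (bits u1 i))^`N(j).
pose cand u1 := [seq be <- flatten [seq polyroots (P u1 j) | j <- iota 0 N] | s <= absC be <= r].
pose Q (u1 : {ffun 'I_N -> bool}) (be : C) : pred {ffun 'I_B -> bool} := fun v =>
  absC (\sum_(i < B) sgnC (v i) * be ^+ i + psum (sgnC \o bits u1) N be / be ^+ N) <
    s ^+ (L * J) / 2.
have szcand u1 : (size (cand u1) <= N ^ 2)%N.
  rewrite /cand size_filter; apply: leq_trans (count_size _ _) _.
  rewrite size_flatten /shape -map_comp sumnE big_map -mulnn.
  apply: (@leq_trans (\sum_(j <- iota 0 N) N)); last by rewrite big_const_seq count_predT size_iota iter_addn_0.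
  apply: leq_sum => j _; apply: size_polyroots; apply: leq_trans (size_poly _ _) _.
  by apply: leq_trans (leq_subr _ _) (size_poly _ _).
have cardQ u1 : (#|[pred v | has (fun be => Q u1 be v) (cand u1)]| * 2 ^ J <= N ^ 2 * 2 ^ B)%N.
  apply: leq_trans (leq_mul (szcand u1) (leqnn _)).
  apply: (@card_has_le _ _ (cand u1) (Q u1)) => be.
  rewrite mem_filter => /andP[/andP[sbe ber] _].
  apply: littlewood_offord => //; apply: le_trans r3.
  by rewrite lerXn2r// nnegrE absC_ge0.
have := card_pair_le cardQ; rewrite card_ffun card_bool card_ord mulnCA -expnD.
apply: leq_trans; rewrite leq_mul2r; apply/orP; right.
pose h (u : {ffun 'I_(N + B) -> bool}) : {ffun 'I_N -> bool} * {ffun 'I_B -> bool} :=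
  ([ffun i => u (lshift B i)], [ffun i => u (rshift N i)]).
have hinj : injective h.
  move=> u u' [] /ffunP h1 /ffunP h2; apply/ffunP => i.
  case: (split_ordP i) => k ->; first by have := h1 k; rewrite !ffunE.
  by have := h2 k; rewrite !ffunE.
rewrite -(fintype.card_image hinj); apply: subset_leq_card; apply/fintype.subsetP => p /fintype.imageP[u].
move=> /asboolP-[j [be [jN /andP[p0 pbe] sbe ber nv]]] ->.
change (has (fun be => Q (h u).1 be (h u).2) (cand (h u).1)).
have b1 i : (i < N)%N -> bits (h u).1 i = bits u i.
  move=> iN; have -> : bits (h u).1 i = (h u).1 (Ordinal iN) by rewrite -bitsE.
  by rewrite /h/= ffunE -bitsE.
have b2 (i : 'I_B) : (h u).2 i = bits u (N + i)%N by rewrite /h/= ffunE -bitsE.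
have PE : P (h u).1 j = (\poly_(i < N) sgnC (bits u i))^`N(j).
  by rewrite /P; congr (_^`N(_)); apply: eq_poly => i iN; rewrite b1.
apply/hasP; exists be.
  rewrite mem_filter sbe ber/=; apply/flattenP; exists (polyroots (P (h u).1 j)).
    by apply/mapP; exists j => //; rewrite mem_iota.
  by apply: mem_polyroots; rewrite PE.
rewrite /Q; under eq_bigr do rewrite b2.
have -> // : psum (sgnC \o bits (h u).1) N be = psum (sgnC \o bits u) N be.
by apply: eq_bigr => i _; rewrite /= b1.
Qed.

End littlewood_offord.

(** * From double zeros to near-vanishing events *)

Section double_zero_event.
Context {R : realType}.
Local Notation C := (Cx R).

Lemma power_series_split (a : nat -> C) n z : bounded_by1 a -> absC z < 1 ->
  power_series a z = psum a n z + z ^+ n * power_series (fun i => a (n + i)%N) z.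
Proof.
move=> a1 z1; have a'1 : bounded_by1 (fun i => a (n + i)%N) by move=> k; exact: a1.
rewrite -(power_series_cat n a1 a'1 z1).
congr (power_series _ z); apply/funext => k; rewrite /cat_coef.
by case: ltnP => // /subnKC ->.
Qed.

Lemma exists_expr_le (x e : R) : 0 <= x -> x < 1 -> 0 < e -> exists n, x ^+ n.+1 <= e.
Proof.
move=> x0 x1 e0; have [n _ /(_ n.+1 (leqnSn n))] := cvg0_lt (cvg_geo_mul 1 x0 x1) e0.
by rewrite /= mul1r => h; exists n; exact: ltW.
Qed.

Lemma double_zero_near_vanishing (s r : R) : 0 < s -> s < r -> r < 1 -> r ^+ 2 < s ->
  exists L A B, [/\ (0 < L)%N, (0 < A)%N, (L <= B)%N, r ^+ L <= 3^-1 &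
    forall (b : nat -> bool) (al : C), s < absC al -> absC al < r ->
      power_series (sgnC \o b) al = 0 -> power_series (dcoef 1 (sgnC \o b)) al = 0 ->
      \forall J \near \oo, near_vanishing s r L J (A * J) (B * J) b].
Proof.
move=> s0 sr r1 r2s; have r0 : 0 < r by exact: lt_trans sr.
pose th := (r ^+ 2 + s) / 2.
have rth : r ^+ 2 < th by rewrite /th; lra.
have ths : th < s by rewrite /th; lra.
have th1 : th < 1 by apply: lt_trans (lt_trans ths sr) r1.
have th0 : 0 < th by apply: le_lt_trans rth; rewrite exprn_ge0// ltW.
have [L' L3] := exists_expr_le (ltW r0) r1 (ltac:(by rewrite invr_gt0) : 0 < 3^-1 :> R).
set L := L'.+1 in L3.
pose sg := s ^+ L; have sg0 : 0 < sg by rewrite exprn_gt0.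
have sg20 : 0 < sg / 2 by rewrite divr_gt0.
have q0 : 0 <= th / s by rewrite divr_ge0// ltW.
have q1 : th / s < 1 by rewrite ltr_pdivrMr// mul1r.
have [A' AP] := exists_expr_le q0 q1 sg20; set A := A'.+1 in AP.
have [B' BP] := exists_expr_le (ltW r0) r1 sg20.
pose B := (L + B'.+1)%N.
have BP' : r ^+ B <= sg / 2.
  apply: le_trans BP; rewrite /B exprD ler_piMl ?exprn_ge0 ?(ltW r0)//.
  by apply: (le_trans L3); lra.
exists L, A, B; split=> //; first by rewrite /B leq_addr.
move=> b al sal alr F0 F10.
pose a : nat -> C := sgnC \o b.
have sa : is_signs a by exact: sgnC_signs.
have a1 := is_signs_bounded sa.
have [N0 _ N0P] := double_zero_approx sa sal alr r1 rth th1 F0 F10.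
have r10 : 0 < 1 - r by rewrite subr_gt0.
pose K := 1 + (1 - r)^-1.
have K0 : 0 < K by rewrite addr_gt0// invr_gt0.
have h20 : 0 <= 2^-1 :> R by rewrite invr_ge0.
have h21 : 2^-1 < 1 :> R by lra.
have h22 : 0 < 2^-1 :> R by rewrite invr_gt0.
have [J0 _ J0P] := cvg0_lt (cvg_geo_mul K h20 h21) h22.
exists (N0 + J0)%N => // J /= JP.
have AJ : (N0 <= A * J)%N.
  apply: leq_trans (leq_pmull J (isT : 0 < A)%N).
  by apply: leq_trans JP; exact: leq_addr.
have [j [be [jN pbe sbe ber Fbe]]] := N0P _ AJ.
exists j, be; split => //.
have be1 : absC be < 1 by exact: le_lt_trans r1.
have be0 : be != 0 by rewrite -absC_gt0; exact: lt_le_trans sbe.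
set N := (A * J)%N in jN pbe Fbe *; set M := (B * J)%N.
pose a' i := a (N + i)%N.
have a'1 : bounded_by1 a' by move=> k; exact: a1.
have E1 := power_series_split N a1 be1; rewrite -/a' in E1.
have E2 := power_series_split M a'1 be1.
have G1 : absC (power_series (fun i => a' (M + i)%N) be) <= (1 - r)^-1.
  by apply: absC_power_series_le => // k; exact: a'1.
rewrite -[\sum_(i < M) _]/(psum a' M be) -/a.
move: G1 E1 E2 Fbe; move: (power_series (fun i => a' (M + i)%N) be) (power_series a' be) (power_series a be).
move=> G2 G F G1 E1 E2 Fbe.
(* F is split into the first N terms, the next M terms and the remainder, then divided by be^N. *)
have -> : psum a' M be + psum a N be / be ^+ N = F / be ^+ N - be ^+ M * G2.
  rewrite E1 E2; move: (psum a' M be) (psum a N be) => x y; field.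
  by rewrite expf_neq0.
apply: le_lt_trans (absCD _ _) _; rewrite absCN !absCM absCV !absCX.
have e1 : absC F / absC be ^+ N <= (sg / 2) ^+ J.
  apply: (@le_trans _ _ ((th / s) ^+ N)).
    rewrite expr_div_n ler_pM ?absC_ge0 ?invr_ge0 ?exprn_ge0 ?absC_ge0//.
    rewrite lef_pV2 ?posrE ?exprn_gt0//; last by rewrite absC_gt0.
    by rewrite lerXn2r// nnegrE ?absC_ge0// ltW.
  by rewrite /N exprM lerXn2r// nnegrE ?exprn_ge0// ltW.
have e2 : absC be ^+ M * absC G2 <= (sg / 2) ^+ J * (1 - r)^-1.
  rewrite ler_pM ?exprn_ge0 ?absC_ge0//.
  apply: (@le_trans _ _ (r ^+ M)); first by rewrite lerXn2r// nnegrE ?absC_ge0// ltW.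
  by rewrite /M exprM lerXn2r// nnegrE ?exprn_ge0// ltW.
apply: le_lt_trans (lerD e1 e2) _.
rewrite exprM -/sg -[X in X + _]mulr1 -mulrDr -/K exprMn -mulrA ltr_pM2l ?exprn_gt0//.
by rewrite mulrC; apply: J0P => /=; apply: leq_trans JP; exact: leq_addl.
Qed.

End double_zero_event.

(** * Almost sure simplicity of the zeros *)

Section rademacher.
Context {R : realType} {d : measure_display} {Omega : measurableType d}.
Context (P : probability Omega R) (eps : nat -> {RV P >-> R}).
Context (rademacher : forall k, P (eps k @^-1` [set 1]) = (2^-1)%:E /\
                                P (eps k @^-1` [set - 1]) = (2^-1)%:E).
Context (indep : mutually_independent P (fun k => eps k : Omega -> R)).

(** Comparing with 1 alone makes the coins measurable and fair without discarding the null set where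
    some [eps k] is not a sign. *)
Definition coin w k : bool := eps k w == 1.

Definition coins n w : {ffun 'I_n -> bool} := [ffun i : 'I_n => coin w i].

Lemma bits_coins n w k : (k < n)%N -> bits (coins n w) k = coin w k.
Proof.
move=> kn; have -> : bits (coins n w) k = coins n w (Ordinal kn) by rewrite -bitsE.
by rewrite ffunE.
Qed.

Let mpre k (B : set R) : measurable B -> measurable (eps k @^-1` B).
Proof. by move=> mB; rewrite -[_ @^-1` _]setTI; exact: measurable_funP. Qed.

Lemma ae_signs : {ae P, forall w, forall k, eps k w = 1 \/ eps k w = - 1}.
Proof.
have : P.-negligible (\bigcup_k (eps k @^-1` (~` [set 1; -1]))).
  apply: negligible_bigcup => k.
  have m1 := mpre k (measurable_set1 1); have mN1 := mpre k (measurable_set1 (-1)).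
  have E : P (~` (eps k @^-1` [set 1] `|` eps k @^-1` [set - 1])) = 0%E.
    rewrite probability_setC; last exact: measurableU.
    rewrite measureU//.
      have [h1 h2] := rademacher k.
      apply: (@etrans _ _ (1 - ((2^-1)%:E + (2^-1)%:E))%E).
        by congr (1 - (_ + _))%E; [exact: h1|exact: h2].
      have -> : ((2^-1)%:E + (2^-1)%:E)%E = 1%E :> \bar R.
        by rewrite -EFinD; congr (_%:E); lra.
      by rewrite subee.
    apply/seteqP; split=> // w [/= -> /eqP].
    by rewrite -addr_eq0 -[1 + 1]/(2%:R) pnatr_eq0.
  apply/negligibleP; first by apply: mpre; apply: measurableC; apply: measurableU.
  exact: E.
apply: negligibleS => w /= /existsNP[k /not_orP[h1 h2]]; exists k => //=.
by case.
Qed.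

Lemma coins_measure n (u : {ffun 'I_n -> bool}) :
  measurable [set w | coins n w = u] /\ P [set w | coins n w = u] = (2^-1 ^+ n)%:E.
Proof.
pose B k : set R := if bits u k then [set 1] else ~` [set 1].
have mB k : measurable (B k) by rewrite /B; case: ifP => _; [|apply: measurableC].
have E : [set w | coins n w = u] = \bigcap_(k in [set` iota 0 n]) (eps k @^-1` B k).
  apply/seteqP; split=> w /=.
    move=> wu k /=; rewrite mem_iota add0n => kn.
    rewrite /B -wu bits_coins// /coin; case: eqP => //.
  move=> h; apply/ffunP => i; rewrite ffunE -bitsE.
  have /= := h i; rewrite mem_iota add0n ltn_ord => /(_ isT).
  by rewrite /B /coin; case: (bits u i) => /= [->|/eqP/negbTE]; rewrite ?eqxx.
split; first by rewrite E; apply: fin_bigcap_measurable => // k _; exact: mpre.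
rewrite E indep ?iota_uniq//.
have half k : P (eps k @^-1` B k) = (2^-1)%:E.
  rewrite /B; case: ifP => _; first by have [] := rademacher k.
  rewrite -preimage_setC probability_setC; last exact: mpre.
  by have [-> _] := rademacher k; rewrite -EFinB; congr (_%:E); lra.
under eq_bigr do rewrite half.
have : forall m, (\prod_(k <- iota m n) (2^-1 : R)%:E)%E = (2^-1 ^+ n)%:E.
  elim: n {u B mB E half} => [|n IH] m; first by rewrite big_nil expr0.
  by rewrite big_cons IH exprS EFinM.
exact.
Qed.

Lemma coins_in_measure n (S : pred {ffun 'I_n -> bool}) :
  measurable [set w | S (coins n w)] /\
  (P [set w | S (coins n w)] <= (#|S|%:R * 2^-1 ^+ n)%:E)%E.
Proof.
have aux (l : seq {ffun 'I_n -> bool}) : measurable [set w | coins n w \in l] /\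
    (P [set w | coins n w \in l] <= ((size l)%:R * 2^-1 ^+ n)%:E)%E.
  elim: l => [|u l [IH1 IH2]].
    rewrite (_ : [set w | _] = set0); last by apply/seteqP; split.
    by rewrite measure0 mul0r.
  have -> : [set w | coins n w \in u :: l] = [set w | coins n w = u] `|` [set w | coins n w \in l].
    apply/seteqP; split=> w /=; rewrite inE.
      by move=> /orP[/eqP|]; [left|right].
    by move=> [->|->]; rewrite ?eqxx// orbT.
  have [m1 p1] := coins_measure u.
  split; first exact: measurableU.
  apply: (le_trans (measureU2 _ m1 IH1)).
  by rewrite /= -natr1 mulrDl mul1r addrC EFinD leeD// p1.
have [m1 p1] := aux (enum S); rewrite -cardE in p1.
by rewrite (_ : [set w | S (coins n w)] = [set w | coins n w \in enum S])//; apply/seteqP; split => w /=; rewrite mem_enum.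
Qed.

Lemma double_zero_negligible (s r : R) : 0 < s -> s < r -> r < 1 -> r ^+ 2 < s ->
  P.-negligible [set w | exists al : Cx R, [/\ s < absC al, absC al < r,
    power_series (sgnC \o coin w) al = 0 &
    power_series (dcoef 1 (sgnC \o coin w)) al = 0]].
Proof.
move=> s0 sr r1 r2s.
have [L [A [B [L0 A0 LB r3 h]]]] := double_zero_near_vanishing s0 sr r1 r2s.
pose S J : pred {ffun 'I_(A * J + B * J) -> bool} :=
  fun u => `[< near_vanishing s r L J (A * J) (B * J) (bits u) >].
pose G J := [set w | S J (coins (A * J + B * J) w)].
have mG J : measurable (G J) by have [] := coins_in_measure (S J).
(* The count gives (A J)^2 / 2^J, and 1 / 2 <= (3 / 4)^2 brings it into the form covered by
   [cvg_n_geo]. *)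
have PG J : (P (G J) <= (A%:R ^+ 2 * (J.+1%:R * (3 / 4) ^+ J) ^+ 2)%:E)%E.
  have [_ p] := coins_in_measure (S J); apply: le_trans p _; rewrite lee_fin.
  have : (#|S J| * 2 ^ J <= (A * J) ^ 2 * 2 ^ (A * J + B * J))%N.
    by apply: near_vanishing_card => //; rewrite ?leq_mul2r ?LB ?orbT// ltW// (lt_trans s0).
  have E : ((A * J) ^ 2)%:R = A%:R ^+ 2 * J%:R ^+ 2 :> R by rewrite natrX natrM exprMn.
  rewrite -(ler_nat R) natrM [X in _ <= X]natrM E !natrX exprVn ler_pdivrMr ?exprn_gt0//.
  have : 1 <= 2 ^+ J * (3 / 4) ^+ J ^+ 2 :> R.
    by rewrite exprAC -exprMn exprn_ege1//; lra.
  rewrite [(J.+1%:R * _) ^+ 2]exprMn; move: (_ ^+ J ^+ 2).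
  have : J%:R ^+ 2 <= J.+1%:R ^+ 2 :> R by rewrite lerXn2r ?nnegrE// ler_nat.
  have : 0 < 2 ^+ (A * J + B * J) :> R by rewrite exprn_gt0.
  have : 0 <= (A%:R : R) ^+ 2 by rewrite sqr_ge0.
  have : 0 <= (J%:R : R) ^+ 2 by rewrite sqr_ge0.
  have : 0 < (2 : R) ^+ J by rewrite exprn_gt0.
  move: (2 ^+ _) (2 ^+ J) (J%:R ^+ 2) (A%:R ^+ 2) (J.+1%:R ^+ 2) (#|_|%:R).
  move=> y x j a j' c x0 j0 a0 y0 jj' q xq cx.
  rewrite -(ler_pM2r x0); apply: (le_trans cx).
  rewrite (_ : a * (j' * q) * y * x = a * y * (j' * (x * q))); last by ring.
  rewrite (_ : a * j * y = a * y * (j * 1)); last by ring.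
  by apply: ler_wpM2l; [rewrite mulr_ge0// ltW|exact: ler_pM].
(* The threshold on J varies with the signs, so the event is covered by the union over J0 of these
   intersections, each of probability at most P (G J) for every J >= J0. *)
have PN J0 : P.-negligible (\bigcap_(J in [set J | (J0 <= J)%N]) G J).
  have mN : measurable (\bigcap_(J in [set J | (J0 <= J)%N]) G J).
    by apply: bigcap_measurableType => J _; exact: mG.
  apply/negligibleP => //; apply/eqP; rewrite -measure_le0.
  apply/lee_addgt0Pr => e e0; rewrite add0e.
  have lim : (fun J => A%:R ^+ 2 * (J.+1%:R * (3 / 4) ^+ J) ^+ 2) @ \oo --> (0 : R).
    have h1 : (fun J => J.+1%:R * (3 / 4) ^+ J) @ \oo --> (0 : R) by apply: cvg_n_geo; lra.
    have -> : 0 = A%:R ^+ 2 * (0 * 0) :> R by rewrite !mulr0.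
    by apply: cvgMr; exact: (cvgM h1 h1).
  have [J1 _ hJ] := cvg0_lt lim e0.
  apply: le_trans (_ : P (G (maxn J0 J1)) <= _)%E.
    by apply: le_measure; rewrite ?inE// => w; apply; rewrite /= leq_maxl.
  by apply: (le_trans (PG _)); rewrite lee_fin ltW// hJ//= leq_maxr.
apply: negligibleS (negligible_bigcup PN) => w [al [sal alr f0 f1]].
have [J0 _ hJ] := h (coin w) al sal alr f0 f1.
exists J0 => // J /= J0J; apply/asboolP; apply: near_vanishing_ext (hJ J J0J) => i iN.
by rewrite bits_coins.
Qed.

(** Countably many annuli with rational radii q1 < q2 < 1 and q2^2 < q1 cover the punctured disk: q2
    is taken between |al| and its square root, then q1 between q2^2 and |al|. The centre is not a
    zero because F(0) is a sign. *)
Lemma ae_simple_zeros : {ae P, forall w, forall alpha : Cx R,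
  zeros (F_series (eps ^~ w)) alpha -> derive1 (F_series (eps ^~ w)) alpha != 0}.
Proof.
pose D (q : rat * rat) := [set w | exists al : Cx R, [/\ ratr q.1 < absC al, absC al < ratr q.2,
    power_series (sgnC \o coin w) al = 0 & power_series (dcoef 1 (sgnC \o coin w)) al = 0]].
pose ok (q : rat * rat) := [&& 0 < ratr q.1 :> R, ratr q.1 < ratr q.2 :> R,
  ratr q.2 < 1 :> R & ratr q.2 ^+ 2 < ratr q.1 :> R].
have DN : P.-negligible (\bigcup_n (if @unpickle (rat * rat)%type n is Some q
    then [set w | ok q /\ D q w] else set0)).
  apply: negligible_bigcup => n; case: unpickle => [q|]; last exact: negligible_set0.
  have [/and4P[h1 h2 h3 h4]|okq] := boolP (ok q).
    by apply: negligibleS (double_zero_negligible h1 h2 h3 h4) => w [].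
  by apply: negligibleS (negligible_set0 P) => w [].
apply: negligibleS (negligibleU ae_signs DN) => w /=.
have [e1|] := pselect (forall k, eps k w = 1 \/ eps k w = - 1); last by left.
move=> /existsNP[al /not_implyP[[al1 f0] /negP]]; rewrite negbK => /eqP f1; right.
have eE : (fun k => embC (eps k w)) = sgnC \o coin w :> (nat -> Cx R).
  apply/funext => k /=; rewrite /coin; case: (e1 k) => ->; rewrite /sgnC ?eqxx//.
  by rewrite eqNr oner_eq0 embCN.
rewrite diskE in al1.
rewrite /F_series eE in f0 f1.
rewrite power_series_derive1// in f1; last exact/is_signs_bounded/sgnC_signs.
have al0 : 0 < absC al.
  rewrite absC_gt0; apply/negP => /eqP alE; move: f0; rewrite alE.
  rewrite (_ : sgnC \o coin w = cat_coef 1 (sgnC \o coin w) (sgnC \o (coin w \o succn))); last first.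
    by apply/funext => -[|k]; rewrite /cat_coef//= subn1.
  rewrite power_series_cat ?absC0 ?ltr01//; last 2 first.
  - exact: is_signs_bounded (sgnC_signs (coin w)).
  - exact: is_signs_bounded (sgnC_signs (coin w \o succn)).
  - rewrite expr1 mul0r addr0 /psum big_ord1 expr0 mulr1 /= /sgnC.
    by case: (coin w 0) => /eqP; rewrite ?oppr_eq0 oner_eq0.
have [q2 /[!in_itv]/= /andP[q2l q2r]] : exists q, ratr q \in `]absC al, Num.sqrt (absC al)[.
  by apply: rat_in_itvoo; rewrite -[X in X < _]sqr_sqrtr ?absC_ge0// expr2 gtr_pMl ?sqrtr_gt0// -sqrtr1 ltr_sqrt.
have q2x : ratr q2 ^+ 2 < absC al.
  by rewrite -[X in _ < X]sqr_sqrtr ?absC_ge0// ltrXn2r// ?nnegrE ?sqrtr_ge0// ltW// (lt_trans al0).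
have [q1 /[!in_itv]/= /andP[q1l q1r]] := rat_in_itvoo q2x.
have okq : ok (q1, q2).
  have h1 : 0 < ratr q1 :> R by apply: le_lt_trans q1l; exact: sqr_ge0.
  have h2 : ratr q1 < ratr q2 :> R by exact: lt_trans q1r q2l.
  have h3 : ratr q2 < 1 :> R by apply: (lt_trans q2r); rewrite -[X in _ < X]sqrtr1 ltr_sqrt.
  by apply/and4P.
exists (pickle (q1, q2)); first exact: I.
by rewrite pickleK; split; [exact: okq|exists al; split].
Qed.

End rademacher.

(** * From almost sure convergence to convergence in distribution *)

Section expectation.
Context {R : realType} {d : measure_display} {T : measurableType d}.
Import HBNNSimple.

(* [f] and [g] need not be measurable: the integral of a nonnegative function
   is the supremum over the simple functions below it, and these can be cut off
   on [N]. *)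
Lemma le_integral_off_null (mu : {measure set T -> \bar R}) (f g : T -> \bar R) N :
  measurable N -> mu N = 0%E -> (forall x, 0 <= f x)%E -> (forall x, 0 <= g x)%E ->
  (forall x, ~ N x -> f x = g x) -> (\int[mu]_x f x <= \int[mu]_x g x)%E.
Proof.
move=> mN N0 f0 g0 fg; rewrite !ge0_integralTE//.
apply/ge_ereal_sup => _ [h hf <-].
have mCN : measurable (~` N) by exact: measurableC.
apply: le_trans (_ : sintegral mu (proj_nnsfun h mCN) <= _)%E.
  rewrite -!integralT_nnsfun le_eqVlt; apply/orP; left; apply/eqP.
  apply: ge0_ae_eq_integral => //; try (by apply/measurable_EFinP);
    try (by move=> x _; rewrite lee_fin).
  exists N; split=> // x /= h1; apply: contrapT => Nx; apply: h1 => _.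
  by rewrite /= mindicE mem_set// mulr1.
apply: ereal_sup_ubound; exists (proj_nnsfun h mCN) => // x /=.
rewrite mindicE; case: (pselect (N x)) => Nx; first by rewrite memNset ?mulr0//; apply.
by rewrite mem_set// mulr1 -fg.
Qed.

Lemma integral_off_null (mu : {measure set T -> \bar R}) (f g : T -> \bar R) N :
  measurable N -> mu N = 0%E -> (forall x, ~ N x -> f x = g x) ->
  (\int[mu]_x f x = \int[mu]_x g x)%E.
Proof.
move=> mN N0 fg; rewrite integralE [RHS]integralE; congr (_ - _)%E; apply/eqP; rewrite eq_le;
  apply/andP; split; apply: (le_integral_off_null mN N0) => // x Nx;
  by rewrite ?funeposE ?funenegE fg.
Qed.

(** The variables X n may fail to be measurable because of their values on N. The products of X' n
    with the indicator of the complement of N are measurable and converge everywhere, and have the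
    same expectations under h. *)
Lemma cvg_in_distribution_off_null (P : probability T R) (X X' : nat -> T -> R) Y N :
  measurable N -> P N = 0%E -> (forall n, measurable_fun [set: T] (X' n)) ->
  (forall n w, ~ N w -> X n w = X' n w) ->
  (forall w, ~ N w -> X ^~ w @ \oo --> Y w) -> cvg_in_distribution P X Y.
Proof.
move=> mN N0 mX' XX' XY; have mCN : measurable (~` N) by exact: measurableC.
pose X1 n := X' n \* \1_(~` N); pose Y1 := Y \* (\1_(~` N) : T -> R).
have mX1 n : measurable_fun [set: T] (X1 n).
  by apply: measurable_funM => //; exact: measurable_indic.
have onCN (Z : T -> R) w : ~ N w -> (Z \* \1_(~` N)) w = Z w.
  by move=> Nw; rewrite /= indicE mem_set// mulr1.
have X1Y1 w : X1 ^~ w @ \oo --> Y1 w.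
  have [Nw|Nw] := pselect (N w).
    rewrite /X1 /Y1 /= indicE memNset; last by apply.
    by rewrite mulr0; under eq_fun do rewrite mulr0; exact: cvg_cst.
  rewrite /Y1 onCN// (_ : X1 ^~ w = X ^~ w); first exact: XY.
  by apply/funext => n; rewrite /X1 onCN// XX'.
have mY1 : measurable_fun [set: T] Y1 by exact: (measurable_fun_cvg mX1).
have aeN (p : T -> Prop) : (forall w, ~ N w -> p w) -> {ae P, forall w, p w}.
  by move=> h; exists N; split=> // w /= pw; apply: contrapT => /h.
split=> [n||h ch [M [_ hM]]].
- by exists (X1 n) => //; apply: aeN => w Nw; rewrite /X1 onCN// XX'.
- by exists Y1 => //; apply: aeN => w Nw; rewrite /Y1 onCN.
have EE (Z Z' : T -> R) : (forall w, ~ N w -> Z w = Z' w) -> ('E_P[h \o Z] = \int[P]_w (h (Z' w))%:E)%E.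
  move=> ZZ'; rewrite unlock; apply: (integral_off_null mN N0) => w Nw.
  by rewrite /= ZZ'.
rewrite (EE _ Y1); last by move=> w Nw; rewrite /Y1 onCN.
under eq_fun => n.
  rewrite (EE _ (X1 n)); last by move=> w Nw; rewrite /X1 onCN// XX'.
  over.
have mh : measurable_fun [set: R] h by exact: continuous_measurable_fun.
have [|||||_ _] := @dominated_convergence _ T R P setT measurableT
  (fun n w => (h (X1 n w))%:E) (fun w => (h (Y1 w))%:E) (cst (M + 1)%:E).
- by move=> n; apply/measurable_EFinP; exact: measurableT_comp.
- by apply/measurable_EFinP; exact: measurableT_comp.
- apply: aeW => w _; apply: cvg_EFin; first exact: nearW.
  by apply: continuous_cvg => //; exact: ch.
- by apply: finite_measure_integrable_cst.
(* [bounded_fun] provides bounds strictly above M only, hence M + 1. *)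
- apply: aeW => w n _; rewrite /= lee_fin; by apply: (hM (M + 1)); rewrite ?ltrDl.
exact.
Qed.

End expectation.

(** * Dependence on finitely many signs, and the conclusion *)

Lemma sum_zeros_trunc_ext (R : realType) (e e' : nat -> R) n (g : Cx R * hyperspace (Cx R) -> R) :
  (forall k, (k < n.+1)%N -> e k = e' k) ->
  sum_zeros (F_trunc e n) (fun al => g (al, tag_trunc e n al)) =
  sum_zeros (F_trunc e' n) (fun al => g (al, tag_trunc e' n al)).
Proof.
move=> ee; have FE : F_trunc e n = F_trunc e' n.
  by apply/funext => z; apply: eq_bigr => k _; rewrite ee.
by rewrite /tag_trunc /roots_ext FE.
Qed.

Theorem theorem3 (R : realType) (d : measure_display) (Omega : measurableType d)
    (P : probability Omega R) (eps : nat -> {RV P >-> R})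
    (rademacher : forall k, P (eps k @^-1` [set 1]) = (2^-1)%:E /\
                            P (eps k @^-1` [set - 1]) = (2^-1)%:E)
    (indep : mutually_independent P (fun k => eps k : Omega -> R)) :
  {ae P, forall w, forall alpha : Cx R,
     zeros (F_series (eps ^~ w)) alpha ->
     derive1 (F_series (eps ^~ w)) alpha != 0} /\
  (forall g : Cx R * hyperspace (Cx R) -> R, test_function g ->
     cvg_in_distribution P
       (fun n w => sum_zeros (F_trunc (eps ^~ w) n)
          (fun alpha => g (alpha, tag_trunc (eps ^~ w) n alpha)))
       (fun w => sum_zeros (F_series (eps ^~ w))
          (fun alpha => g (alpha, tag_limit (eps ^~ w) alpha)))).
Proof.
have simple := ae_simple_zeros rademacher indep.
split=> [//|g tg].
have [N [mN N0 sN]] := negligibleU (ae_signs rademacher) simple.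
have good w : ~ N w -> (forall k, eps k w = 1 \/ eps k w = - 1) /\
    forall al : Cx R, zeros (F_series (eps ^~ w)) al -> derive1 (F_series (eps ^~ w)) al != 0.
  by move=> Nw; split; apply: contrapT => h; apply: Nw; apply: sN; [left|right].
(* The sum over the zeros of F_n is rewritten as a function of n + 1 coins: its preimages are events
   on finitely many patterns, and off N the coins determine the signs. *)
pose sgn n (u : {ffun 'I_n -> bool}) k : R := if bits u k then 1 else - 1.
pose Phi n (u : {ffun 'I_n.+1 -> bool}) : R := sum_zeros (F_trunc (sgn _ u) n)
  (fun al => g (al, tag_trunc (sgn _ u) n al)).
apply: (@cvg_in_distribution_off_null _ _ _ P _ (fun n w => Phi n (coins eps n.+1 w)) _ N) => //.
- move=> n _ B mB; rewrite setTI.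
  have [mS _] := coins_in_measure rademacher indep (fun u => `[< B (Phi n u) >]).
  rewrite (_ : _ @^-1` B = [set w | `[< B (Phi n (coins eps n.+1 w)) >]])//.
  by apply/seteqP; split=> w /=; [move/asboolP|move=> ?; apply/asboolP].
- move=> n w /good[e1 _]; apply: sum_zeros_trunc_ext => k kn.
  rewrite /sgn bits_coins// /coin; case: (e1 k) => ->; first by rewrite eqxx.
  by rewrite eqNr oner_eq0.
- by move=> w /good[e1 e2]; exact: sum_zeros_cvg.
Qed.
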